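(* Let $n,N\ge1$, $q\in(0,1)$, and let $x$, $\mathbf u=(u_1,\dots,u_N)$, $\mathbf s^{(h)}=(s^{(h)}_1,\dots,s^{(h)}_N)$, $\mathbf v=(v_1,\dots,v_n)$, $\mathbf s^{(v)}=(s^{(v)}_1,\dots,s^{(v)}_n)$ be complex parameters for which all weights below are well defined. Consider the cylinder with rows indexed by $0,1,\dots,N$ (in this cyclic order from bottom to top), where row $0$ carries the horizontal parameters $(xq^{1/2},q^{-1/2})$ and row $j\in\{1,\dots,N\}$ carries $(u_j,s_j^{(h)})$; that is, the queue weight at $(-m,0)$ is $\mathbb W^{(-m)}_{q^{-1/2},\,s_m^{(v)},\,xq^{1/2}/v_m}$ and at $(-m,j)$ it is $\mathbb W^{(-m)}_{s_j^{(h)},\,s_m^{(v)},\,u_j/v_m}$. Let $\langle\emptyset|\mathfrak Q|c,\mathbf V\rangle$ ($c\in\{0,\dots,n\}$, $\mathbf V=(\mathbf V(1),\dots,\mathbf V(N))$, $\mathbf V(j)\in\mathbb Z_{\ge0}^n$) denote its partition function with empty left boundary and right boundary $c$ in row $0$ and $\mathbf V(j)$ in row $j$. Then $$\langle\emptyset|\,\mathfrak Q\,\mathfrak S(x,\mathbf u;\mathbf s^{(h)})=\langle\emptyset|\,\mathfrak Q ,$$ i.e. $\sum_{(c,\mathbf V)}\langle\emptyset|\mathfrak Q|c,\mathbf V\rangle\langle c,\mathbf V|\mathfrak S|c',\mathbf V'\rangle=\langle\emptyset|\mathfrak Q|c',\mathbf V'\rangle$ for all $(c',\mathbf V')$, where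 $\mathfrak S$ is the straight cylinder operator.
   Context: **Notation.** $(a;q)_k=\prod_{i=0}^{k-1}(1-aq^i)$, $k\in\mathbb Z_{\ge0}\cup\{\infty\}$; $|\mathbf A|=\sum_iA_i$; $\mathbf e_1,\dots,\mathbf e_n$ standard basis vectors, and a color $c\in\{0,1,\dots,n\}$ is identified with $\mathbf e_c$ if $c\ge1$ and with the zero tuple if $c=0$. **Fused weights.** For $\mathbf A,\mathbf B\in\mathbb Z_{\ge0}^n$, $A_i\le B_i$: $$\Phi(\mathbf A,\mathbf B;x,y)=\frac{(x;q)_{|\mathbf A|}(y/x;q)_{|\mathbf B-\mathbf A|}}{(y;q)_{|\mathbf B|}}(y/x)^{|\mathbf A|}q^{\sum_{i<j}(B_i-A_i)A_j}\prod_{i=1}^n\frac{(q;q)_{B_i}}{(q;q)_{A_i}(q;q)_{B_i-A_i}},$$ $$W_{x,\mathsf L,\mathsf M}(\mathbf A,\mathbf B;\mathbf C,\mathbf D)=\mathbf 1_{\mathbf A+\mathbf B=\mathbf C+\mathbf D}\,x^{|\mathbf D|-|\mathbf B|}q^{\mathsf L|\mathbf A|}q^{-\mathsf M|\mathbf D|}\sum_{\mathbf P}\Phi(\mathbf C-\mathbf P,\mathbf C+\mathbf D-\mathbf P;q^{\mathsf L-\mathsf M}x,q^{-\mathsf M}x)\,\Phi(\mathbf P,\mathbf B;q^{-\mathsf L}/x,q^{-\mathsf L}),$$ sum over $0\le P_i\le\min(B_i,C_i)$; it depends on $\mathsf L,\mathsf M$ only through $q^{\mathsf L},q^{\mathsf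 M}$, viewed as complex parameters. Here $\mathbf A,\mathbf B,\mathbf C,\mathbf D$ are the arrow configurations entering from below, entering from the left, exiting above, exiting to the right. Put $L_{s,x}(\mathbf A,k;\mathbf C,\ell)=W_{x/s,1,\mathsf N}(\mathbf A,\mathbf e_k\mathbf 1_{k\ge1};\mathbf C,\mathbf e_\ell\mathbf 1_{\ell\ge1})$ with $q^{\mathsf N}=s^{-2}$, $k,\ell\in\{0,\dots,n\}$. **Queue weights.** For $1\le m\le n$, $\mathbf B,\mathbf D\in\mathbb Z^n_{\ge0}$ and tuples $\mathbf A,\mathbf C$ with $A_m=C_m=+\infty$ and other coordinates in $\mathbb Z_{\ge0}$, $$\begin{aligned}\mathbb W^{(-m)}_{s_1,s_2,u}(\mathbf A,\mathbf B;\mathbf C,\mathbf D)={}&\mathbf 1_{\mathbf A+\mathbf B=\mathbf C+\mathbf D}\mathbf 1_{D_1=\dots=D_{m-1}=0}\frac{(s_1^{-1}s_2u;q)_\infty}{(s_1s_2u;q)_\infty}\sum_{\mathbf P}\frac{(s_1s_2/u;q)_{|\mathbf P|}(s_1u/s_2;q)_{|\mathbf B-\mathbf P|}}{(s_1^2;q)_{|\mathbf B|}}q^{\sum_{i<j}(B_i-P_i)P_j}\prod_{i=1}^n\frac{(q;q)_{B_i}}{(q;q)_{P_i}(q;q)_{B_i-P_i}}\\&\times\Bigl(\frac{s_1s_2}u\Bigr)^{|\mathbf B|-|\mathbf P|}\Bigl(\frac{us_2}{s_1}\Bigr)^{|\mathbf D|}q^{\sum_{m\le i<j\le n}D_i(C_j-P_j)}\frac{(s_1^2;q)_{|\mathbf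 D|}}{(q;q)_{D_m}}\prod_{i=m+1}^n\frac{(q;q)_{C_i-P_i+D_i}}{(q;q)_{C_i-P_i}(q;q)_{D_i}},\end{aligned}$$ sum over $0\le P_i\le\min(B_i,C_i)$; $\mathbf 1_{\mathbf A+\mathbf B=\mathbf C+\mathbf D}$ imposes equality in coordinates $i\ne m$. When $s_1=q^{-\mathsf L/2}$ with $\mathsf L\in\mathbb Z_{\ge1}$, only $|\mathbf B|,|\mathbf D|\le\mathsf L$ are allowed (so row $0$ carries at most one arrow per horizontal edge). **Cylinder partition function with empty left boundary.** Vertices are $(-m,j)$, $1\le m\le n$, $j\in\mathbb Z/(N+1)\mathbb Z$. If each color $1,\dots,n$ occurs at least once in the right boundary $(\mathbf R(j))_j$, the partition function is the (convergent) sum of $\prod_{m,j}\mathbb W_{m,j}(\mathbf A^{(m,j)},\mathbf H^{(m+1,j)};\mathbf A^{(m,j+1)},\mathbf H^{(m,j)})$ over all horizontal configurations with $\mathbf H^{(n+1,j)}=\mathbf 0$, $\mathbf H^{(1,j)}=\mathbf R(j)$, and all vertical tuples $\mathbf A^{(m,j)}$ ($j$ cyclic) with $(\mathbf A^{(m,j)})_m=+\infty$, $(\mathbf A^{(m,j)})_i=0$ for $i<m$, $(\mathbf A^{(m,j)})_i\in\mathbb Z_{\ge0}$ for $i>m$. If some color is missing from the right boundary, the partition function is set to $0$. **Straight cylinder operator.** On $\mathbb C^{n+1}\otimes V^{\otimes N}$, where $\mathbb C^{n+1}$ (factor $0$) has basis $|c\rangle$, $0\le c\le n$, and each $V$ has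 basis $|\mathbf A\rangle$, $\mathbf A\in\mathbb Z^n_{\ge0}$, let $\mathscr L^{(0,j)}_{s,z}$ act on factors $0$ and $j$ by $\langle k,\mathbf A|\mathscr L_{s,z}|\ell,\mathbf B\rangle=L_{s,z}(\mathbf A,k;\mathbf B,\ell)$ and as identity on the other factors. Then $$\mathfrak S(x,\mathbf u;\mathbf s^{(h)})=\mathscr L^{(0,N)}_{s^{(h)}_N,xu_N^{-1}}\mathscr L^{(0,N-1)}_{s^{(h)}_{N-1},xu_{N-1}^{-1}}\cdots\mathscr L^{(0,1)}_{s^{(h)}_1,xu_1^{-1}},$$ acting on row vectors (leftmost factor first). *)

(* Defs.v *)
From HB Require Import structures.
From mathcomp Require Import all_boot all_order all_algebra.
From mathcomp Require Import finmap complex.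
From mathcomp Require Import boolp classical_sets functions cardinality fsbigop.
From mathcomp Require Import reals topology normedtype sequences.
From mathcomp Require summability.
Set Implicit Arguments.
Unset Strict Implicit.
Unset Printing Implicit Defensive.
Import Order.TTheory GRing.Theory Num.Theory.
Import numFieldNormedType.Exports.
Local Open Scope classical_set_scope.
Local Open Scope ring_scope.

(* Colors 1, ..., n are indexed by 'I_n (color i+1 <-> index i). *)
Notation conf n := {ffun 'I_n -> nat}.

(* Vertical tuples of the queue vertices; None stands for +oo. *)
Notation vconf n := {ffun 'I_n -> option nat}.

Definition cadd n (A B : conf n) : conf n := [ffun i => (A i + B i)%N].
Definition csub n (A B : conf n) : conf n := [ffun i => (A i - B i)%N].
Definition czero n : conf n := [ffun => 0%N].
Definition ctot n (A : conf n) : nat := (\sum_i A i)%N.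

(* The tuple attached to a color c in {0, ..., n}: e_c if c >= 1, 0 if c = 0. *)
Definition color_conf n (c : 'I_n.+1) : conf n :=
  [ffun i : 'I_n => nat_of_bool (i.+1 == c :> nat)].

(* \sum_{i<j} A_i B_j *)
Definition ccross n (A B : conf n) : nat :=
  (\sum_(i < n) \sum_(j < n | (i < j)%N) A i * B j)%N.

(* Value of a coordinate that is known to be finite. *)
Definition fin_part (a : option nat) : nat := odflt 0%N a.

Definition min_oo (b : nat) (c : option nat) : nat :=
  if c is Some c' then minn b c' else b.

Section Weights.
Variables (R : realType) (q : R).
Implicit Types (a s x y u : R[i]).

Definition qpoch a (k : nat) : R[i] := \prod_(i < k) (1 - a * q%:C%C ^+ i).

Definition qpoch_inf a : R[i] := limn (qpoch a : nat -> R[i]^o).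

Definition Phi n (A B : conf n) x y : R[i] :=
  qpoch x (ctot A) * qpoch (y / x) (ctot (csub B A)) / qpoch y (ctot B)
  * (y / x) ^+ ctot A * q%:C%C ^+ ccross (csub B A) A
  * \prod_(i < n) (qpoch q%:C%C (B i)
                   / (qpoch q%:C%C (A i) * qpoch q%:C%C (B i - A i)%N)).

(* qL and qM stand for q^L and q^M. *)
Definition fusedW n x (qL qM : R[i]) (A B C D : conf n) : R[i] :=
  if cadd A B == cadd C D then
    x ^ ((ctot D)%:Z - (ctot B)%:Z) * qL ^+ ctot A * qM ^- ctot D
    * \sum_(P \in [set P : conf n | forall i, (P i <= minn (B i) (C i))%N])
        (Phi (csub C P) (csub (cadd C D) P) (qL / qM * x) (x / qM)
         * Phi P B (qL^-1 / x) qL^-1)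
  else 0.

Definition Lweight n s x (A : conf n) (k : 'I_n.+1) (C : conf n) (l : 'I_n.+1)
    : R[i] :=
  fusedW (x / s) q%:C%C (s ^- 2) A (color_conf k) C (color_conf l).

(* Number of arrows allowed on a horizontal edge of a queue row with spin
   parameter s: if s = q^{-L/2}, L >= 1, at most L arrows. *)
Definition queue_allowed s (k : nat) : Prop :=
  forall L : nat, (0 < L)%N -> s = ((Num.sqrt q)^- L)%:C%C -> (k <= L)%N.

(* The weight W^{(-m)}, where m : 'I_n is the index of the distinguished color.
   It is only meant for A, C equal to None exactly at m. *)
Definition queueW n (m : 'I_n) (s1 s2 u : R[i])
    (A : vconf n) (B : conf n) (C : vconf n) (D : conf n) : R[i] :=
  if `[< [/\ forall i, i != m ->
               (fin_part (A i) + B i = fin_part (C i) + D i)%N,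
             forall i : 'I_n, (i < m)%N -> D i = 0%N,
             queue_allowed s1 (ctot B) & queue_allowed s1 (ctot D)] >] then
    qpoch_inf (s1^-1 * s2 * u) / qpoch_inf (s1 * s2 * u)
    * \sum_(P \in [set P : conf n | forall i, (P i <= min_oo (B i) (C i))%N])
        (qpoch (s1 * s2 / u) (ctot P)
         * qpoch (s1 * u / s2) (ctot (csub B P)) / qpoch (s1 ^+ 2) (ctot B)
         * q%:C%C ^+ ccross (csub B P) P
         * \prod_(i < n) (qpoch q%:C%C (B i)
                          / (qpoch q%:C%C (P i) * qpoch q%:C%C (B i - P i)%N))
         * (s1 * s2 / u) ^+ (ctot B - ctot P) * (u * s2 / s1) ^+ ctot D
         * q%:C%C ^+ (\sum_(i < n | (m <= i)%N) \sum_(j < n | (i < j)%N)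
                        D i * (fin_part (C j) - P j))%N
         * (qpoch (s1 ^+ 2) (ctot D) / qpoch q%:C%C (D m))
         * \prod_(i < n | (m < i)%N)
             (qpoch q%:C%C (fin_part (C i) - P i + D i)%N
              / (qpoch q%:C%C (fin_part (C i) - P i)%N * qpoch q%:C%C (D i))))
  else 0.

(* Nonvanishing of all the denominators in queueW. *)
Definition queueW_well_defined (s1 s2 u : R[i]) : Prop :=
  [/\ s1 != 0, s2 != 0, u != 0, qpoch_inf (s1 * s2 * u) != 0
    & forall k, queue_allowed s1 k -> qpoch (s1 ^+ 2) k != 0].

(* Nonvanishing of all the denominators in Lweight: the first Phi has
   y = s^2 (x / s); in the second one, y = q^{-1} and |B| <= 1. *)
Definition Lweight_well_defined s x : Prop :=
  [/\ s != 0, x != 0 & forall k, qpoch (s * x) k != 0].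

End Weights.

(* Basis |c> (x) |V(1)> (x) ... (x) |V(N)> of C^{n+1} (x) V^{(x) N}. *)
Notation state n N := ('I_n.+1 * {ffun 'I_N -> conf n})%type.

Section Cylinder.
Variables (R : realType) (q : R) (n N : nat).

(* Horizontal edges (k, j), k : 'I_n.+1, carry H^{(k+1,j)}; the column of index
   m : 'I_n is column -(m+1), between H^{(m+2,j)} on its left and H^{(m+1,j)} on
   its right. The vertical tuple at (m, j) enters the vertex of column m and
   row j from below. *)
Local Notation cylconf :=
  ({ffun 'I_n.+1 * 'I_N.+1 -> conf n} * {ffun 'I_n * 'I_N.+1 -> vconf n})%type.

Definition right_edge (m : 'I_n) : 'I_n.+1 := widen_ord (leqnSn n) m.
Definition left_edge (m : 'I_n) : 'I_n.+1 := lift ord0 m.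

Definition cyl_admissible (Rb : 'I_N.+1 -> conf n) (F : cylconf) : Prop :=
  [/\ forall j, F.1 (ord_max, j) = czero n,
      forall j, F.1 (ord0, j) = Rb j
    & forall (m : 'I_n) (j : 'I_N.+1),
        [/\ F.2 (m, j) m = None,
            forall i : 'I_n, (i < m)%N -> F.2 (m, j) i = Some 0%N
          & forall i : 'I_n, (m < i)%N -> F.2 (m, j) i != None]].

(* Row j has horizontal parameters (ru j, rs j), column m has vertical
   parameters (v m, sv m). ordS is the cyclic successor on 'I_N.+1. *)
Definition cyl_weight (ru rs : 'I_N.+1 -> R[i]) (v sv : 'I_n -> R[i])
    (F : cylconf) : R[i] :=
  \prod_(m < n) \prod_(j < N.+1)
    queueW q m (rs j) (sv m) (ru j / v m)
      (F.2 (m, j)) (F.1 (left_edge m, j))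
      (F.2 (m, ordS j)) (F.1 (right_edge m, j)).

Definition cyl_partition (ru rs : 'I_N.+1 -> R[i]) (v sv : 'I_n -> R[i])
    (Rb : 'I_N.+1 -> conf n) : R[i] :=
  if [forall i : 'I_n, exists j : 'I_N.+1, (0 < Rb j i)%N] then
    @summability.sum cylconf R[i] R[i]^o
      (fun F => if `[< cyl_admissible Rb F >] then cyl_weight ru rs v sv F
                else 0)
  else 0.

Local Notation state := (state n N).

(* Linear operators on row vectors are given by their matrices; the matrices
   below have finitely many nonzero entries in each column, so that all the
   sums over states have finite support. *)
Definition opmx : Type := state -> state -> R[i].

Definition op_id : opmx := fun a b => (a == b)%:R.

Definition op_mul (S T : opmx) : opmx :=
  fun a b => \sum_(k \in [set: state]) (S a k * T k b).

Definition op_act (phi : state -> R[i]) (S : opmx) : state -> R[i] :=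
  fun b => \sum_(a \in [set: state]) (phi a * S a b).

(* L^{(0,j)}_{s,z}, acting on factors 0 and j. *)
Definition Lop (j : 'I_N) (s z : R[i]) : opmx :=
  fun a b =>
    if [forall i, (i != j) ==> (a.2 i == b.2 i)] then
      Lweight q s z (a.2 j) a.1 (b.2 j) b.1
    else 0.

(* L^{(0,N)} L^{(0,N-1)} ... L^{(0,1)} *)
Definition straight_op (x : R[i]) (u sh : 'I_N -> R[i]) : opmx :=
  foldr op_mul op_id
    [seq Lop j (sh j) (x * (u j)^-1) | j <- rev (enum 'I_N)].

(* Data on the rows 0, 1, ..., N from data on row 0 and on the rows 1, ..., N. *)
Definition with_row0 (T : Type) (t0 : T) (t : 'I_N -> T) (j : 'I_N.+1) : T :=
  if unlift ord0 j is Some j' then t j' else t0.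

(* <emptyset| Q |c, V> *)
Definition queue_vector (x : R[i]) (u sh : 'I_N -> R[i]) (v sv : 'I_n -> R[i])
    (b : state) : R[i] :=
  cyl_partition
    (with_row0 (x * (Num.sqrt q)%:C%C) u)
    (with_row0 ((Num.sqrt q)%:C%C)^-1 sh)
    v sv
    (with_row0 (color_conf b.1) b.2).

Definition params_well_defined (x : R[i]) (u sh : 'I_N -> R[i])
    (v sv : 'I_n -> R[i]) : Prop :=
  [/\ (forall j, u j != 0) /\ (forall m, v m != 0),
      forall m, queueW_well_defined q ((Num.sqrt q)%:C%C)^-1 (sv m)
                  (x * (Num.sqrt q)%:C%C / v m),
      forall m j, queueW_well_defined q (sh j) (sv m) (u j / v m)
    & forall j, Lweight_well_defined q (sh j) (x * (u j)^-1)].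

End Cylinder.

(* Main.v *)
(** Let row 0 be crossed with row j by the operator L^{(0,j)}. Vertex by vertex, the
    queue weights of the two rows satisfy a Yang-Baxter equation with the L-weight,
    so an L-vertex standing to the right of a column of queue vertices may be moved
    to the left of that column, at the cost of exchanging the positions of the rows 0
    and j around the cylinder. After crossing all n columns it meets the empty left
    boundary, on which it acts trivially. The factors L^{(0,N)}, ..., L^{(0,1)} of the
    straight cylinder operator thus carry row 0 once around the cylinder, which
    restores the cyclic order of the rows and hence the partition function.

    The Yang-Baxter equation itself is the composition of two exchange relations, one
    for each of the two factors of the summand of the queue weight; in both, the sum
    over the color of the inner edge telescopes. If s_1^2 = q^{-L}, the terms having
    more than L arrows on an edge drop out, because s_1^2 q^L = 1 makes the sum over P
    vanish. The sums over the vertical tuples converge absolutely: by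
    conservation a column is determined by one of its tuples A, and the row in which
    the distinguished color leaves the column contributes a factor q^{|A|}. *)

(* All parameters are ratios of four numbers: with s, u for the row j and s', v for the column, [l1]
   = s x/u and [l2] = x/(s u) belong to the L-vertex, [m1] = s' x/v and [m2] = x/(s' v) to the row-0
   vertex. Crossing the two vertices exchanges the pairs (l1, l2) and (m1, m2). The summand of the
   queue weight factors as [phi1] times [phi2]: [phi1] exchanges [l2] with [m2], [phi2] exchanges
   [l1] with [m1], each at fixed P, so only a finite sum over one color is left to evaluate. That
   sum telescopes because every one-arrow weight has the form c_i G_i - c_{i+1} G_{i+1}, with a
   coefficient c that jumps at the incoming color. Setting q^oo = 0 lets the infinite coordinate
   obey the same formulas as the finite ones. The two sides of the equation have different vertical
   tuples between the two rows, so their infinite sums cannot be compared term by term; conservation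
   determines this tuple, and it is eliminated first. States are infinite in number, but the
   L-operators preserve the number of arrows, so all sums over states run over finite lists with at
   most T arrows. *)
Require Import Defs.
From mathcomp Require Import all_boot all_order all_algebra all_fingroup.
From mathcomp Require Import finmap complex.
From mathcomp Require Import boolp classical_sets fsbigop.
From mathcomp Require Import reals topology normedtype.
From mathcomp Require summability.
From mathcomp Require Import ring lra zify.
Set Implicit Arguments.
Unset Strict Implicit.
Unset Printing Implicit Defensive.
Import Order.TTheory GRing.Theory Num.Theory.
Import numFieldNormedType.Exports.
Local Open Scope ring_scope.

(** * Telescoping identities *)

Section Telescope.
Variable K : fieldType.
Implicit Types F f : nat -> K.

Lemma sum_tele F c m n : (m <= n)%N ->
  \sum_(m <= i < n) c * (F i.+1 - F i) = c * (F n - F m).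
Proof. by move=> lemn; rewrite -mulr_sumr telescope_sumr. Qed.

(** The break at [j] will be the incoming or the outgoing color, where a one-arrow weight takes an
    exceptional value and its coefficient changes. *)
Lemma sum_tele1 F f j n al be x : (j < n)%N ->
  (forall i, (i < j)%N -> f i = al * (F i.+1 - F i)) ->
  f j = x ->
  (forall i, (j < i < n)%N -> f i = be * (F i.+1 - F i)) ->
  \sum_(i < n) f i = al * (F j - F 0%N) + x + be * (F n - F j.+1).
Proof.
move=> jn f1 fj f2; rewrite -(big_mkord xpredT) (big_cat_nat (n := j)) ?(ltnW jn) //=.
rewrite (big_ltn jn) fj (eq_big_nat _ _ (F2 := fun i => al * (F i.+1 - F i))).
  by rewrite sum_tele // (eq_big_nat _ _ (F2 := fun i => be * (F i.+1 - F i)))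
    ?sum_tele ?addrA // => i /andP[? ?]; rewrite f2 //; lia.
by move=> i /andP[_ ?]; rewrite f1.
Qed.

(** Two breaks: the incoming and the outgoing color, when they differ. *)
Lemma sum_tele2 F f j r n al be ga x y : (j < r < n)%N ->
  (forall i, (i < j)%N -> f i = al * (F i.+1 - F i)) ->
  f j = x ->
  (forall i, (j < i < r)%N -> f i = be * (F i.+1 - F i)) ->
  f r = y ->
  (forall i, (r < i < n)%N -> f i = ga * (F i.+1 - F i)) ->
  \sum_(i < n) f i = al * (F j - F 0%N) + x + be * (F r - F j.+1) + y
                     + ga * (F n - F r.+1).
Proof.
move=> /andP[jr rn] f1 fj f2 fr f3.
rewrite -(big_mkord xpredT) (big_cat_nat (n := r)) ?(ltnW rn) //=.
rewrite (big_ltn rn) fr big_mkord (sum_tele1 jr f1 fj f2).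
rewrite (eq_big_nat _ _ (F2 := fun i => ga * (F i.+1 - F i)))
    ?sum_tele ?addrA // => i /andP[? ?]; rewrite f3 //; lia.
Qed.
End Telescope.

Section Weights.
Variables (K : fieldType) (q : K).
Hypothesis q1 : forall i, 1 - q ^+ i.+1 != 0.
Hypothesis q0 : q != 0.

Definition qp (a : K) (k : nat) : K := \prod_(i < k) (1 - a * q ^+ i).

Lemma qp0 a : qp a 0 = 1. Proof. by rewrite /qp big_ord0. Qed.
Lemma qpS a k : qp a k.+1 = qp a k * (1 - a * q ^+ k).
Proof. by rewrite /qp big_ord_recr. Qed.
Lemma qpSl a k : qp a k.+1 = (1 - a) * qp (a * q) k.
Proof.
rewrite /qp big_ord_recl expr0 mulr1; congr (_ * _); apply: eq_bigr => i _.
by rewrite /bump /= exprS mulrA.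
Qed.
Lemma qpqS k : qp q k.+1 = qp q k * (1 - q ^+ k.+1).
Proof. by rewrite qpS exprS. Qed.
Lemma qpq_neq0 k : qp q k != 0.
Proof.
elim: k => [|k IH]; first by rewrite qp0 oner_neq0.
by rewrite qpqS mulf_neq0.
Qed.

(* Common form of [ell] and [qw] below when color i.+1 exits and color k enters. *)
Definition wt (s lam : K) (G : nat -> K) (k i : nat) : K :=
  if (i.+1 < k)%N then - s * (G i.+1 - G i)
  else if k == i.+1 then s * G i - lam * G i.+1
  else - lam * (G i.+1 - G i).

End Weights.

(** * Scalar identities behind the first exchange relation *)

Section Stage1.
Variables (K : fieldType) (q : K) (n : nat).
Hypothesis q0 : q != 0.
Variables (l1 l2 m1 m2 : K).
Hypotheses (l1n : l1 != 0) (l2n : l2 != 0) (m1n : m1 != 0) (m2n : m2 != 0).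
Variables (Dl g : nat -> K).
Hypothesis Dn0 : forall i, Dl i != 0.
Hypothesis Dn : Dl n = 1.

(** [Dl] stands for the sequence c -> q^(hi D c) and [g] for the same sequence of A, with 0 for an
    infinite sum. Taking an arrow of index [i] out of D divides the values at c <= i by q, whence
    [gX i]; [dE i] is the increment of q^(lo D) at [i], which appears when that arrow is put into
    P. *)
Let gX i c := g c * Dl c * (if (c <= i)%N then q^-1 else 1).
Let gX0 c := g c * Dl c.
Let dE i := Dl 0%N / Dl i.+1 - Dl 0%N / Dl i.


Let a := l1 / m2.
Let b := m2 / l2.
Let sg := l1 / l2.
Let w k r := wt (m1 / m2) m1 g k r.
Let w0 k r := wt (m1 / l2) m1 gX0 k r.
Let wX i k r := wt (m1 / l2) m1 (gX i) k r.

Lemma sum_dD : \sum_(i < n) (Dl i.+1 - Dl i) = 1 - Dl 0%N.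
Proof.
by rewrite -(big_mkord xpredT (fun i => Dl i.+1 - Dl i)) telescope_sumr // Dn.
Qed.

Lemma sum_dE : \sum_(i < n) dE i = Dl 0%N - 1.
Proof.
rewrite -(big_mkord xpredT) /dE (telescope_sumr (fun i => Dl 0%N / Dl i)) // Dn.
by rewrite divr1 divff.
Qed.

(** The suffix tells whether a color enters and whether one leaves. [P] stands for q^|P| when
    nothing enters and for q^(P_j) when the color of index j enters. *)
Lemma stage1_00 P :
  a * (1 - b * (Dl 0%N / q)) * (1 - l1 * (P * Dl 0%N))
  - l1 * (1 - sg * (P * Dl 0%N / q)) * (\sum_(i < n) (Dl i.+1 - Dl i))
  = a * (1 - b * (Dl 0%N / q)) * (1 - l1 * P)
  + l1 * (1 - a * P) * (\sum_(i < n) dE i).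
Proof.
rewrite sum_dD sum_dE /a /b /sg.
by field; rewrite ?q0 ?l1n ?l2n ?m1n ?m2n ?oner_neq0.
Qed.

Lemma stage1_0l P r : (r < n)%N ->
  a * (1 - b * (Dl 0%N / q)) * (1 - l1 * (P * Dl 0%N)) * w 0 r
  - l1 * (1 - sg * (P * Dl 0%N / q)) *
      (\sum_(i < n) (Dl i.+1 - Dl i) * w i.+1 r)
  = a * (1 - b * (Dl 0%N / q)) * (1 - l1 * P) * w0 0 r
  + l1 * (1 - a * P) * (\sum_(i < n) dE i * wX i i.+1 r).
Proof.
move=> rn.
rewrite (@sum_tele1 _ Dl (fun i => (Dl i.+1 - Dl i) * w i.+1 r) r n
   (- m1 * (g r.+1 - g r)) (- (m1 / m2) * (g r.+1 - g r)) _ rn _ erefl); first 1 last.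
- move=> i ir; rewrite /w /wt ltnNge ltnW ?ltnS //= eqSS (ltn_eqF ir); ring.
- move=> i /andP[ri _]; rewrite /w /wt ltnS ri; ring.
rewrite (@sum_tele1 _ (fun i => Dl 0%N / Dl i) (fun i => dE i * wX i i.+1 r) r n
   (- m1 * (g r.+1 * Dl r.+1 - g r * Dl r))
   (- (m1 / l2) * (g r.+1 * Dl r.+1 - g r * Dl r) / q) _ rn _ erefl); first 1 last.
- move=> i ir; rewrite /wX /wt ltnNge ltnW ?ltnS //= eqSS (ltn_eqF ir) /gX.
  by rewrite !ifF /dE; [ring | apply/negbTE; lia..].
- move=> i /andP[ri _]; rewrite /wX /wt ltnS ri /gX ri (ltnW ri) /dE; ring.
rewrite /w /w0 /wX /dE /wt /gX /gX0 !ltnn /= eqxx leqnn Dn /a /b /sg.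
by field; rewrite ?q0 ?l1n ?l2n ?m1n ?m2n ?Dn0 ?oner_neq0.
Qed.

Section IncomingColor.
Variables (P : K) (j : nat).
Hypothesis jn : (j < n)%N.
Let y := Dl j / Dl j.+1.
(** [st1L] and [st1R] are the terms of the two sides at inner color i + 1, divided by the common
    factor [REF] below. The exceptional case i = j is the one in which the entering color continues
    on the inner edge. *)
Definition st1L wl i :=
  if i == j then (sg * (P * y / q) - l1) * Dl j.+1 * (1 - y) * wl i.+1
  else - (1 - P * y) * (if (i < j)%N then sg / q else l1)
       * (Dl i.+1 - Dl i) * wl i.+1.
Definition st1R (wl : nat -> nat -> K) i :=
  if i == j then (1 - y) * (a * P - l1) * wl i i.+1
  else (1 - P) / (Dl 0%N / Dl j) * (if (i < j)%N then a else l1)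
       * dE i * wl i i.+1.

Lemma stage1_k0 :
  (1 - P * y) * a * (1 - b * (Dl 0%N / q)) + \sum_(i < n) st1L (fun=> 1) i
  = (1 - P) / (Dl 0%N / Dl j) * a * (1 - b * (Dl 0%N / q))
    + \sum_(i < n) st1R (fun _ _ => 1) i.
Proof.
rewrite (@sum_tele1 _ Dl (st1L (fun=> 1)) j n
   (- (1 - P * y) * (sg / q)) (- (1 - P * y) * l1) _ jn _ erefl); first 1 last.
- by move=> i ij; rewrite /st1L ltn_eqF // ij; ring.
- by move=> i /andP[ij _]; rewrite /st1L gtn_eqF // ltnNge ltnW //=; ring.
rewrite (@sum_tele1 _ (fun i => Dl 0%N / Dl i) (st1R (fun _ _ => 1)) j n
   ((1 - P) / (Dl 0%N / Dl j) * a) ((1 - P) / (Dl 0%N / Dl j) * l1) _ jn _ erefl); first 1 last.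
- by move=> i ij; rewrite /st1R ltn_eqF // ij /dE; ring.
- by move=> i /andP[ij _]; rewrite /st1R gtn_eqF // ltnNge ltnW //= /dE; ring.
rewrite /st1L /st1R eqxx /y Dn /a /b /sg.
by field; rewrite ?q0 ?l1n ?l2n ?m1n ?m2n ?Dn0 ?oner_neq0.
Qed.

(** Each side telescopes by itself, with breaks at [j] and [r]; the coefficients depend on the order
    of the two colors, hence the three cases. The closed forms then agree as rational functions. *)
Lemma stage1_kl r : (r < n)%N ->
  (1 - P * y) * a * (1 - b * (Dl 0%N / q)) * w 0 r + \sum_(i < n) st1L (w^~ r) i
  = (1 - P) / (Dl 0%N / Dl j) * a * (1 - b * (Dl 0%N / q)) * w0 0 r
    + \sum_(i < n) st1R (fun i k => wX i k r) i.
Proof.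
move=> rn; case: (ltngtP j r) => [jr|rj|jr].
- rewrite (@sum_tele2 _ Dl (st1L (w^~ r)) j r n
   ((1 - P * y) * (sg / q) * m1 * (g r.+1 - g r))
   ((1 - P * y) * l1 * m1 * (g r.+1 - g r))
   ((1 - P * y) * l1 * (m1 / m2) * (g r.+1 - g r)) _ _ _ _ erefl _ erefl); first 1 last.
  + by rewrite jr.
  + move=> i ij; rewrite /st1L ltn_eqF // ij /w /wt !ifF; [ring | apply/negbTE; lia..].
  + move=> i /andP[ji ir]; rewrite /st1L gtn_eqF // ltnNge ltnW //= /w /wt !ifF;
      [ring | apply/negbTE; lia..].
  + move=> i /andP[ri _]; rewrite /st1L /w /wt !ltnS ri !ifF;
      [ring | apply/negbTE; lia..].
  rewrite (@sum_tele2 _ (fun i => Dl 0%N / Dl i) (st1R (fun i k => wX i k r)) j r n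
   (- ((1 - P) / (Dl 0%N / Dl j) * a * m1 * (g r.+1 * Dl r.+1 - g r * Dl r)))
   (- ((1 - P) / (Dl 0%N / Dl j) * l1 * m1 * (g r.+1 * Dl r.+1 - g r * Dl r)))
   (- ((1 - P) / (Dl 0%N / Dl j) * l1 * (m1 / l2) * (g r.+1 * Dl r.+1 - g r * Dl r) / q))
    _ _ _ _ erefl _ erefl); first 1 last.
  + by rewrite jr.
  + move=> i ij; rewrite /st1R ltn_eqF // ij /wX /wt /gX /dE !ifF; [ring | apply/negbTE; lia..].
  + move=> i /andP[ji ir]; rewrite /st1R gtn_eqF // ltnNge ltnW //= /wX /wt /gX /dE !ifF;
      [ring | apply/negbTE; lia..].
  + move=> i /andP[ri _]; rewrite /st1R /wX /wt /gX /dE !ltnS ri (ltnW ri) !ifF;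
      [ring | apply/negbTE; lia..].
  rewrite /st1L /st1R !eqxx gtn_eqF // /w /w0 /wX /wt /gX /gX0 /dE !ltnn /= eqxx leqnn.
  rewrite !eqSS (ltn_eqF jr) /y Dn /a /b /sg /= !ltnS.
  do ?[rewrite (_ : (r < j)%N = false); last by apply/negbTE; lia].
  do ?[rewrite (_ : (r <= j)%N = false); last by apply/negbTE; lia].
  by field; rewrite ?q0 ?l1n ?l2n ?m1n ?m2n ?Dn0 ?oner_neq0.
- rewrite (@sum_tele2 _ Dl (st1L (w^~ r)) r j n
   ((1 - P * y) * (sg / q) * m1 * (g r.+1 - g r))
   ((1 - P * y) * (sg / q) * (m1 / m2) * (g r.+1 - g r))
   ((1 - P * y) * l1 * (m1 / m2) * (g r.+1 - g r)) _ _ _ _ erefl _ erefl); first 1 last.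
  + by rewrite rj.
  + move=> i ij; have -> : st1L (w^~ r) i = - (1 - P * y) * (sg / q) * (Dl i.+1 - Dl i) * w i.+1 r.
      by rewrite /st1L ltn_eqF ?ifT //; lia.
    by rewrite /w /wt !ifF; [ring | apply/negbTE; lia..].
  + move=> i /andP[ji ir]; rewrite /st1L ltn_eqF // ir /w /wt ltnS ji; ring.
  + move=> i /andP[ri _]; rewrite /st1L gtn_eqF // /w /wt !ltnS (ltn_trans rj ri) ifF;
      [ring | apply/negbTE; lia..].
  rewrite (@sum_tele2 _ (fun i => Dl 0%N / Dl i) (st1R (fun i k => wX i k r)) r j n
   (- ((1 - P) / (Dl 0%N / Dl j) * a * m1 * (g r.+1 * Dl r.+1 - g r * Dl r)))
   (- ((1 - P) / (Dl 0%N / Dl j) * a * (m1 / l2) * (g r.+1 * Dl r.+1 - g r * Dl r) / q))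
   (- ((1 - P) / (Dl 0%N / Dl j) * l1 * (m1 / l2) * (g r.+1 * Dl r.+1 - g r * Dl r) / q))
    _ _ _ _ erefl _ erefl); first 1 last.
  + by rewrite rj.
  + move=> i ij; have -> : st1R (fun i k => wX i k r) i = (1 - P) / (Dl 0%N / Dl j) * a * dE i * wX i i.+1 r.
      by rewrite /st1R ltn_eqF ?ifT //; lia.
    by rewrite /wX /wt /gX /dE !ifF; [ring | apply/negbTE; lia..].
  + move=> i /andP[ji ir]; rewrite /st1R ltn_eqF // ir /wX /wt /gX /dE ltnS ji (ltnW ji); ring.
  + move=> i /andP[ri _]; rewrite /st1R gtn_eqF // /wX /wt /gX /dE !ltnS (ltn_trans rj ri).
    rewrite (ltnW (ltn_trans rj ri)) ifF;
      [ring | apply/negbTE; lia..].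
  rewrite /st1L /st1R !eqxx ltn_eqF // /w /w0 /wX /wt /gX /gX0 /dE !ltnn /= eqxx leqnn.
  rewrite !ltnS rj (ltnW rj) /y Dn /a /b /sg /=.
  by field; rewrite ?q0 ?l1n ?l2n ?m1n ?m2n ?Dn0 ?oner_neq0.
- rewrite -{}jr {rn}.
  rewrite (@sum_tele1 _ Dl (st1L (w^~ j)) j n
   ((1 - P * y) * (sg / q) * m1 * (g j.+1 - g j))
   ((1 - P * y) * l1 * (m1 / m2) * (g j.+1 - g j)) _ _ _ erefl); first 1 last.
  + by [].
  + move=> i ij; rewrite /st1L ltn_eqF // ij /w /wt !ifF; [ring | apply/negbTE; lia..].
  + move=> i /andP[ji ir]; rewrite /st1L gtn_eqF // /w /wt !ltnS ji ifF;
      [ring | apply/negbTE; lia..].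
  rewrite (@sum_tele1 _ (fun i => Dl 0%N / Dl i) (st1R (fun i k => wX i k j)) j n
   (- ((1 - P) / (Dl 0%N / Dl j) * a * m1 * (g j.+1 * Dl j.+1 - g j * Dl j)))
   (- ((1 - P) / (Dl 0%N / Dl j) * l1 * (m1 / l2) * (g j.+1 * Dl j.+1 - g j * Dl j) / q))
    _ _ _ erefl); first 1 last.
  + by [].
  + move=> i ij; rewrite /st1R ltn_eqF // ij /wX /wt /gX /dE !ifF; [ring | apply/negbTE; lia..].
  + move=> i /andP[ji ir]; rewrite /st1R gtn_eqF // /wX /wt /gX /dE !ltnS ji (ltnW ji) ifF;
      [ring | apply/negbTE; lia..].
  rewrite /st1L /st1R !eqxx /w /w0 /wX /wt /gX /gX0 /dE !ltnn /= eqxx leqnn.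
  rewrite /y Dn /a /b /sg /=.
  by field; rewrite ?q0 ?l1n ?l2n ?m1n ?m2n ?Dn0 ?oner_neq0.
Qed.
End IncomingColor.
End Stage1.

(** * Exchange relation for the first factor *)

Section Confs.
Variable n : nat.
Implicit Types (A B C D P : conf n) (i j : 'I_n) (k l : 'I_n.+1).

Definition cone i : conf n := [ffun j => nat_of_bool (j == i)].
Definition cle A B := [forall i, (A i <= B i)%N].
Definition hi B (c : nat) := (\sum_(i < n | (c <= i)%N) B i)%N.
Definition lo B (c : nat) := (\sum_(i < n | (i < c)%N) B i)%N.

Lemma color_conf0 : color_conf ord0 = czero n.
Proof. by apply/ffunP => i; rewrite !ffunE. Qed.
Lemma color_confS i : color_conf (lift ord0 i) = cone i.
Proof. by apply/ffunP => j; rewrite !ffunE lift0 eqSS. Qed.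

Lemma caddC A B : cadd A B = cadd B A.
Proof. by apply/ffunP => i; rewrite !ffunE addnC. Qed.
Lemma caddA A B C : cadd A (cadd B C) = cadd (cadd A B) C.
Proof. by apply/ffunP => i; rewrite !ffunE addnA. Qed.
Lemma cadd_cone A i : (cadd A (cone i)) i = (A i).+1.
Proof. by rewrite !ffunE eqxx addn1. Qed.
Lemma cadd_cone_neq A i j : j != i -> (cadd A (cone i)) j = A j.
Proof. by move=> /negbTE ji; rewrite !ffunE ji addn0. Qed.
Lemma cadd0 A : cadd A (czero n) = A.
Proof. by apply/ffunP => i; rewrite !ffunE addn0. Qed.
Lemma csub0 A : csub A (czero n) = A.
Proof. by apply/ffunP => i; rewrite !ffunE subn0. Qed.
Lemma caddK A B : csub (cadd A B) B = A.
Proof. by apply/ffunP => i; rewrite !ffunE addnK. Qed.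
Lemma csubK A B : cle B A -> cadd (csub A B) B = A.
Proof. by move=> /forallP h; apply/ffunP => i; rewrite !ffunE subnK. Qed.
Lemma caddI A B C : cadd A C = cadd B C -> A = B.
Proof. by move=> h; rewrite -[A](caddK A C) h caddK. Qed.
Lemma cle0 A : cle (czero n) A.
Proof. by apply/forallP => i; rewrite ffunE. Qed.
Lemma cle_addl A B : cle B (cadd A B).
Proof. by apply/forallP => i; rewrite ffunE leq_addl. Qed.
Lemma cle_cone i A : cle (cone i) A = (0 < A i)%N.
Proof.
apply/forallP/idP => [/(_ i)|h j]; rewrite !ffunE ?eqxx //.
by case: eqP => // ->.
Qed.

Lemma ctotD A B : ctot (cadd A B) = (ctot A + ctot B)%N.
Proof. by rewrite /ctot -big_split; apply: eq_bigr => i _; rewrite ffunE. Qed.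
Lemma ctot_cone i : ctot (cone i) = 1%N.
Proof.
rewrite /ctot (bigD1 i) //= ffunE eqxx big1 // => j /negbTE ji.
by rewrite ffunE ji.
Qed.
Lemma ctot0 : ctot (czero n) = 0%N.
Proof. by rewrite /ctot big1 // => i _; rewrite ffunE. Qed.
Lemma hiD A B c : hi (cadd A B) c = (hi A c + hi B c)%N.
Proof. by rewrite /hi -big_split; apply: eq_bigr => i _; rewrite ffunE. Qed.
Lemma hi_cone i c : hi (cone i) c = (c <= i)%N.
Proof.
rewrite /hi big_mkcond (bigD1 i) //= ffunE eqxx big1 ?addn0; first by case: leqP.
by move=> j /negbTE ji; rewrite ffunE ji; case: ifP.
Qed.
Lemma hiS B i : hi B i = (B i + hi B i.+1)%N.
Proof.
rewrite /hi (bigD1 i) //=; congr addn; apply: eq_bigl => j.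
by rewrite ltn_neqAle andbC eq_sym.
Qed.
Lemma loS B i : lo B i.+1 = (lo B i + B i)%N.
Proof.
rewrite /lo (bigD1 i) ?ltnS //= addnC; congr addn; apply: eq_bigl => j.
by rewrite ltnS ltn_neqAle andbC.
Qed.
Lemma hi0 B : hi B 0 = ctot B.
Proof. by rewrite /hi /ctot; apply: eq_bigl. Qed.
Lemma hin B : hi B n = 0%N.
Proof. by rewrite /hi big1 // => i; rewrite leqNgt ltn_ord. Qed.
Lemma lo0 B : lo B 0 = 0%N.
Proof. by rewrite /lo big1. Qed.
Lemma lon B : lo B n = ctot B.
Proof. by rewrite /lo /ctot; apply: eq_bigl => i; rewrite ltn_ord. Qed.
Lemma lo_hi B c : (lo B c + hi B c = ctot B)%N.
Proof.
rewrite /lo /hi /ctot [RHS](bigID (fun i : 'I_n => (i < c)%N)) /=; congr addn.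
by apply: eq_bigl => i; rewrite leqNgt.
Qed.
Lemma ctot_ge i B : (B i <= ctot B)%N.
Proof. by rewrite /ctot (bigD1 i) //= leq_addr. Qed.

Lemma ccrossDl A B C : ccross (cadd A B) C = (ccross A C + ccross B C)%N.
Proof.
rewrite /ccross -big_split; apply: eq_bigr => i _ /=; rewrite -big_split.
by apply: eq_bigr => j _; rewrite ffunE mulnDl.
Qed.
Lemma ccrossDr A B C : ccross A (cadd B C) = (ccross A B + ccross A C)%N.
Proof.
rewrite /ccross -big_split; apply: eq_bigr => i _ /=; rewrite -big_split.
by apply: eq_bigr => j _; rewrite ffunE mulnDr.
Qed.
Lemma ccross_conel i A : ccross (cone i) A = hi A i.+1.
Proof.
rewrite /ccross (bigD1 i) //= [X in (_ + X)%N]big1 ?addn0.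
  by apply: eq_bigr => j _; rewrite ffunE eqxx mul1n.
by move=> j /negbTE ji; rewrite big1 // => l _; rewrite ffunE ji.
Qed.
Lemma ccross_coner i A : ccross A (cone i) = lo A i.
Proof.
rewrite /ccross /lo [RHS]big_mkcond; apply: eq_bigr => j _.
rewrite big_mkcond (bigD1 i) //= big1 ?addn0 ?ffunE ?eqxx ?muln1 //.
by move=> l /negbTE li; rewrite ffunE li muln0; case: ifP.
Qed.
Lemma ccross0l A : ccross (czero n) A = 0%N.
Proof. by rewrite /ccross big1 // => i _; rewrite big1 // => j _; rewrite ffunE. Qed.
Lemma ccross0r A : ccross A (czero n) = 0%N.
Proof. by rewrite /ccross big1 // => i _; rewrite big1 // => j _; rewrite ffunE muln0. Qed.
End Confs.

(** * One-arrow weights and the factor [phi1] over a field *)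

Section ConfWeights.
Variables (K : fieldType) (q : K) (n : nat).
Hypothesis q1 : forall i, 1 - q ^+ i.+1 != 0.
Hypothesis q0 : q != 0.
Implicit Types (A B C D P : conf n) (i j : 'I_n) (k l : 'I_n.+1).
Local Notation qp := (qp q).

Definition gB B : K := \prod_i qp q (B i).
(** Times [gB (P + D)], this is the product of q-binomials with its crossing power in the queue
    weight. Leaving [gB (P + D)] out gives the one-arrow recursions [hcD] and [hcP], in which only
    one of P and D changes. *)
Definition hc P D : K := q ^+ ccross D P / (gB P * gB D).

Lemma gB_neq0 B : gB B != 0.
Proof. by apply/prodf_neq0 => i _; rewrite qpq_neq0. Qed.
Lemma gBS B i : gB (cadd B (cone i)) = gB B * (1 - q ^+ (B i).+1).
Proof.
rewrite /gB (bigD1 i) //= [in RHS](bigD1 i) //= !ffunE eqxx addn1 qpqS.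
rewrite mulrAC; congr (_ * _ * _); apply: eq_bigr => j /negbTE ji.
by rewrite !ffunE ji addn0.
Qed.
Lemma gB0 : gB (czero n) = 1.
Proof. by rewrite /gB big1 // => i _; rewrite ffunE qp0. Qed.

Lemma hcD P D i :
  hc P (cadd D (cone i)) * (1 - q ^+ (D i).+1) = q ^+ hi P i.+1 * hc P D.
Proof.
rewrite /hc gBS ccrossDl ccross_conel exprD.
by field; rewrite !gB_neq0 q1.
Qed.
Lemma hcP P D i :
  hc (cadd P (cone i)) D * (1 - q ^+ (P i).+1) = q ^+ lo D i * hc P D.
Proof.
rewrite /hc gBS ccrossDr ccross_coner exprD.
by field; rewrite !gB_neq0 q1.
Qed.

(* The value 0 of [gA] encodes A_m = +oo. *)
Definition qhi B (c : nat) : K := q ^+ hi B c.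
Definition gA (m : nat) A (c : nat) : K := if (m < c)%N then q ^+ hi A c else 0.

(* [ell] is the L-weight times 1 - lam, where sg = s^2 and lam = s x; [qw] is the
   queue weight of row 0 without its prefactor. The horizontal edge enters with
   color k and exits with color l. *)
Definition ell (sg lam : K) B k l : K :=
  if unlift ord0 l is Some r then wt sg lam (qhi B) k r
  else 1 - (if (0 < k)%N then sg else lam) * q ^+ ctot B.
Definition qw (tau mu : K) (m : nat) A k l : K :=
  if unlift ord0 l is Some r then wt tau mu (gA m A) k r else 1.

(* The factor (sg)_{|B|} / (sg)_{|B'|}, B' the outcome of the vertex, is
   absorbed in the weight. *)
Definition ellr (sg lam : K) B k l : K :=
  if unlift ord0 l is Some r
  then (if k == ord0 then 1 - sg * q ^+ (ctot B).-1 else 1) * ell sg lam B k l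
  else if k == ord0 then ell sg lam B k l else 1.

(* With D = B - P and X = A + B - P, the summand P of the queue weight is
   (q)_B / (s_1^2)_|B| phi1 P D times the factor [phi2] of D and X below. *)
Definition phi1 (a b : K) P D : K :=
  qp a (ctot P) * qp b (ctot D) * a ^+ ctot D * hc P D.

(** Keeps the coordinates of a vertical tuple of column [m] that are finite and may be nonzero: the
    m-th is infinite, the lower ones are empty. *)
Definition offm (m : nat) A : conf n := [ffun i : 'I_n => if (m < i)%N then A i else 0%N].

Lemma hi_offm m A c : (m < c)%N -> hi (offm m A) c = hi A c.
Proof.
move=> mc; rewrite /hi; apply: eq_bigr => i ci; rewrite ffunE ifT //; exact: leq_trans ci.
Qed.

Section Stage1C.
Variables (l1 l2 m1 m2 : K).
Hypotheses (l1n : l1 != 0) (l2n : l2 != 0) (m1n : m1 != 0) (m2n : m2 != 0).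
Let a := l1 / m2.
Let b := m2 / l2.
Let sg := l1 / l2.
Variables (m : nat) (A : conf n).

(** The two sides of the first exchange at inner color [k1]. In [S1L] the arrow crosses first and
    the outcome is split into P and the rest; in [S1R] it is B that is split, into [P1] and [D1],
    and the parameters (l1, l2), (m1, m2) of the two vertices have become (l1, m2), (m1, l2). *)
Definition S1L B k l P D k1 : K :=
  if cle (color_conf k1) D then
    ellr sg l1 B k k1 * qw (m1 / m2) m1 m A k1 l
    * gB (cadd P (csub D (color_conf k1))) * phi1 a b P (csub D (color_conf k1))
  else 0.
Definition S1R B k l P D k1 : K :=
  if cle (color_conf k1) D && cle (color_conf k) (cadd P (color_conf k1)) then
    let P1 := csub (cadd P (color_conf k1)) (color_conf k) in
    let D1 := csub D (color_conf k1) in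
    gB B * phi1 a b P1 D1 * ell a l1 P1 k k1
    * qw (m1 / l2) m1 m (offm m (cadd A D1)) k1 l
  else 0.

Let X D i := offm m (cadd A (csub D (cone i))).

Lemma qhi_neq0 D c : qhi D c != 0.
Proof. by rewrite expf_neq0. Qed.

Lemma qhiS D i : qhi D i = q ^+ D i * qhi D i.+1.
Proof. by rewrite /qhi hiS exprD. Qed.

Lemma qw_X D i k (r : 'I_n) : (0 < D i)%N ->
  qw (m1 / l2) m1 m (X D i) k (lift ord0 r)
  = wt (m1 / l2) m1
      (fun c => gA m A c * qhi D c * (if (c <= i)%N then q^-1 else 1)) k r.
Proof.
move=> Di; rewrite /qw liftK; set G := gA m _; set H := (fun c => _).
suff GH c : G c = H c by rewrite /wt !GH.
rewrite /G /H /gA /qhi; case: ltnP => mc; last by rewrite !mul0r.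
have -> : hi (X D i) c = (hi A c + hi (csub D (cone i)) c)%N.
  by rewrite /X hi_offm // hiD.
have -> : hi D c = (hi (csub D (cone i)) c + (c <= i)%N)%N.
  by rewrite -hi_cone -hiD csubK // cle_cone.
rewrite !exprD mulrA; case: leqP => _ /=; last by rewrite !mulr1.
by rewrite expr1 -!mulrA divff // mulr1.
Qed.

Lemma qw_X0 D k (r : 'I_n) :
  qw (m1 / l2) m1 m (offm m (cadd A D)) k (lift ord0 r)
  = wt (m1 / l2) m1 (fun c => gA m A c * qhi D c) k r.
Proof.
rewrite /qw liftK; set G := gA m _; set H := (fun c => _).
suff GH c : G c = H c by rewrite /wt !GH.
rewrite /G /H /gA /qhi; case: ltnP => mc; last by rewrite !mul0r.
by rewrite hi_offm // hiD exprD.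
Qed.

Lemma qlo D c : q ^+ lo D c = qhi D 0 / qhi D c.
Proof.
rewrite /qhi hi0 -(lo_hi D c) exprD mulfK // expf_neq0 //.
Qed.

Lemma wt0E (s lam : K) G r : wt s lam G 0 r = - lam * (G r.+1 - G r).
Proof. by []. Qed.

Lemma hcD_sub P D i : hc P D = hc P (cadd D (cone i)) * (1 - q ^+ (D i).+1) / qhi P i.+1.
Proof. by rewrite hcD mulrAC divff ?mul1r // qhi_neq0. Qed.
Lemma hcP_add P D i : hc (cadd P (cone i)) D = qhi D 0 / qhi D i * hc P D / (1 - q ^+ (P i).+1).
Proof. by rewrite -qlo -hcP mulfK. Qed.

Lemma hcD_add P D i : hc P (cadd D (cone i)) = qhi P i.+1 * hc P D / (1 - q ^+ (D i).+1).
Proof. by rewrite -hcD mulfK. Qed.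

Lemma gBS_sub B i : gB B = gB (cadd B (cone i)) / (1 - q ^+ (B i).+1).
Proof. by rewrite gBS mulfK. Qed.

Lemma csub_split D i : (0 < D i)%N -> {D1 | D = cadd D1 (cone i)}.
Proof. by move=> h; exists (csub D (cone i)); rewrite csubK // cle_cone. Qed.

Section Case0.
Variables (P D : conf n) (l : 'I_n.+1) (d : nat).
Hypothesis Dd : ctot D = d.+1.
Let B := cadd P D.
(** An inner color takes one arrow out of D, so the normalization uses [d] = |D| - 1; the term with
    inner color 0 keeps the extra factor a (1 - b q^d). *)
Let REF := gB B * qp a (ctot P) * qp b d * a ^+ d * hc P D.

Lemma S1L_00 : S1L B ord0 l P D ord0 =
  REF * (a * (1 - b * q ^+ d) * (1 - l1 * q ^+ ctot B) * qw (m1 / m2) m1 m A ord0 l).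
Proof.
rewrite /S1L color_conf0 cle0 csub0 /ellr unlift_none eqxx /ell unlift_none ltnn.
by rewrite /phi1 Dd !qpS exprS /REF -/B; ring.
Qed.

Lemma S1L_0S i : S1L B ord0 l P D (lift ord0 i) =
  REF * (- l1 * (1 - sg * q ^+ (ctot B).-1) *
    ((qhi D i.+1 - qhi D i) * qw (m1 / m2) m1 m A (lift ord0 i) l)).
Proof.
(* If D has no arrow of index i, the increment of [qhi D] at i is zero, so the closed form needs no
   side condition. *)
rewrite /S1L color_confS cle_cone; case: posnP => [D0|/csub_split[D1 E]].
  by rewrite qhiS D0 expr0 mul1r subrr mul0r !mulr0.
have E' : csub D (cone i) = D1 by rewrite E caddK.
rewrite E' /ellr liftK eqxx /ell liftK wt0E.
have [d1 BD] : ctot D1 = d /\ B = cadd (cadd P D1) (cone i).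
  by move: Dd; rewrite /B E caddA ctotD ctot_cone addn1 => -[].
rewrite /phi1 d1 /REF (hcD_sub _ _ i) -E (gBS_sub (cadd P D1) i) -BD.
rewrite [qhi B i]qhiS [qhi D i]qhiS [in qhi B _]/B /qhi hiD exprD -!/(qhi _ _).
have -> : B i = ((cadd P D1) i).+1 by rewrite BD cadd_cone.
have -> : D i = (D1 i).+1 by rewrite E cadd_cone.
by field; rewrite q1 qhi_neq0.
Qed.

Lemma S1R_00 : S1R B ord0 l P D ord0 =
  REF * (a * (1 - b * q ^+ d) * (1 - l1 * q ^+ ctot P)
         * qw (m1 / l2) m1 m (offm m (cadd A D)) ord0 l).
Proof.
rewrite /S1R color_conf0 !cle0 !csub0 cadd0 /ell unlift_none ltnn.
by rewrite /phi1 Dd !qpS exprS /REF -/B; ring.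
Qed.

Lemma S1R_0S i : S1R B ord0 l P D (lift ord0 i) =
  REF * (l1 * (1 - a * q ^+ ctot P)
    * ((qhi D 0 / qhi D i.+1 - qhi D 0 / qhi D i)
       * qw (m1 / l2) m1 m (X D i) (lift ord0 i) l)).
Proof.
rewrite /S1R color_conf0 color_confS cle0 cle_cone andbT csub0.
case: posnP => [D0|/csub_split[D1 E]].
  by rewrite qhiS D0 expr0 mul1r subrr mul0r !mulr0.
have E' : csub D (cone i) = D1 by rewrite E caddK.
rewrite /X E'.
have d1 : ctot D1 = d by move: Dd; rewrite E ctotD ctot_cone addn1 => -[].
rewrite /phi1 ctotD ctot_cone addn1 qpS d1 hcP_add (hcD_sub _ _ i) -E.
rewrite /ell liftK wt0E /REF -/B.
have -> : qhi D1 0 = qhi D 0 / q by rewrite E /qhi hiD hi_cone leq0n addn1 exprSr mulfK.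
have -> : qhi D1 i = qhi D i / q by rewrite E /qhi hiD hi_cone leqnn addn1 exprSr mulfK.
rewrite [qhi D i]qhiS [qhi (cadd _ _) i]qhiS.
have -> : qhi (cadd P (cone i)) i.+1 = qhi P i.+1.
  by rewrite /qhi hiD hi_cone ltnn addn0.
have -> : D i = (D1 i).+1 by rewrite E cadd_cone.
have -> : (cadd P (cone i)) i = (P i).+1 by rewrite cadd_cone.
rewrite exprS.
have := expf_neq0 (D1 i) q0; move: (q ^+ D1 i) => u un.
by field; rewrite q1 !qhi_neq0 q0 un.
Qed.

Lemma stage1_case0 :
  \sum_k1 S1L B ord0 l P D k1 = \sum_k1 S1R B ord0 l P D k1.
Proof.
rewrite !big_ord_recl S1L_00 S1R_00.
under eq_bigr do rewrite S1L_0S.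
under [in RHS]eq_bigr do rewrite S1R_0S.
rewrite -!mulr_sumr -!mulrDr; congr (_ * _).
have Bd : ctot B = (ctot P + d).+1 by rewrite /B ctotD Dd addnS.
have E1 : q ^+ d = qhi D 0 / q by rewrite /qhi hi0 Dd exprS mulrAC divff ?mul1r.
have E2 : q ^+ ctot B = q ^+ ctot P * qhi D 0 by rewrite /B ctotD exprD /qhi hi0.
have E3 : q ^+ (ctot B).-1 = q ^+ ctot P * qhi D 0 / q.
  by rewrite -E2 Bd /= exprS mulrAC divff ?mul1r.
rewrite E1 E2 E3 !mulNr; have qn := qhi_neq0 D; have qhn : qhi D n = 1 by rewrite /qhi hin.
case: (unliftP ord0 l) => [r|] ->.
  have H := stage1_0l q0 l1n l2n m1n m2n (gA m A) qn qhn (q ^+ ctot P) (ltn_ord r).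
  rewrite qw_X0 (_ : qw _ _ _ _ ord0 _ = wt (m1 / m2) m1 (gA m A) 0 r);
    last by rewrite /qw liftK.
  under eq_bigr do rewrite /qw liftK.
  apply: (etrans H); congr (_ + _ * _); apply: eq_bigr => i _ /=.
  case: (posnP (D i)) => [Di|Di]; last by rewrite qw_X.
  by rewrite qhiS Di expr0 mul1r subrr !mul0r.
rewrite /qw unlift_none !mulr1.
under eq_bigr do rewrite mulr1.
under [in RHS]eq_bigr do rewrite mulr1.
apply: stage1_00 => //; exact: qhi_neq0.
Qed.
End Case0.

Section CaseS.
Variables (B P D : conf n) (l : 'I_n.+1) (j : 'I_n) (d : nat).
Hypothesis Dd : ctot D = d.+1.
Hypothesis BPD : cadd B (cone j) = cadd P D.
Let REF := gB B * qp a (ctot P) * qp b d * a ^+ d * hc P D.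
Let Pj := q ^+ P j.
Let y := qhi D j / qhi D j.+1.

Lemma qy : q ^+ D j = y.
Proof. by rewrite /y qhiS mulfK // qhi_neq0. Qed.

Lemma qBj : q ^+ (B j).+1 = Pj * y.
Proof. by rewrite -cadd_cone BPD ffunE exprD qy. Qed.

Lemma qhiB c : qhi B c = qhi P c * qhi D c * (if (c <= j)%N then q^-1 else 1).
Proof.
have := congr1 (fun x => q ^+ hi x c) BPD; rewrite /= !hiD !exprD hi_cone.
rewrite -!/(qhi _ _) => <-; case: leqP => _; last by rewrite !mulr1.
by rewrite expr1 mulfK.
Qed.

Lemma S1L_S0 : S1L B (lift ord0 j) l P D ord0 =
  REF * ((1 - Pj * y) * a * (1 - b * q ^+ d) * qw (m1 / m2) m1 m A ord0 l).
Proof.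
rewrite /S1L color_conf0 cle0 csub0 -BPD gBS qBj /ellr unlift_none.
by rewrite /= /phi1 Dd !qpS exprS /REF; ring.
Qed.

Lemma S1L_SS i : S1L B (lift ord0 j) l P D (lift ord0 i) =
  REF * st1L q l1 l2 (qhi D) Pj j
    (fun=> qw (m1 / m2) m1 m A (lift ord0 i) l) i.
Proof.
rewrite /S1L color_confS cle_cone; case: posnP => [D0|/csub_split[D1 E]].
  have e : qhi D i = qhi D i.+1 by rewrite qhiS D0 expr0 mul1r.
  rewrite /st1L e subrr; case: eqP => [/val_inj ij|_]; last by rewrite mulr0 mul0r mulr0.
  by rewrite -ij e divff ?qhi_neq0 // subrr mulr0 mul0r mulr0.
have E' : csub D (cone i) = D1 by rewrite E caddK.
rewrite E' /ellr liftK /= /ell liftK mul1r.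
have [d1 BD] : ctot D1 = d /\ cadd B (cone j) = cadd (cadd P D1) (cone i).
  by move: Dd; rewrite BPD E caddA ctotD ctot_cone addn1 => -[].
rewrite /phi1 d1 /REF (hcD_sub _ _ i) -E /st1L /wt !qhiB [qhi D i]qhiS.
have Di : D i = (D1 i).+1 by rewrite E cadd_cone.
have Bi : i != j -> B i = (P i + D1 i).+1.
  by move=> ij; rewrite -(cadd_cone_neq _ ij) BPD ffunE Di addnS.
(* For i different from j, P + D1 is B + e_j - e_i, so [gB] changes in two coordinates. *)
have gBi : i != j -> gB (cadd P D1) = gB B * (1 - Pj * y) / (1 - q ^+ P i * q ^+ (D1 i).+1).
  move=> ij; rewrite (gBS_sub (cadd P D1) i) -BD gBS qBj.
  by rewrite [cadd P D1 i]ffunE -addnS exprD.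
have nB : 1 - q ^+ P i * q ^+ (D1 i).+1 != 0 by rewrite -exprD addnS.
rewrite /= !eqSS !ltnS Di [qhi P i]qhiS; case: (ltngtP i j) => [ij|ij|/val_inj ij].
- rewrite gBi ?(ltn_eqF ij) -?val_eqE /= ?(ltn_eqF ij) //.
  rewrite /y /sg; field; rewrite ?nB ?l2n ?q0 ?qhi_neq0 //.
- rewrite gBi -?val_eqE /= ?(gtn_eqF ij) //.
  by rewrite /y; field; rewrite ?nB ?qhi_neq0 //.
- have -> : cadd P D1 = B by apply: (@caddI _ _ _ (cone i)); rewrite -BD ij.
  have yE : y = q ^+ (D1 i).+1 by rewrite -qy -ij Di.
  rewrite -/y yE /Pj -ij /sg; field; rewrite ?l2n ?q0 ?qhi_neq0 //.
Qed.

Lemma S1R_S0 : S1R B (lift ord0 j) l P D ord0 =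
  REF * ((1 - Pj) / (qhi D 0 / qhi D j) * a * (1 - b * q ^+ d)
         * qw (m1 / l2) m1 m (offm m (cadd A D)) ord0 l).
Proof.
rewrite /S1R color_conf0 color_confS cle0 !csub0 cadd0 cle_cone /=.
rewrite /REF /Pj; case: posnP => [P0|/csub_split[P1 E]].
  by rewrite P0 expr0 subrr !mul0r mulr0.
rewrite E caddK cadd_cone /ell unlift_none /= hcP_add ctotD ctot_cone addn1.
rewrite /phi1 Dd !qpS exprS.
by field; rewrite q1 !qhi_neq0.
Qed.

Lemma S1R_SS i : S1R B (lift ord0 j) l P D (lift ord0 i) =
  REF * st1R l1 m2 (qhi D) Pj j
    (fun _ _ => qw (m1 / l2) m1 m (X D i) (lift ord0 i) l) i.
Proof.
rewrite /S1R !color_confS cle_cone; case: posnP => [D0|/csub_split[D1 E]] /=.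
  have e : qhi D i = qhi D i.+1 by rewrite qhiS D0 expr0 mul1r.
  rewrite /st1R e subrr; case: eqP => [/val_inj ij|_]; last by rewrite mulr0 mul0r mulr0.
  by rewrite -ij e divff ?qhi_neq0 // subrr !mul0r mulr0.
have E' : csub D (cone i) = D1 by rewrite E caddK.
rewrite /X E' cle_cone.
have d1 : ctot D1 = d by move: Dd; rewrite E ctotD ctot_cone addn1 => -[].
have Di : D i = (D1 i).+1 by rewrite E cadd_cone.
rewrite /st1R /ell liftK; case: (ltngtP i j) => [ij|ij|/val_inj ij]; last first.
- rewrite ij in E E' Di *.
  rewrite cadd_cone /= caddK /phi1 d1 /REF (hcD_sub _ _ j) -E /wt /= eqxx ltnn.
  rewrite [qhi P j]qhiS /Pj -/y -qy Di /=.
  by rewrite -/a; field; rewrite ?qhi_neq0.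
- have ji : j != i by rewrite -val_eqE /= (ltn_eqF ij).
  rewrite cadd_cone_neq //.
  rewrite /REF /Pj; case: posnP => [P0|/csub_split[P1 Ep]].
    by rewrite P0 expr0 subrr !mul0r mulr0.
  have -> : csub (cadd P (cone i)) (cone j) = cadd P1 (cone i).
    by rewrite Ep -caddA [cadd (cone j) _]caddC caddA caddK.
  have -> : hc P D = qhi P i.+1 * hc P D1 / (1 - q ^+ (D1 i).+1).
    by rewrite E hcD_add.
  rewrite /phi1 [in hc P D1]Ep !hcP_add [in ctot P]Ep !ctotD !ctot_cone !d1.
  rewrite Ep cadd_cone.
  have DE c : qhi D1 c = qhi D c * (if (c <= i)%N then q^-1 else 1).
    rewrite E /qhi hiD hi_cone; case: leqP; rewrite ?addn1 ?exprSr ?mulfK //.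
    by rewrite addn0 mulr1.
  have PE (k : 'I_n) c : qhi (cadd P1 (cone k)) c = qhi P1 c * (if (c <= k)%N then q else 1).
    by rewrite /qhi hiD hi_cone; case: leqP; rewrite ?addn1 ?exprSr ?addn0 ?mulr1.
  rewrite !DE leqnn leq0n /wt /= !eqSS !ltnS !PE leqnn ltnn [qhi D i]qhiS Di.
  rewrite [qhi P1 i]qhiS.
  have c0 : (i < j)%N = false by lia.
  have c1 : (j < i)%N = true by lia.
  have c2 : (i <= j)%N = false by lia.
  have c3 : (j <= i)%N = true by lia.
  have c4 : (j == i :> nat) = false by lia.
  have c5 : (i == j :> nat) = false by lia.
  rewrite ?c0 ?c1 ?c2 ?c3 ?c4 ?c5 /=.
  have := expf_neq0 (D1 i) q0; rewrite [q ^+ (D1 i).+1]exprS => un.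
  have := q1 (D1 i); rewrite exprS => n1.
  have := q1 (P1 i); rewrite exprS => n2.
  have := q1 (P1 j); rewrite exprS => n3.
  rewrite ?exprS -?/a; field.
  by rewrite ?q0 ?qhi_neq0 ?un ?n1 ?n2 ?n3.
- have ji : j != i by rewrite -val_eqE /= (gtn_eqF ij).
  rewrite cadd_cone_neq //.
  rewrite /REF /Pj; case: posnP => [P0|/csub_split[P1 Ep]].
    by rewrite P0 expr0 subrr !mul0r mulr0.
  have -> : csub (cadd P (cone i)) (cone j) = cadd P1 (cone i).
    by rewrite Ep -caddA [cadd (cone j) _]caddC caddA caddK.
  have -> : hc P D = qhi P i.+1 * hc P D1 / (1 - q ^+ (D1 i).+1).
    by rewrite E hcD_add.
  rewrite /phi1 [in hc P D1]Ep !hcP_add [in ctot P]Ep !ctotD !ctot_cone !d1.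
  rewrite Ep cadd_cone.
  have DE c : qhi D1 c = qhi D c * (if (c <= i)%N then q^-1 else 1).
    rewrite E /qhi hiD hi_cone; case: leqP; rewrite ?addn1 ?exprSr ?mulfK //.
    by rewrite addn0 mulr1.
  have PE (k : 'I_n) c : qhi (cadd P1 (cone k)) c = qhi P1 c * (if (c <= k)%N then q else 1).
    by rewrite /qhi hiD hi_cone; case: leqP; rewrite ?addn1 ?exprSr ?addn0 ?mulr1.
  rewrite !DE leqnn leq0n /wt /= !eqSS !ltnS !PE leqnn ltnn [qhi D i]qhiS Di.
  rewrite [qhi P1 i]qhiS.
  have c0 : (i < j)%N = true by lia.
  have c1 : (j < i)%N = false by lia.
  have c2 : (i <= j)%N = true by lia.
  have c3 : (j <= i)%N = false by lia.
  have c4 : (j == i :> nat) = false by lia.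
  have c5 : (i == j :> nat) = false by lia.
  rewrite ?c0 ?c1 ?c2 ?c3 ?c4 ?c5 /=.
  have := expf_neq0 (D1 i) q0; rewrite [q ^+ (D1 i).+1]exprS => un.
  have := q1 (D1 i); rewrite exprS => n1.
  have := q1 (P1 i); rewrite exprS => n2.
  have := q1 (P1 j); rewrite exprS => n3.
  rewrite ?exprS -?/a; field.
  by rewrite ?q0 ?qhi_neq0 ?un ?n1 ?n2 ?n3.
Qed.

Lemma stage1_caseS :
  \sum_k1 S1L B (lift ord0 j) l P D k1 = \sum_k1 S1R B (lift ord0 j) l P D k1.
Proof.
rewrite !big_ord_recl S1L_S0 S1R_S0.
under eq_bigr do rewrite S1L_SS.
under [in RHS]eq_bigr do rewrite S1R_SS.
rewrite -!mulr_sumr -!mulrDr; congr (_ * _).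
have E1 : q ^+ d = qhi D 0 / q by rewrite /qhi hi0 Dd exprS mulrAC divff ?mul1r.
rewrite E1; have qn := qhi_neq0 D; have qhn : qhi D n = 1 by rewrite /qhi hin.
case: (unliftP ord0 l) => [r|] ->.
  have H := stage1_kl q0 l1n l2n m1n m2n (gA m A) qn qhn Pj (ltn_ord j) (ltn_ord r).
  rewrite qw_X0 (_ : qw _ _ _ _ ord0 _ = wt (m1 / m2) m1 (gA m A) 0 r);
    last by rewrite /qw liftK.
  under eq_bigr do rewrite /qw liftK.
  apply: (etrans H); congr (_ + _); apply: eq_bigr => i _ /=.
  rewrite /st1R; case: (posnP (D i)) => [Di|Di]; last by rewrite qw_X.
  have e : qhi D i = qhi D i.+1 by rewrite qhiS Di expr0 mul1r.
  case: eqP => [/val_inj ij|_]; last by rewrite e subrr mulr0 !mul0r.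
  by rewrite -ij e divff ?qhi_neq0 // subrr !mul0r.
rewrite /qw unlift_none !mulr1.
apply: stage1_k0 => //. 
Qed.
End CaseS.

Lemma csum0 D : ctot D = 0%N -> D = czero n.
Proof.
move=> D0; apply/ffunP => i; rewrite ffunE; apply/eqP.
by rewrite -leqn0 -D0 ctot_ge.
Qed.

Lemma gA_offm c : gA m (offm m A) c = gA m A c.
Proof. by rewrite /gA; case: ltnP => // mc; rewrite hi_offm. Qed.

(** Only |D| = 0 escapes the normalization by |D| - 1; there the inner color must be 0. *)
Lemma stage1 B P D k l : cadd B (color_conf k) = cadd P D ->
  \sum_k1 S1L B k l P D k1 = \sum_k1 S1R B k l P D k1.
Proof.
case Dd: (ctot D) => [|d]; last first.
  case: (unliftP ord0 k) => [j|] ->; rewrite ?color_confS => E.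
    by apply: stage1_caseS E; exact: Dd.
  by rewrite color_conf0 cadd0 in E; rewrite E; by apply: stage1_case0; exact: Dd.
rewrite (csum0 Dd) cadd0 => E.
rewrite !big_ord_recl !big1 ?addr0; first last.
- by move=> i _; rewrite /S1L color_confS cle_cone ffunE.
- by move=> i _; rewrite /S1R color_confS cle_cone ffunE.
rewrite /S1L /S1R color_conf0 !cle0 csub0 !cadd0 /=.
have -> : qw (m1 / l2) m1 m (offm m A) ord0 l = qw (m1 / m2) m1 m A ord0 l.
  by rewrite /qw; case: (unlift ord0 l) => // r; rewrite !wt0E !gA_offm.
move: E; case: (unliftP ord0 k) => [j|] ->; rewrite ?color_confS ?color_conf0.
  move=> <-; rewrite cle_cone cadd_cone /= caddK /ellr unlift_none /=.
  rewrite /ell unlift_none /= /phi1 ctot0 ctotD ctot_cone addn1 qpS.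
  rewrite -[X in hc X _]/(cadd B (cone j)) hcP_add !qp0 gBS /qhi /hi.
  rewrite !big1 ?expr0; [|by move=> i _; rewrite ffunE..].
  by field; rewrite q1 oner_neq0.
rewrite cle0 csub0 cadd0 => ->.
by rewrite /ellr unlift_none eqxx /ell unlift_none /=; ring.
Qed.
End Stage1C.
End ConfWeights.

(** * Exchange relation for the second factor *)

Section Stage2.
Variables (K : fieldType) (q : K) (n : nat).
Hypothesis q1 : forall i, 1 - q ^+ i.+1 != 0.
Hypothesis q0 : q != 0.
Implicit Types (A B C D P X Y : conf n) (i j r : 'I_n) (k l : 'I_n.+1).
Local Notation qp := (qp q).
Local Notation gB := (gB q).
Local Notation hc := (hc q).
Local Notation qhi := (qhi q).
Local Notation ck := (@color_conf n).

(** Exhibits the weight as a difference of consecutive terms c_i G_i, the coefficient c jumping from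
    [s] to [lam] at the incoming color. *)
Lemma wtE (s lam : K) G (k i : nat) : wt s lam G k i =
  (if (i < k)%N then s else lam) * G i - (if (i.+1 < k)%N then s else lam) * G i.+1.
Proof.
by rewrite /wt; case: (ltngtP i.+1 k) => // _; ring.
Qed.

(** In the second exchange the two sides do not telescope separately, but their difference does, up
    to the factor 1 - y. The coefficients U, V of one side and A, B of the other enter only through
    their products. *)
Lemma exchange_identity (C y p d U0 U1 V0 V1 A0 A1 B0 B1 : K) :
  U0 * V0 = A0 * B0 -> U0 * V1 = A0 * B1 -> U1 * V0 = A1 * B0 ->
  U1 * V1 = A1 * B1 ->
  C * (U0 * (y * p) - U1) * (V1 * d - V0) - C * (A0 * p - A1) * (B1 * d * y - B0)
  = C * (1 - y) * (U0 * V0 * p - U1 * V1 * d).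
Proof.
move=> e00 e01 e10 e11.
transitivity (C * (U0 * V1 * (y * p * d) - U0 * V0 * (y * p) - U1 * V1 * d
  + U1 * V0 - (A0 * B1 * (p * d * y) - A0 * B0 * p - A1 * B1 * (d * y) + A1 * B0))).
  by ring.
by rewrite -e00 -e01 -e10 -e11; ring.
Qed.

Variable m : nat.

Lemma offmD A B : offm m (cadd A B) = cadd (offm m A) (offm m B).
Proof. by apply/ffunP => i; rewrite !ffunE; case: ifP. Qed.
Lemma offm_id A : offm m (offm m A) = offm m A.
Proof. by apply/ffunP => i; rewrite !ffunE; case: (m < i)%N. Qed.
Lemma offmB A B : offm m (csub A B) = csub (offm m A) (offm m B).
Proof. by apply/ffunP => i; rewrite !ffunE; case: ifP. Qed.
Lemma offm0 : offm m (czero n) = czero n.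
Proof. by apply/ffunP => i; rewrite !ffunE; case: ifP. Qed.

(* The value 0 encodes X_m = +oo. *)
Definition xs X i : K := if (m < i)%N then q ^+ X i else 0.
Local Notation o i := (offm m (cone i)).

(** At i = m nothing is added and [xs X m] is 0, so the rule for a finite coordinate also covers the
    infinite one. *)
Lemma gBo X i : gB (cadd X (o i)) = gB X * (1 - q * xs X i).
Proof.
rewrite /xs; case: ltnP => mi.
  have -> : o i = cone i by apply/ffunP => j; rewrite !ffunE; case: eqP => [->|]; rewrite ?mi //; case: ifP.
  by rewrite gBS exprS.
have -> : o i = czero n.
  apply/ffunP => j; rewrite !ffunE; case: eqP => [->|]; rewrite ?ltnNge ?mi //=; by case: ifP.
by rewrite cadd0 mulr0 subr0 mulr1.
Qed.

Lemma hco Y D i : (m <= i)%N -> lo D m = 0%N ->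
  hc (cadd Y (o i)) D * (1 - q * xs Y i) = q ^+ lo D i * hc Y D.
Proof.
move=> mi Dm; rewrite /xs; case: ltnP => mi'.
  have -> : o i = cone i by apply/ffunP => j; rewrite !ffunE; case: eqP => [->|]; rewrite ?mi' //; case: ifP.
  by rewrite -exprS hcP.
have -> : o i = czero n.
  apply/ffunP => j; rewrite !ffunE; case: eqP => [->|]; rewrite ?ltnNge ?mi' //=; by case: ifP.
have <- : m = i by apply/eqP; rewrite eqn_leq mi mi'.
by rewrite cadd0 mulr0 subr0 mulr1 Dm expr0 mul1r.
Qed.

Lemma qhiD A B c : qhi (cadd A B) c = qhi A c * qhi B c.
Proof. by rewrite /qhi hiD exprD. Qed.
Lemma qhi_offm A c : (m < c)%N -> qhi (offm m A) c = qhi A c.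
Proof. by move=> mc; rewrite /qhi hi_offm. Qed.
Lemma qhi_cone i c : qhi (cone i) c = if (c <= i)%N then q else 1.
Proof. by rewrite /qhi hi_cone; case: leqP; rewrite ?expr1. Qed.

Lemma gA_S A c : (m < c)%N -> gA q m A c = qhi A c.
Proof. by rewrite /gA => ->. Qed.
Lemma gA_xs A i : (m <= i)%N -> gA q m A i = xs A i * qhi A i.+1.
Proof.
rewrite /gA /xs leq_eqVlt => /orP[/eqP <-|mi]; first by rewrite ltnn mul0r.
by rewrite mi -/(qhi A i) qhiS.
Qed.
Lemma xsD A B i : xs (cadd A (offm m B)) i = xs A i * q ^+ B i.
Proof. by rewrite /xs !ffunE; case: (m < i)%N; rewrite ?mul0r ?exprD. Qed.

Variables (l1 l2 m1 m2 : K).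
Hypotheses (l1n : l1 != 0) (l2n : l2 != 0) (m1n : m1 != 0) (m2n : m2 != 0).
Let a := l1 / m2.
Let b := m2 / l2.
Let sg := l1 / l2.
Let z := m1 / l1.

(** By conservation X - [offm m D] is C - P, and the test on D is the condition P <= C. *)
Definition phi2 (z sg : K) D X : K :=
  if cle (offm m D) X then
    z ^+ ctot D * qp sg (ctot D) * gB X * hc (csub X (offm m D)) D
  else 0.

(** [S2R] has the vertices (l1, m2), (m1, l2) left by the first exchange. Passing [phi2] trades [l1]
    for [m1], which gives in [S2L] the row-0 vertex (m1, m2) followed by the L-vertex (l1, l2). *)
Definition S2L k l P D X kk : K :=
  if cle (ck kk) (cadd D (ck l)) then
    let D' := csub (cadd D (ck l)) (ck kk) in
    phi2 z sg D' X * qw q (m1 / m2) m1 m (cadd (csub X (offm m D')) (offm m P)) k kk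
    * ell q sg l1 D' kk l
  else 0.

Definition S2R k l P D X kk : K :=
  if cle (ck kk) (cadd P (ck k)) then
    ell q a l1 P k kk * qw q (m1 / l2) m1 m X kk l
    * phi2 z sg D (csub (cadd X (offm m (ck kk))) (offm m (ck l)))
  else 0.

Section Fixed.
Variables (k l : 'I_n.+1) (P D X : conf n).
Hypothesis Dm : forall i : 'I_n, (i < m)%N -> D i = 0%N.
Hypothesis Pm : forall i : 'I_n, (i < m)%N -> P i = 0%N.
Hypothesis km : k != ord0 -> (m < k)%N.
Hypothesis lm : l != ord0 -> (m < l)%N.

(** Whether the vertical tuple supplies D and the exiting color without help from the inner color.
    [REFh] is a part of the terms that does not depend on the inner color. *)
Let good := cle (offm m (cadd D (ck l))) X.
Let REFh := if good then hc (csub X (offm m (cadd D (ck l)))) D else 0.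
Let Q := if l == ord0 then 1 else qhi X l.
(** Coefficients of the row-0 weight ([u]) and of the L-weight ([v]) as functions of the inner
    color; the sequence that telescopes is u v T. For l = 0, [v] is the constant -1/z, coming from
    the power of z that [phi2] loses with one arrow. *)
Let u (i : nat) := if (i < k)%N then m1 / m2 else m1.
Let v (i : nat) := if l == ord0 then - (l1 / m1) else if (i < l)%N then l1 else sg.
Let Z := z ^+ ctot D * qp sg (ctot D).
Let T c := qhi P c * q ^+ lo D c.

Section Term.
Variable i : 'I_n.
Hypothesis mi : (m <= i)%N.
Let V := cle (offm m (cadd D (ck l))) (cadd X (o i)).
Let Y := csub (cadd X (o i)) (offm m (cadd D (ck l))).
Let p := q ^+ P i.
Let d := q ^+ D i.
Let y := xs Y i.

Lemma VE : V -> cadd X (o i) = cadd (cadd Y (offm m D)) (offm m (ck l)).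
Proof. by move=> /csubK E; rewrite -[LHS]E -/Y offmD caddA. Qed.

Lemma lo_Dm : lo D m = 0%N.
Proof. by rewrite /lo big1 // => j; exact: Dm. Qed.

Lemma cle_trans A B C : cle A B -> cle B C -> cle A C.
Proof.
by move=> /forallP ab /forallP bc; apply/forallP => x; exact: leq_trans (ab x) (bc x).
Qed.
Lemma cle_addr A B : cle A (cadd A B).
Proof. by apply/forallP => x; rewrite ffunE leq_addr. Qed.

Lemma good_V : good -> V.
Proof. by move=> g; apply: cle_trans g (cle_addr _ _). Qed.

(** The factor 1 - y turns [hc Y D] into an expression whose dependence on i is explicit. If V holds
    but [good] fails, coordinate i of Y is exhausted, so y = 1 and both sides vanish. *)
Lemma REFhE : V -> (1 - y) * hc Y D = q ^+ lo D i * REFh.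
Proof.
move=> v'; have E := VE v'; rewrite /REFh; case: ifP => g.
  have -> : Y = cadd (csub X (offm m (cadd D (ck l)))) (o i).
    by rewrite /Y -{1}(csubK g) -caddA [cadd (offm _ _) (o i)]caddC caddA caddK.
  rewrite -hco ?lo_Dm // mulrC; congr (_ * (1 - _)).
  by rewrite /y /Y -{1}(csubK g) -caddA [cadd (offm _ _) (o i)]caddC caddA caddK xsD ffunE eqxx expr1 mulrC.
suff -> : y = 1 by rewrite subrr mul0r mulr0.
move: g => /negbT; rewrite negb_forall; case/existsP => j.
rewrite -ltnNge => Xj; move/forallP: v' => /(_ j).
move: Xj; rewrite /y /xs /Y !ffunE; case: (ltnP m j) => mj //.
case: (eqVneq j i) => [<-|_]; last by rewrite addn0 => Xj h; move: (leq_trans Xj h); rewrite ltnn.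
by rewrite mj eqxx => Xj h; have -> : (X j + 1 - (D j + (j.+1 == l)) = 0)%N by lia.
Qed.

Lemma REFh0 : ~~ V -> REFh = 0.
Proof. by rewrite /REFh; case: ifP => // g; rewrite good_V. Qed.

Let uu (i : nat) := if (i < k)%N then a else l1.
Let vv (i : nat) := if l == ord0 then - 1 else if (i < l)%N then m1 else m1 / l2.

(** Trading [l1] for [m1] multiplies the coefficients of one vertex by m1/l1 and divides those of
    the other by it. *)
Lemma uvE (i' j' : nat) : u i' * v j' = uu i' * vv j'.
Proof.
rewrite /u /v /uu /vv /a /sg; case: ifP => _; case: ifP => _; try case: ifP => _.
all: by field; rewrite ?l1n ?l2n ?m1n ?m2n.
Qed.

Let Zc := Z * gB X * hc Y D * Q * qhi P i.+1.

Lemma qw_P Y' P' kk : qw q (m1 / m2) m1 m (cadd Y' (offm m P')) kk (lift ord0 i)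
  = qhi Y' i.+1 * qhi P' i.+1 *
    ((if (i < kk)%N then m1 / m2 else m1) * (xs Y' i * q ^+ P' i)
     - (if (i.+1 < kk)%N then m1 / m2 else m1)).
Proof.
rewrite /qw liftK wtE gA_xs // gA_S ?ltnS // !xsD !qhiD qhi_offm ?ltnS //.
by case: ifP => _; case: ifP => _; ring.
Qed.

Lemma wt_step (s lam : K) (r kk : nat) : kk != r.+1 ->
  (if (r.+1 < kk)%N then s else lam) = (if (r < kk)%N then s else lam).
Proof. by move=> h; rewrite [in RHS]leq_eqVlt eq_sym (negbTE h). Qed.

Lemma xs_o A j : xs (cadd A (o i)) j = xs A j * (if i == j :> nat then q else 1).
Proof.
rewrite xsD ffunE eq_sym; case: eqP => [->|/eqP h]; rewrite ?eqxx ?expr1 //.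
by rewrite -val_eqE /= eq_sym in h *; rewrite (negbTE h) mulr1.
Qed.
End Term.

Section Term2.
Variable i : 'I_n.
Hypothesis mi : (m <= i)%N.
Local Notation V := (cle (offm m (cadd D (ck l))) (cadd X (o i))).
Local Notation Y := (csub (cadd X (o i)) (offm m (cadd D (ck l)))).
Local Notation p := (q ^+ P i).
Local Notation d := (q ^+ D i).
Local Notation y := (xs Y i).
Local Notation uu := (fun j : nat => if (j < k)%N then a else l1).
Local Notation vv := (fun j : nat => if l == ord0 then - 1 else if (j < l)%N then m1 else m1 / l2).
Local Notation Zc := (Z * gB X * hc Y D * Q * qhi P i.+1).

Lemma S2R_E : V ->
  S2R k l P D X (lift ord0 i) =
  Zc * (uu i * p - uu i.+1) * (vv i.+1 * d * y - vv i).
Proof.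
move=> v'; have := VE v'; move: (Y) => Y0 E.
rewrite /S2R color_confS cle_cone; case: posnP => [P0|_].
  have [Pi0 ki] : P i = 0%N /\ (k : nat) != i.+1.
    move: P0; rewrite !ffunE => /eqP; rewrite addn_eq0 => /andP[/eqP ->].
    by case: (eqVneq i.+1 (k : nat)) => // h _; rewrite eq_sym.
  by rewrite /= (wt_step _ _ ki) Pi0 expr0 mulr1 subrr mulr0 mul0r.
have ellE : ell q a l1 P k (lift ord0 i) = qhi P i.+1 * (uu i * p - uu i.+1).
  by rewrite /ell liftK wtE qhiS /=; case: ifP => _; case: ifP => _; ring.
have phE : phi2 z sg D (csub (cadd X (o i)) (offm m (ck l))) =
    Z * gB (cadd Y0 (offm m D)) * hc Y0 D.
  by rewrite /phi2 E caddK cle_addl caddK.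
rewrite ellE phE /Q /=.
move: (_ * _ - (if (i.+1 < k)%N then a else l1)) => F.
have xE j : xs (cadd X (o i)) j = xs (cadd (cadd Y0 (offm m D)) (offm m (ck l))) j.
  by rewrite E.
have : gB (cadd X (o i)) = gB (cadd (cadd Y0 (offm m D)) (offm m (ck l))) by rewrite E.
rewrite gBo.
case: (unliftP ord0 l) xE E => [r|] lE xE E; last first.
  move: (xE i); rewrite lE color_conf0 offm0 cadd0 xs_o eqxx xsD => xi gE.
  by rewrite /qw unlift_none /= -gE [q * _]mulrC xi; ring.
rewrite lE color_confS gBo.
have mr : (m <= r)%N by move: (lm); rewrite lE => /(_ isT).
move: xE E; rewrite lE /= color_confS /bump add1n => xE E.
rewrite /qw liftK wtE gA_xs // gA_S //= !ltnS.
move=> gE; case: (eqVneq i r) => [ir|ir].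
  subst r; move: E => /caddI XE.
  have -> : xs X i = xs Y0 i * q ^+ D i by rewrite XE xsD.
  have -> : gB X = gB (cadd Y0 (offm m D)) by rewrite {1}XE.
  by rewrite leqnn ltnn; ring.
(* X plus the arrow i equals Y0 + D plus the arrow r; [gB] of this tuple is expanded in both
   ways. *)
have gE' : gB (cadd Y0 (offm m D)) * (1 - xs X r) = gB X * (1 - xs Y0 i * d).
  have eir : (i == r :> nat) = false by rewrite val_eqE (negbTE ir).
  have eri : (r == i :> nat) = false by rewrite eq_sym eir.
  move: gE (xE i) (xE r); rewrite !xs_o !eqxx eir eri !xsD !mulr1 => gE <- ->.
  by rewrite ![_ * q]mulrC gE.
case: (ltngtP i r) ir => [ir _|ir _|/val_inj-> /eqP//].
  transitivity (- m1 * qhi P i.+1 * F * qhi X r.+1 * Z * hc Y0 D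
    * (gB (cadd Y0 (offm m D)) * (1 - xs X r))); first by ring.
  by rewrite gE'; ring.
transitivity (- (m1 / l2) * qhi P i.+1 * F * qhi X r.+1 * Z * hc Y0 D
    * (gB (cadd Y0 (offm m D)) * (1 - xs X r))); first by ring.
by rewrite gE'; ring.
Qed.

Lemma S2L_E : V ->
  S2L k l P D X (lift ord0 i) =
  Zc * (u i * (y * p) - u i.+1) * (v i.+1 * d - v i).
Proof.
move=> v'; have := VE v'; move: (Y) => Y0 E.
rewrite /S2L color_confS cle_cone; case: posnP => [D0|D0].
  have [Di0 li] : D i = 0%N /\ (l : nat) != i.+1.
    move: D0; rewrite !ffunE => /eqP; rewrite addn_eq0 => /andP[/eqP ->].
    by case: (eqVneq i.+1 (l : nat)) => // h _; rewrite eq_sym.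
  by rewrite /v (wt_step _ _ li) Di0 expr0 mulr1 subrr mulr0.
set D' := csub _ _.
have DE : cadd D (ck l) = cadd D' (cone i) by rewrite csubK // cle_cone.
have XE : X = cadd Y0 (offm m D').
  by apply: (@caddI _ _ _ (o i)); rewrite -caddA -offmD -DE offmD caddA.
have -> : csub X (offm m D') = Y0 by rewrite XE caddK.
rewrite qw_P // /phi2 {1}XE cle_addl.
have -> : csub X (offm m D') = Y0 by rewrite XE caddK.
rewrite -/(u i) -/(u i.+1).
move: (_ * _ - u i.+1) => F.
rewrite /Q /v; case: (unliftP ord0 l) DE => [r|] lE DE; last first.
  rewrite lE color_conf0 cadd0 in DE.
  rewrite lE eqxx /ell unlift_none /= /Z DE ctotD ctot_cone addn1 exprSr qpS.
  rewrite (hcD_add q1) ?cadd_cone /z.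
  by field; rewrite ?l1n ?m1n ?q1.
have mr : (m <= r)%N by move: (lm); rewrite lE => /(_ isT).
rewrite lE color_confS in DE; rewrite lE /= /bump add1n /ell liftK wtE !ltnS.
have hE : hc Y0 D' = hc Y0 D * qhi Y0 r.+1 / (1 - q ^+ (D r).+1) * (1 - q ^+ (D' i).+1) / qhi Y0 i.+1.
  have := hcD q1 Y0 D' i; rewrite -DE (hcD_add q1 Y0 D r).
  move=> h; rewrite -[LHS](mulKf (qhi_neq0 q0 Y0 i.+1)) -h.
  by field; rewrite q1 (qhi_neq0 q0).
have tE : ctot D' = ctot D.
  by have := congr1 (@ctot n) DE; rewrite !ctotD !ctot_cone !addn1 => -[].
have QE : qhi X r.+1 = qhi Y0 r.+1 * qhi D' r.+1 by rewrite XE qhiD qhi_offm.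
rewrite tE -/Z QE (qhiS q D' r) hE.
case: (eqVneq i r) => [ir|ir].
  subst r; have -> : D' = D by apply: (@caddI _ _ _ (cone i)); rewrite DE.
  rewrite leqnn ltnn; field; rewrite ?(qhi_neq0 q0) ?q1 //.
have D'r : D' r = (D r).+1.
  by rewrite -cadd_cone DE cadd_cone_neq // eq_sym.
have D'i : D i = (D' i).+1.
  by rewrite -cadd_cone -DE cadd_cone_neq.
rewrite D'r D'i; case: (ltngtP i r) ir => [ir _|ir _|/val_inj-> /eqP//];
  by field; rewrite ?(qhi_neq0 q0) ?q1.
Qed.

(** When the tuple cannot supply the exiting arrows, [phi2] vanishes; if only the exiting color [l]
    is lacking, the row-0 weight does. *)
Lemma S2_0 : ~~ V ->
  S2L k l P D X (lift ord0 i) = 0 /\ S2R k l P D X (lift ord0 i) = 0.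
Proof.
move=> nV; split.
  rewrite /S2L color_confS; case: ifP => // h; rewrite /phi2; case: ifP => [h'|]; last by rewrite !mul0r.
  case/negP: nV; rewrite -(csubK h) offmD; apply/forallP => j.
  by move/forallP: h' => /(_ j) h'; rewrite [X in (X <= _)%N]ffunE [X in (_ <= X)%N]ffunE leq_add2r.
rewrite /S2R color_confS; case: ifP => // _; rewrite /phi2; case: ifP => [h|]; last by rewrite mulr0.
have [h'|] := boolP (cle (offm m (ck l)) (cadd X (o i))).
  case/negP: nV; rewrite -(csubK h') offmD; apply/forallP => j.
  by move/forallP: h => /(_ j) h; rewrite [X in (X <= _)%N]ffunE [X in (_ <= X)%N]ffunE leq_add2r.
case: (unliftP ord0 l) => [r|] lE; last by rewrite lE color_conf0 offm0 cle0.
rewrite lE color_confS negb_forall; case/existsP => j.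
rewrite -ltnNge !ffunE; case: (ltnP m j) => // mj.
case: (eqVneq j r) mj => // -> mr; rewrite ltnS leqn0 addn_eq0 eqb0 => /andP[/eqP Xr ri].
have {}ri : (r == i :> nat) = false by rewrite val_eqE; apply/negbTE.
rewrite /qw liftK wtE (gA_xs X (ltnW mr)) (gA_S X (leqW mr)) /xs mr Xr expr0 mul1r.
by rewrite (wt_step _ _ (_ : _ != _)) ?subrr ?mulr0 ?mul0r // /= /bump add1n eqSS eq_sym ri.
Qed.
End Term2.

Local Notation S0 := (S2L k l P D X ord0 - S2R k l P D X ord0).

Lemma S2_ord0 : S0 = Z * gB X * REFh * Q * (u n * v n * T n - u 0%N * v 0%N * T 0%N).
Proof.
have T0 : T 0%N = q ^+ ctot P by rewrite /T /qhi hi0 lo0 mulr1.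
have Tn : T n = q ^+ ctot D by rewrite /T /qhi hin lon mul1r.
rewrite T0 Tn /S2L /S2R color_conf0 !cle0 csub0 offm0 cadd0 /u ltnNge -ltnS ltn_ord /=.
have -> : ell q a l1 P k ord0 = 1 - (if (0 < k)%N then a else l1) * q ^+ ctot P.
  by rewrite /ell unlift_none.
case: (unliftP ord0 l) => [r|] lE; last first.
  rewrite /REFh /good /Q /v lE.
  rewrite color_conf0 offm0 cadd0 csub0 /qw unlift_none /ell unlift_none eqxx /phi2.
  case: ifP => _; last by ring.
  by rewrite /Z ltnn /a; case: (0 < k)%N; field; rewrite ?l1n ?m1n ?m2n.
have mr : (m <= r)%N by move: (lm); rewrite lE => /(_ isT).
have goodE : good = cle (offm m (cadd D (cone r))) X by rewrite /good lE color_confS.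
rewrite /REFh goodE /Q /v lE color_confS /= /bump add1n.
rewrite {1}/qw unlift_none /ell /qw !liftK !wtE (gA_xs X mr) (gA_S X (mr : (m < r.+1)%N)) /=.
rewrite /phi2; case: ifP => g; last first.
  rewrite !mul0r mulr0 !mul0r; case: (boolP (cle (offm m D) _)) => h;
    last by rewrite mulr0 subr0.
  suff -> : xs X r = 1 by rewrite mul1r subrr mulr0 mul0r subr0.
  move/negP: g; rewrite /xs; case: (ltnP m r) => [mr'|rm] h'; last first.
    case: h'; rewrite offmD; have -> : o r = czero n.
      apply/ffunP => j; rewrite !ffunE; case: eqP => [->|]; last by case: ifP.
      by rewrite ltnNge rm.
    rewrite cadd0; apply: (cle_trans h); apply/forallP => j; by rewrite !ffunE leq_subr.
  case: (posnP (X r)) => [->//|Xr]; case: h'.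
  have e : o r = cone r.
    by apply/ffunP => j; rewrite !ffunE; case: eqP => [->|]; rewrite ?mr' //; case: ifP.
  move: h; rewrite offmD e => h; rewrite -(@csubK _ X (cone r)) ?cle_cone //.
  by apply/forallP => j; move/forallP: h => /(_ j) h; rewrite [X in (X <= _)%N]ffunE [X in (_ <= X)%N]ffunE leq_add2r.
set Y0 := csub _ _.
have XE : X = cadd (cadd Y0 (offm m D)) (o r) by rewrite -caddA -offmD csubK.
have -> : csub X (o r) = cadd Y0 (offm m D) by rewrite XE caddK.
have gE : gB X = gB (cadd Y0 (offm m D)) * (1 - xs X r).
  by rewrite XE gBo [xs (cadd _ (o r)) r]xsD ffunE eqxx expr1 [_ * q]mulrC.
have qE : qhi X r.+1 = qhi Y0 r.+1 * qhi D r.+1.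
  by rewrite XE !qhiD !qhi_offm // qhi_cone ltnn mulr1.
rewrite cle_addl caddK gE qE [qhi (cadd D _) r](qhiS q) cadd_cone !qhiD qhi_cone ltnn.
rewrite ctotD ctot_cone addn1 exprSr qpS (hcD_add q1).
rewrite /Z [(n < _)%N]ltnNge ltn_ord /=; move: (qp sg _) (z ^+ ctot D) => F G.
by rewrite /z /a; case: (0 < k)%N; field; rewrite ?l1n ?m2n ?q1.
Qed.

(** The inner color 0 closes the telescoping: by [S2_ord0] it contributes exactly the difference of
    the end values of u v T at n and 0. *)
Lemma stage2 : \sum_kk S2L k l P D X kk = \sum_kk S2R k l P D X kk.
Proof.
apply/eqP; rewrite -subr_eq0 -sumrB big_ord_recl S2_ord0.
rewrite (eq_bigr (fun i : 'I_n => Z * gB X * REFh * Q * (- (u i.+1 * v i.+1 * T i.+1 - u i * v i * T i)))).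
  rewrite -mulr_sumr -mulrDr sumrN.
  rewrite -(big_mkord xpredT (fun i : nat => u i.+1 * v i.+1 * T i.+1 - u i * v i * T i)).
  by rewrite (telescope_sumr (fun i : nat => u i * v i * T i)) // subrr mulr0.
(* Colors below m are absent from P, D and both outer edges, so both terms are zero and the sequence
   u v T is constant there. *)
move=> i _; case: (leqP m i) => mi; last first.
  have [Pi Di] := (Pm mi, Dm mi).
  have ki : (k : nat) != i.+1.
    by case: (eqVneq k ord0) => [->//|/km mk]; rewrite gtn_eqF // (leq_ltn_trans mi).
  have li : (l : nat) != i.+1.
    by case: (eqVneq l ord0) => [->//|/lm ml]; rewrite gtn_eqF // (leq_ltn_trans mi).
  have -> : S2L k l P D X (lift ord0 i) = 0.
    by rewrite /S2L color_confS cle_cone !ffunE Di eq_sym (negbTE li).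
  have -> : S2R k l P D X (lift ord0 i) = 0.
    by rewrite /S2R color_confS cle_cone !ffunE Pi eq_sym (negbTE ki).
  rewrite /u /v (wt_step _ _ ki) (wt_step _ _ li) /T !(qhiS q P i) Pi loS Di addn0.
  by rewrite expr0 mul1r !subrr oppr0 mulr0.
have [hV|nV] := boolP (cle (offm m (cadd D (ck l))) (cadd X (o i))); last first.
  by case: (S2_0 nV) => -> ->; rewrite (REFh0 nV) subrr mulr0 !mul0r.
rewrite S2L_E // S2R_E //.
have := REFhE mi hV.
set y := xs _ i => RE.
have E1 := uvE i i; have E2 := uvE i i.+1; have E3 := uvE i.+1 i; have E4 := uvE i.+1 i.+1.
rewrite /T loS exprD [qhi P i](qhiS q P i).
rewrite (exchange_identity _ _ _ _ E1 E2 E3 E4).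
transitivity (Z * gB X * Q * qhi P i.+1 * (u i * v i * q ^+ P i - u i.+1 * v i.+1 * q ^+ D i)
   * ((1 - y) * hc (csub (cadd X (o i)) (offm m (cadd D (ck l)))) D)); first by ring.
by rewrite RE; ring.
Qed.
End Fixed.
End Stage2.

(** * Yang-Baxter equation *)

Section Subs.
Variable n : nat.
Implicit Types (A B C D P : conf n) (i j : 'I_n) (k l : 'I_n.+1).
Local Notation ck := (@color_conf n).

Lemma confP A B : (forall i, A i = B i :> nat) -> A = B.
Proof. by move=> h; apply/ffunP => i; rewrite h. Qed.

Definition emb T (p : {ffun 'I_n -> 'I_T.+1}) : conf n := [ffun i => p i : nat].
Definition subs B : seq (conf n) :=
  [seq P <- [seq emb p | p <- enum {: {ffun 'I_n -> 'I_(ctot B).+1}}] | cle P B].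

Lemma emb_inj T : injective (@emb T).
Proof.
move=> p p' /ffunP e; apply/ffunP => i; apply: val_inj.
by have := e i; rewrite !ffunE.
Qed.

Lemma emb_ex T P : (forall i, (P i <= T)%N) -> {p | P = @emb T p}.
Proof.
move=> h; exists [ffun i => inord (P i)]; apply/ffunP => i.
by rewrite !ffunE inordK // ltnS.
Qed.

Lemma subs_uniq B : uniq (subs B).
Proof. by rewrite filter_uniq // map_inj_uniq ?enum_uniq //; exact: emb_inj. Qed.

Lemma mem_subs B P : (P \in subs B) = cle P B.
Proof.
rewrite mem_filter andb_idr // => /forallP h; apply/mapP.
have [i|p ->] := @emb_ex (ctot B) P.
  exact: leq_trans (h i) (ctot_ge _ _).
by exists p; rewrite // mem_enum.
Qed.

Lemma csubDr A B C : cadd A B = C -> csub C B = A.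
Proof. by move=> <-; rewrite caddK. Qed.
Lemma caddAC A B C : cadd (cadd A B) C = cadd (cadd A C) B.
Proof. by rewrite -!caddA [cadd B C]caddC. Qed.

(** Substitution P' = P + k - e; the side conditions on the right say that P' comes from some P <=
    B. *)
Lemma sum_subs_move (R : nmodType) B (e k : conf n) (f : conf n -> conf n -> R) :
  \sum_(P <- subs B | cle e (cadd P k)) f P (csub (cadd P k) e)
  = \sum_(P <- subs (cadd B k) |
        cle e (csub (cadd B k) P) && cle k (cadd P e)) f (csub (cadd P e) k) P.
Proof.
rewrite -[LHS]big_filter -[RHS]big_filter.
pose h P := csub (cadd P e) k.
rewrite [RHS](eq_big_seq (fun P => (fun P0 => f P0 (csub (cadd P0 k) e)) (h P))); last first.
  by move=> P; rewrite mem_filter /h => /andP[/andP[_ kP] _]; rewrite csubK // caddK.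
rewrite -(big_map h xpredT (fun P0 => f P0 (csub (cadd P0 k) e))).
apply: perm_big; apply: uniq_perm; first exact: filter_uniq (subs_uniq _).
  rewrite map_inj_in_uniq; first exact: filter_uniq (subs_uniq _).
  move=> P P'.
  rewrite mem_filter => /andP[/andP[_ h1] _]; rewrite mem_filter => /andP[/andP[_ h2] _].
  by move/(congr1 (fun x : conf n => cadd x k)); rewrite /h !csubK // => /caddI.
suff key (P : conf n) : (P \in [seq P <- subs B | cle e (cadd P k)]) =
    (P \in [seq h P | P <- [seq P <- subs (cadd B k) |
        cle e (csub (cadd B k) P) && cle k (cadd P e)]]) by exact: key.
rewrite mem_filter mem_subs; apply/andP/mapP.
  move=> [/forallP h1 /forallP h2]; exists (csub (cadd P k) e).
    rewrite mem_filter mem_subs -andbA; apply/and3P.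
    by split; apply/forallP => i; move: (h1 i) (h2 i); rewrite !ffunE; lia.
  by apply: confP => i; move: (h1 i); rewrite /h !ffunE; lia.
move=> [C]; rewrite mem_filter mem_subs -andbA => /and3P[/forallP h1 /forallP h2 /forallP h3] ->.
by split; apply/forallP => i; move: (h1 i) (h2 i) (h3 i); rewrite /h !ffunE; lia.
Qed.

Lemma sum_subs_sub (R : nmodType) B (e : conf n) (f : conf n -> R) : cle e B ->
  \sum_(P <- subs (csub B e)) f P = \sum_(P <- subs B | cle e (csub B P)) f P.
Proof.
move=> eB; rewrite -[RHS]big_filter; apply: perm_big; apply: uniq_perm.
- exact: subs_uniq.
- exact: filter_uniq (subs_uniq _).
suff key (P : conf n) : (P \in subs (csub B e)) =
    (P \in [seq P <- subs B | cle e (csub B P)]) by exact: key.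
rewrite mem_subs mem_filter mem_subs; move/forallP: eB => eB.
apply/idP/andP => [/forallP h|[/forallP h1 /forallP h2]]; [split|].
all: apply/forallP => i.
1, 2: by move: (h i) (eB i); rewrite !ffunE; lia.
by move: (h1 i) (h2 i) (eB i); rewrite !ffunE; lia.
Qed.
End Subs.

Section YBE.
Variables (K : fieldType) (q : K) (n : nat).
Hypothesis q1 : forall i, 1 - q ^+ i.+1 != 0.
Hypothesis q0 : q != 0.
Implicit Types (A B C D P X Y : conf n) (i j r : 'I_n) (k l : 'I_n.+1).
Local Notation ck := (@color_conf n).
Variable m : nat.

Definition Rr (a b z sg : K) A B D : K :=
  \sum_(P <- subs B) gB q B * phi1 q a b P (csub B P)
     * phi2 q m z sg D (offm m (cadd A (csub B P))).

Variables (l1 l2 m1 m2 : K).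
Hypotheses (l1n : l1 != 0) (l2n : l2 != 0) (m1n : m1 != 0) (m2n : m2 != 0).
Let a := l1 / m2.
Let b := m2 / l2.
Let sg := l1 / l2.
Let z := m1 / l1.

(** For an exiting color absent from the vertex, q^0 = 1 makes the two terms of the weight cancel.
    Terms in which a truncated subtraction would be wrong thus vanish. *)
Lemma qw_exit0 (t mu : K) X (kk l : 'I_n.+1) : (l != ord0 -> (m < l)%N) ->
  ~~ cle (offm m (ck l)) (cadd X (offm m (ck kk))) -> qw q t mu m X kk l = 0.
Proof.
move=> lm; case: (unliftP ord0 l) lm => [r|] -> lm; last by rewrite color_conf0 offm0 cle0.
rewrite color_confS negb_forall; case/existsP => j; rewrite -ltnNge !ffunE.
case: (ltnP m j) => // mj; case: (eqVneq j r) mj => // -> mr.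
rewrite ltnS leqn0 addn_eq0 eqb0 => /andP[/eqP Xr ri].
rewrite /qw liftK wtE (gA_xs q X (ltnW mr)) (gA_S q X (leqW mr)) /xs mr Xr expr0 mul1r.
by rewrite (wt_step _ _ (_ : _ != _)) ?subrr // eq_sym.
Qed.

Variables (A B D : conf n) (k l : 'I_n.+1).
Hypothesis Ac : offm m A = A.
Hypothesis Bm : forall i : 'I_n, (i < m)%N -> B i = 0%N.
Hypothesis Dm : forall i : 'I_n, (i < m)%N -> D i = 0%N.
Hypothesis km : k != ord0 -> (m < k)%N.
Hypothesis lm : l != ord0 -> (m < l)%N.

(** Both exchanges are applied at fixed P. Between them the sum over P is shifted by the arrows that
    the intermediate L-vertex (l1, m2) puts into P and takes out of it. *)
Lemma ybe_R :
  \sum_kk (if cle (ck kk) (cadd D (ck l)) then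
      let D' := csub (cadd D (ck l)) (ck kk) in
      Rr a b z sg A B D' * qw q (m1 / m2) m1 m (csub (offm m (cadd A B)) (offm m D')) k kk
      * ell q sg l1 D' kk l else 0)
  = \sum_kk (if cle (ck kk) (cadd B (ck k)) then
      ellr q sg l1 B k kk * qw q (m1 / m2) m1 m A kk l
      * Rr a b z sg (csub (offm m (cadd A (ck kk))) (offm m (ck l)))
          (csub (cadd B (ck k)) (ck kk)) D else 0).
Proof.
pose X P := offm m (cadd A (csub B P)).
transitivity (\sum_(P <- subs B) gB q B * phi1 q a b P (csub B P) *
   \sum_kk S2L q m l1 l2 m1 m2 k l P D (X P) kk).
  under [RHS]eq_bigr do rewrite mulr_sumr.
  rewrite exchange_big; apply: eq_bigr => kk _; rewrite /S2L.
  case: ifP => h; last by rewrite big1 // => P _; rewrite mulr0.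
  rewrite /= /Rr !mulr_suml; apply: eq_big_seq => P; rewrite mem_subs => PB.
  rewrite -/(X P) !mulrA; congr (_ * _).
  case: (boolP (cle (offm m (csub (cadd D (ck l)) (ck kk))) (X P))) => h'; last first.
    by rewrite /phi2 (negbTE h') !(mulr0, mul0r).
  congr (_ * qw _ _ _ _ _ _ _).
  have E : offm m (cadd A B) = cadd (X P) (offm m P) by rewrite /X -offmD -caddA csubK.
  by apply: csubDr; rewrite E caddAC csubK.
have supp P C : cle P C -> (forall i : 'I_n, (i < m)%N -> C i = 0%N) ->
    forall i : 'I_n, (i < m)%N -> P i = 0%N.
  by move=> /forallP PC C0 i im; apply/eqP; rewrite -leqn0 -(C0 i im).
rewrite (eq_big_seq (fun P => gB q B * phi1 q a b P (csub B P) *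
   \sum_kk S2R q m l1 l2 m1 m2 k l P D (X P) kk)); last first.
  move=> P; rewrite mem_subs => PB; congr (_ * _).
  by apply: stage2 => //; exact: supp PB Bm.
pose G P' := phi2 q m z sg D (csub (offm m (cadd A (csub (cadd B (ck k)) P'))) (offm m (ck l))).
transitivity (\sum_(P <- subs (cadd B (ck k))) G P *
   \sum_kk S1R q l1 l2 m1 m2 m A B k l P (csub (cadd B (ck k)) P) kk).
  under eq_bigr do rewrite mulr_sumr.
  under [RHS]eq_bigr do rewrite mulr_sumr.
  rewrite exchange_big [RHS]exchange_big; apply: eq_bigr => kk _.
  pose f P P' := gB q B * phi1 q a b P (csub B P) * (ell q a l1 P k kk
    * qw q (m1 / l2) m1 m (X P) kk l * G P').
  transitivity (\sum_(P <- subs B | cle (ck kk) (cadd P (ck k))) f P (csub (cadd P (ck k)) (ck kk))).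
    rewrite [RHS]big_mkcond; apply: eq_big_seq => P; rewrite mem_subs => PB.
    rewrite /S2R; case: ifP => h; last by rewrite mulr0.
    rewrite /f /G; congr (_ * (_ * phi2 _ _ _ _ _ (csub _ _))).
    rewrite /X -offmD -caddA; congr (offm _ (cadd _ _)); apply: confP => i.
    by move/forallP: h => /(_ i); move/forallP: PB => /(_ i); rewrite !ffunE; lia.
  rewrite sum_subs_move [LHS]big_mkcond; apply: eq_big_seq => P; rewrite mem_subs => PB.
  rewrite /S1R; case: ifP => [/andP[h h']|_]; last by rewrite mulr0.
  rewrite /f /X.
  have -> : csub B (csub (cadd P (ck kk)) (ck k)) = csub (csub (cadd B (ck k)) P) (ck kk).
    apply: confP => i; move/forallP: h => /(_ i); move/forallP: PB => /(_ i).
    by move/forallP: h' => /(_ i); rewrite !ffunE; lia.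
  by ring.
transitivity (\sum_(P <- subs (cadd B (ck k))) G P *
   \sum_kk S1L q l1 l2 m1 m2 m A B k l P (csub (cadd B (ck k)) P) kk).
  apply: eq_big_seq => P; rewrite mem_subs => PB; rewrite stage1 //.
  by rewrite [RHS]caddC csubK.
under eq_bigr do rewrite mulr_sumr.
rewrite exchange_big; apply: eq_bigr => kk _.
case: ifP => h; last first.
  rewrite big1_seq // => P; rewrite mem_subs => /andP[_ PB].
  rewrite /S1L ifF ?mulr0 //; apply/negbTE; move/negP: h => h; apply/negP => h'.
  apply: h; apply/forallP => i; move/forallP: h' => /(_ i); move/forallP: PB => /(_ i).
  by rewrite !ffunE; lia.
rewrite /Rr sum_subs_sub // mulr_sumr [RHS]big_mkcond; apply: eq_big_seq => P.
rewrite mem_subs => PB; rewrite /S1L; case: ifP => // h'; last by rewrite mulr0.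
case: (boolP (cle (offm m (ck l)) (cadd A (offm m (ck kk))))) => hl; last first.
  by rewrite (qw_exit0 _ _ lm hl) !(mulr0, mul0r).
have -> : csub (csub (cadd B (ck k)) (ck kk)) P = csub (csub (cadd B (ck k)) P) (ck kk).
  by apply: confP => i; rewrite !ffunE; lia.
have -> : cadd P (csub (csub (cadd B (ck k)) P) (ck kk)) = csub (cadd B (ck k)) (ck kk).
  apply: confP => i; move/forallP: h => /(_ i); move/forallP: PB => /(_ i).
  by move/forallP: h' => /(_ i); rewrite !ffunE; lia.
rewrite /G.
suff -> : csub (offm m (cadd A (csub (cadd B (ck k)) P))) (offm m (ck l))
  = offm m (cadd (csub (offm m (cadd A (ck kk))) (offm m (ck l)))
       (csub (csub (cadd B (ck k)) P) (ck kk))) by ring.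
apply: confP => i; move/forallP: hl => /(_ i); move/forallP: h' => /(_ i).
by rewrite !ffunE; case: (m < i)%N; lia.
Qed.
End YBE.

(** * Vanishing beyond the truncation *)

Section Vanish.
Variables (K : fieldType) (q : K) (n : nat).
Hypothesis q1 : forall i, 1 - q ^+ i.+1 != 0.
Hypothesis q0 : q != 0.
Implicit Types (A B C D P X Y : conf n) (i j r : 'I_n) (k l : 'I_n.+1).

Definition dotp (g : 'I_n -> nat) P : nat := (\sum_i g i * P i)%N.
Lemma dotpD g P Q : dotp g (cadd P Q) = (dotp g P + dotp g Q)%N.
Proof. by rewrite /dotp -big_split; apply: eq_bigr => i _; rewrite ffunE mulnDr. Qed.
Lemma dotp_cone g i : dotp g (cone i) = g i.
Proof.
rewrite /dotp (bigD1 i) //= ffunE eqxx muln1 big1 ?addn0 // => j /negbTE ji.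
by rewrite ffunE ji muln0.
Qed.

Lemma sum_subs_add B (e : conf n) (f : conf n -> K) :
  \sum_(P <- subs (cadd B e) | cle e P) f P = \sum_(P <- subs B) f (cadd P e).
Proof.
transitivity (\sum_(P <- subs B | cle (czero n) (cadd P e)) f (csub (cadd P e) (czero n))).
  rewrite (sum_subs_move B (czero n) e (fun=> f)); apply: eq_bigl => P.
  by rewrite cle0 cadd0.
by apply: eq_big => P; rewrite ?cle0 ?csub0.
Qed.

Definition Sg (a b : K) B (f : conf n -> K) : K :=
  \sum_(P <- subs B) gB q B * phi1 q a b P (csub B P) * f P.

Lemma eq_Sg a b B f f' : (forall P, cle P B -> f P = f' P) -> Sg a b B f = Sg a b B f'.
Proof. by move=> h; apply: eq_big_seq => P; rewrite mem_subs => /h ->. Qed.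

Lemma SgZ a b B f (c : K) : Sg a b B (fun P => c * f P) = c * Sg a b B f.
Proof. by rewrite /Sg mulr_sumr; apply: eq_bigr => P _; rewrite mulrCA. Qed.

Lemma SgD a b B f f' : Sg a b B (fun P => f P + f' P) = Sg a b B f + Sg a b B f'.
Proof. by rewrite /Sg -big_split; apply: eq_bigr => P _; rewrite mulrDr. Qed.

(** A q-Pascal rule: the extra arrow of color [i] goes either to P or to B - P. Since [i] is the
    lowest color present, the power of q in the second case is q^|P|. *)
Lemma Sg_peel a b B i f : (forall j : 'I_n, (j < i)%N -> B j = 0%N) ->
  Sg a b (cadd B (cone i)) f =
  Sg a b B (fun P => (1 - a * q ^+ ctot P) * f (cadd P (cone i))
    + q ^+ ctot P * a * (1 - b * q ^+ (ctot B - ctot P)) * f P).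
Proof.
move=> Bi; set e := cone i.
have pascal P : cle P (cadd B e) ->
    gB q (cadd B e) * hc q P (csub (cadd B e) P) =
    (if cle e P then gB q B * hc q (csub P e) (csub (cadd B e) P) else 0)
    + (if cle e (csub (cadd B e) P)
       then q ^+ ctot P * (gB q B * hc q P (csub (csub (cadd B e) P) e)) else 0).
  move=> PB; set G := csub _ P; have E : cadd P G = cadd B e by rewrite caddC csubK.
  have low C : cle C (cadd B e) -> lo C i = 0%N.
    move=> /forallP h; rewrite /lo big1 // => j ji.
    have := h j; rewrite cadd_cone_neq ?Bi // ?leqn0 => [/eqP//|].
    by rewrite -val_eqE /= ltn_eqF.
  have loP := low _ PB; have loG : lo G i = 0%N by apply: low; rewrite -E; exact: cle_addl.
  have ctP : ctot P = (P i + hi P i.+1)%N by rewrite -(lo_hi P i) loP add0n hiS.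
  have -> : q ^+ ctot P = q ^+ P i * qhi q P i.+1 by rewrite ctP exprD.
  have Bv : q ^+ (B i).+1 = q ^+ P i * q ^+ G i by rewrite -cadd_cone -E ffunE exprD.
  have h1 : (if cle e P then gB q B * hc q (csub P e) G else 0) = gB q B * hc q P G * (1 - q ^+ P i).
    rewrite cle_cone; case: posnP => [->|Pi]; first by rewrite expr0 subrr mulr0.
    have PE : cadd (csub P e) e = P by rewrite csubK // cle_cone.
    rewrite -[in hc q P G]PE -[in q ^+ P i]PE cadd_cone hcP_add //.
    by rewrite -qlo // loG expr0 mul1r mulrA mulfVK.
  have h2 : (if cle e G then q ^+ P i * qhi q P i.+1 * (gB q B * hc q P (csub G e)) else 0)
      = q ^+ P i * (gB q B * hc q P G * (1 - q ^+ G i)).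
    rewrite cle_cone; case: posnP => [->|Gi]; first by rewrite expr0 subrr !mulr0.
    have GE : cadd (csub G e) e = G by rewrite csubK // cle_cone.
    rewrite -[in hc q P G]GE -[in q ^+ G i]GE cadd_cone hcD_add //.
    by field; rewrite q1 ?(qhi_neq0 q0).
  by rewrite h1 h2 gBS Bv; ring.
rewrite /Sg.
transitivity (\sum_(P <- subs (cadd B e) | cle e P)
   qp q a (ctot P) * qp q b (ctot (csub (cadd B e) P)) * a ^+ ctot (csub (cadd B e) P)
    * (gB q B * hc q (csub P e) (csub (cadd B e) P)) * f P
 + \sum_(P <- subs (cadd B e) | cle e (csub (cadd B e) P))
   qp q a (ctot P) * qp q b (ctot (csub (cadd B e) P)) * a ^+ ctot (csub (cadd B e) P)
    * (q ^+ ctot P * (gB q B * hc q P (csub (csub (cadd B e) P) e))) * f P).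
  rewrite [X in _ = X + _]big_mkcond [X in _ = _ + X]big_mkcond -big_split.
  apply: eq_big_seq => P; rewrite mem_subs => PB /=.
  transitivity (qp q a (ctot P) * qp q b (ctot (csub (cadd B e) P))
      * a ^+ ctot (csub (cadd B e) P) * (gB q (cadd B e) * hc q P (csub (cadd B e) P)) * f P).
    by rewrite /phi1; ring.
  by rewrite pascal //; case: ifP => _; case: ifP => _; ring.
rewrite -sum_subs_sub ?cle_addl // caddK.
rewrite sum_subs_add -big_split; apply: eq_big_seq => P; rewrite mem_subs => PB /=.
have -> : csub (cadd B e) (cadd P e) = csub B P by apply: confP => j; rewrite !ffunE; lia.
have -> : csub (csub (cadd B e) P) e = csub B P.
  by apply: confP => j; move/forallP: PB => /(_ j); rewrite !ffunE; lia.
have -> : ctot (csub (cadd B e) P) = (ctot (csub B P)).+1.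
  rewrite -addn1 -(ctot_cone i) -ctotD; congr ctot; apply: confP => j.
  by move/forallP: PB => /(_ j); rewrite !ffunE; lia.
have -> : (ctot B - ctot P = ctot (csub B P))%N.
  by rewrite -[in ctot B](csubK PB) ctotD addnK.
rewrite caddK ctotD ctot_cone addn1 !qpS exprS /phi1; ring.
Qed.

(** For g = 0 this is q-Vandermonde: the sum is (ab)_|B|, which contains the factor 1 - a b q^L. In
    general the lowest color is peeled off; monotonicity of g permits replacing g by g - 1 on the
    remaining colors when g_i > 0, and for |B| = L + 1 the induction passes to (aq, b, L - 1), hence
    the quantification over a, b, L and g. *)
Lemma Sg_vanish (L : nat) (a b : K) (g : 'I_n -> nat) B :
  a * b * q ^+ L = 1 -> (L < ctot B)%N ->
  (forall i j : 'I_n, (i < j)%N -> (g i <= g j)%N) -> (forall i, (g i <= L)%N) ->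
  Sg a b B (fun P => q^-1 ^+ dotp g P) = 0.
Proof.
move bE : (ctot B) => be; elim: be B bE L a b g => // be IH B bE L a b g abL LB gm gL.
have [i Bi Bmin] : exists2 i : 'I_n, (0 < B i)%N & forall j : 'I_n, (j < i)%N -> B j = 0%N.
  have [i0 Bi0] : exists i0 : 'I_n, (0 < B i0)%N.
    apply/existsP; apply: contra_eqT bE => /existsPn h.
    by rewrite /ctot big1 // => j _; apply/eqP; rewrite -leqn0 leqNgt.
  case: (@arg_minnP _ i0 (fun i => 0 < B i)%N (fun i : 'I_n => nat_of_ord i) Bi0) => i Bi h; exists i => //.
  by move=> j ji; apply/eqP; rewrite -leqn0 leqNgt; apply/negP => /h; rewrite leqNgt ji.
have [B1 BE] := csub_split Bi.
have bE1 : ctot B1 = be by move: bE; rewrite BE ctotD ctot_cone addn1 => -[].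
have B1min (j : 'I_n) : (j < i)%N -> B1 j = 0%N.
  by move=> ji; move: (Bmin j ji); rewrite BE !ffunE => /eqP; rewrite addn_eq0 => /andP[/eqP].
have w0 : q^-1 != 0 by rewrite invr_eq0.
have wK (k : nat) : q^-1 ^+ k * q ^+ k = 1 by rewrite -exprMn mulVf // expr1n.
pose S a b g := Sg a b B1 (fun P => q^-1 ^+ dotp g P).
pose S' a b g := Sg a b B1 (fun P => q ^+ ctot P * q^-1 ^+ dotp g P).
have peel : Sg a b B (fun P => q^-1 ^+ dotp g P) =
    (q^-1 ^+ g i - a * b * q ^+ be) * S a b g + a * (1 - q^-1 ^+ g i) * S' a b g.
  rewrite BE (Sg_peel _ _ _ B1min) -!SgZ -SgD; apply: eq_Sg => P PB1.
  rewrite dotpD dotp_cone exprD.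
  have -> : q ^+ be = q ^+ ctot P * q ^+ (ctot B1 - ctot P).
    by rewrite -exprD bE1 subnKC // -bE1 -[in ctot B1](csubK PB1) ctotD leq_addl.
  by ring.
(* A factor q^|P| lowers all exponents by one: colors below i carry no arrow, and the others have
   exponent at least g_i > 0. *)
have shift a' b' : (0 < g i)%N -> S' a' b' g = S a' b' (fun j => (g j).-1).
  move=> gi; apply: eq_Sg => Q /forallP QB1.
  have -> : dotp g Q = (dotp (fun j => (g j).-1) Q + ctot Q)%N.
    rewrite /dotp /ctot -big_split; apply: eq_bigr => j _ /=.
    have [ji|ij] := ltnP j i.
      have -> : Q j = 0%N by apply/eqP; rewrite -leqn0 -(B1min j ji) QB1.
      by rewrite !muln0.
    have gj : (0 < g j)%N.
      by move: ij; rewrite leq_eqVlt => /orP[/eqP/val_inj <- //|/gm]; exact: leq_trans.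
    by rewrite -[in LHS](prednK gj) mulSn addnC.
  by rewrite exprD -[RHS]mulr1 -(wK (ctot Q)); ring.
have gm' (j j' : 'I_n) : (j < j')%N -> ((g j).-1 <= (g j').-1)%N.
  by move=> /gm; lia.
rewrite peel; have [gi0|gi] := posnP (g i).
  rewrite gi0 expr0 subrr mulr0 mul0r addr0.
  move: LB; rewrite ltnS leq_eqVlt => /orP[/eqP <-|LB]; first by rewrite abL subrr mul0r.
  by rewrite /S (IH B1 bE1 L) // mulr0.
move: LB; rewrite ltnS leq_eqVlt => /orP[/eqP LE|LB]; last first.
  rewrite shift // /S (IH B1 bE1 L) // (IH B1 bE1 L) ?mulr0 ?addr0 // => j.
  by have := gL j; lia.
rewrite -LE abL.
(* From (a)_k (1 - a q^k) = (1 - a) (aq)_k, while turning a^|D| into (aq)^|D| costs q^-|D| = q^|P| /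
   q^be. *)
have key : S a b g - a * S' a b g = (1 - a) / q ^+ be * S' (a * q) b g.
  rewrite /S /S' /Sg mulr_sumr -sumrB mulr_sumr; apply: eq_big_seq => P.
  rewrite mem_subs => PB1; rewrite /phi1 exprMn.
  have -> : q ^+ be = q ^+ ctot P * q ^+ ctot (csub B1 P).
    by rewrite -exprD -ctotD caddC csubK // bE1.
  have := qpSl q a (ctot P); rewrite qpS => h.
  transitivity (gB q B1 * (qp q a (ctot P) * (1 - a * q ^+ ctot P)) * qp q b (ctot (csub B1 P))
    * a ^+ ctot (csub B1 P) * hc q P (csub B1 P) * q^-1 ^+ dotp g P); first by ring.
  rewrite h; field; rewrite !expf_neq0 //.
transitivity ((q^-1 ^+ g i - 1) * (S a b g - a * S' a b g)); first by ring.
rewrite key shift // /S (IH B1 bE1 L.-1) ?mulr0 //.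
- have L0 : (0 < L)%N by exact: leq_trans gi (gL i).
  by rewrite -[RHS]abL -{2}(prednK L0) exprS; ring.
- by rewrite -LE; have := gL i; lia.
- by move=> j; have := gL j; lia.
Qed.
End Vanish.

(** * Vanishing of the whole vertex sum *)

Section RrVanish.
Variables (K : fieldType) (q : K) (n : nat).
Hypothesis q1 : forall i, 1 - q ^+ i.+1 != 0.
Hypothesis q0 : q != 0.
Implicit Types (A B C D P X Y : conf n) (i j r : 'I_n) (k l : 'I_n.+1).

(** With c = q^(A_i + B_i) and the variable at q^(-P_i), this is (q)_x / (q)_(x-d) for x = A_i + B_i
    - P_i. It vanishes by itself when x < d, so it also encodes the test in [phi2]. *)
Definition fallp (c : K) (d : nat) : {poly K} := \prod_(t < d) (1 - (c * q^-1 ^+ t) *: 'X).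

Lemma size_fallp c d : (size (fallp c d) <= d.+1)%N.
Proof.
rewrite /fallp; elim: d => [|d IH]; first by rewrite big_ord0 size_polyC oner_neq0.
rewrite big_ord_recr /=; apply: leq_trans (size_polyMleq _ _) _.
have h : (size (1 - (c * q^-1 ^+ d) *: 'X)%R <= 2)%N.
  rewrite (leq_trans (size_polyD _ _)) // geq_max size_polyN size_poly1 /=.
  by rewrite (leq_trans (size_scale_leq _ _)) // size_polyX.
by rewrite -subn1 leq_subLR (leq_trans (leq_add IH h)) // addn2 add1n.
Qed.

Lemma horner_fallp c d x : (fallp c d).[x] = \prod_(t < d) (1 - c * x * q^-1 ^+ t).
Proof. by rewrite horner_prod; apply: eq_bigr => t _; rewrite !hornerE; ring. Qed.

Lemma qp_fall y d : qp q q (y + d) = qp q q y * \prod_(t < d) (1 - q ^+ (y + d) * q^-1 ^+ t).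
Proof.
elim: d => [|d IH]; first by rewrite big_ord0 mulr1 addn0.
rewrite addnS qpqS IH big_ord_recl expr0 mulr1 -mulrA [_ * (1 - _)]mulrC.
congr (_ * (_ * _)); apply: eq_bigr => t _; congr (1 - _).
by rewrite lift0 !exprS [RHS]mulrACA divff // mul1r.
Qed.

Lemma ccross_lo D Y : ccross D Y = (\sum_i Y i * lo D i)%N.
Proof.
rewrite /ccross (exchange_big_dep xpredT) //=; apply: eq_bigr => j _.
by rewrite /lo big_distrr; apply: eq_bigr => i _; rewrite mulnC.
Qed.

Variables (m : nat) (a b z sg : K).
Section Expansion.
Variables (A B D : conf n).
Hypothesis Dm : forall i : 'I_n, (i < m)%N -> D i = 0%N.
Let c i := q ^+ (A i + B i).
Definition vpoly i : {poly K} :=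
  if (m < i)%N then (c i * q^-1 ^+ D i) ^+ lo D i *: fallp (c i) (D i) else 1.

Lemma lo_below i : (i <= m)%N -> lo D i = 0%N.
Proof. by move=> im; rewrite /lo big1 // => j ji; apply: Dm; exact: leq_trans im. Qed.

(** P enters only through the variables q^(-P_i), the i-th one with degrees between [lo D i] and
    [lo D (i + 1)]; the lower bound comes from the crossing power of D with X - D. *)
Lemma phi2_vpoly P : cle P B ->
  phi2 q m z sg D (offm m (cadd A (csub B P)))
  = z ^+ ctot D * qp q sg (ctot D) / gB q D *
    \prod_i ((q^-1 ^+ P i) ^+ lo D i * (vpoly i).[q^-1 ^+ P i]).
Proof.
move=> /forallP PB; set X := offm m _.
have cX i : (m < i)%N -> c i * q^-1 ^+ P i = q ^+ X i.
  move=> mi; rewrite /c !ffunE mi -(subnKC (PB i)) addnCA exprD mulrAC addKn.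
  by rewrite -exprMn divff // expr1n mul1r.
rewrite /phi2; case: ifP => [/forallP h|/negbT]; last first.
  rewrite negb_forall; case/existsP => i.
  rewrite -ltnNge [offm m D i]ffunE; case: (boolP (m < i)%N) => // mi Dx.
  have Di : (X i < D i)%N by exact: Dx.
  have zero : \prod_(t < D i) (1 - q ^+ X i * q^-1 ^+ t) = 0.
    apply/eqP/prodf_eq0; exists (Ordinal Di) => //=.
    by rewrite -exprMn divff // expr1n subrr.
  rewrite (bigD1 i) //= /vpoly mi hornerZ horner_fallp cX // zero.
  by rewrite !(mul0r, mulr0).
rewrite /hc ccross_lo /gB; set Y := csub X _.
transitivity (z ^+ ctot D * qp q sg (ctot D) / (\prod_i qp q q (D i)) *
  \prod_i (qp q q (X i) / qp q q (Y i) * q ^+ (Y i * lo D i))).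
  rewrite big_split /= prodf_div prodrXr; field.
  by apply/andP; split; apply/prodf_neq0 => i _; rewrite qpq_neq0.
congr (_ * _); apply: eq_bigr => i _; rewrite /vpoly; case: ifP => mi; last first.
  have e0 : X i = 0%N by rewrite ffunE mi.
  rewrite lo_below; last by rewrite leqNgt mi.
  have Y0 : Y i = 0%N by apply/eqP; rewrite -leqn0 -e0 [Y i]ffunE leq_subr.
  by rewrite Y0 e0 muln0 !expr0 -[1 : {poly K}]/(1%:P) hornerC !mulr1 divff // qpq_neq0.
have XD : (D i <= X i)%N by move: (h i); rewrite [in X in (X <= _)%N]ffunE mi.
have Yi : Y i = (X i - D i)%N by rewrite [LHS]ffunE [offm _ _ i]ffunE mi.
rewrite hornerZ horner_fallp cX // mulrA -exprMn mulrA [q^-1 ^+ P i * c i]mulrC cX //.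
have XE : X i = (Y i + D i)%N by rewrite Yi subnK.
have -> : q ^+ X i * q^-1 ^+ D i = q ^+ Y i.
  by rewrite XE exprD -mulrA -exprMn divff // expr1n mulr1.
rewrite XE qp_fall exprM; field; exact: qpq_neq0.
Qed.

Lemma size_vpoly i : (size (vpoly i) <= (D i).+1)%N.
Proof.
rewrite /vpoly; case: ifP => _; last by rewrite size_poly1.
by rewrite (leq_trans (size_scale_leq _ _)) // size_fallp.
Qed.

(** Expand into monomials q^(-g.P). From lo D i <= g_i <= lo D (i + 1), g is nondecreasing and
    bounded by |D| <= L, as [Sg_vanish] requires. *)
Lemma Rr_vanish (L : nat) : a * b * q ^+ L = 1 -> (ctot D <= L)%N -> (L < ctot B)%N ->
  Rr q m a b z sg A B D = 0.
Proof.
move=> abL DL LB; rewrite /Rr -/(Sg q a b B (fun P => phi2 q m z sg D (offm m (cadd A (csub B P))))).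
pose g (s : {ffun 'I_n -> 'I_L.+1}) i := (lo D i + s i)%N.
pose C := z ^+ ctot D * qp q sg (ctot D) / gB q D.
rewrite (@eq_Sg _ q _ a b B _ (fun P => \sum_(s : {ffun 'I_n -> 'I_L.+1})
   C * (\prod_i (vpoly i)`_(s i)) * q^-1 ^+ dotp (g s) P)); last first.
  move=> P PB; rewrite phi2_vpoly // -/C.
  under eq_bigr => i _.
    rewrite (horner_coef_wide (n := L.+1)); last first.
      by apply: leq_trans (size_vpoly i) _; rewrite ltnS (leq_trans (ctot_ge _ _)).
    rewrite mulr_sumr; over.
  rewrite bigA_distr_bigA mulr_sumr; apply: eq_bigr => s _.
  rewrite -mulrA /dotp -prodrXr -big_split; congr (_ * _).
  apply: eq_bigr => i _ /=; rewrite mulrCA -exprD -exprM mulnC //.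
rewrite /Sg.
under eq_bigr do rewrite mulr_sumr.
rewrite exchange_big big1 // => s _.
(* Degrees s_i > D_i, which could break monotonicity, have zero coefficient. *)
have [/forallP sD|] := boolP [forall i, (s i <= D i)%N]; last first.
  rewrite negb_forall; case/existsP => i; rewrite -ltnNge => sD.
  rewrite big1 // => P _; rewrite (bigD1 i) //= nth_default ?mul0r ?mulr0 ?mul0r ?mulr0 //.
  exact: leq_trans (size_vpoly i) sD.
transitivity (Sg q a b B (fun P => C * (\prod_i (vpoly i)`_(s i)) * q^-1 ^+ dotp (g s) P)) => //.
rewrite SgZ (@Sg_vanish _ q n q1 q0 L) ?mulr0 //.
  move=> i j ij; rewrite /g; apply: leq_trans (leq_addr _ _).
  apply: (@leq_trans (lo D i.+1)); first by rewrite loS leq_add2l.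
  rewrite /lo [X in (_ <= X)%N](bigID (fun x : 'I_n => (x < i.+1)%N)) /=.
  rewrite [X in (_ <= X + _)%N](eq_bigl (fun x : 'I_n => (x < i.+1)%N)) ?leq_addr //.
  by move=> x; rewrite andb_idl // => /leq_trans; apply.
move=> i; rewrite /g; apply: leq_trans DL; apply: (@leq_trans (lo D i.+1)).
  by rewrite loS leq_add2l.
by rewrite -(lo_hi D i.+1) leq_addr.
Qed.
End Expansion.
End RrVanish.

(** * Rows carrying at most one arrow *)

Section SpinHalf.
Variables (K : fieldType) (q : K) (n : nat).
Hypothesis q1 : forall i, 1 - q ^+ i.+1 != 0.
Hypothesis q0 : q != 0.
Implicit Types (A B C D E P X Y : conf n).
Local Notation ck := (@color_conf n).

Definition PhiK A B (x y : K) :=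
  qp q x (ctot A) * qp q (y / x) (ctot (csub B A)) / qp q y (ctot B)
  * (y / x) ^+ ctot A * (gB q B * hc q A (csub B A)).

Lemma gBhc0 E : gB q E * hc q E (czero n) = 1.
Proof. by rewrite /hc ccross0l expr0 gB0 mulr1 mul1r (divff (gB_neq0 q1 _)). Qed.

Lemma gBhc0l E : gB q E * hc q (czero n) E = 1.
Proof. by rewrite /hc ccross0r expr0 gB0 !mul1r (divff (gB_neq0 q1 _)). Qed.

Lemma q11 : 1 - q != 0. Proof. exact: (q1 0). Qed.

Lemma gB_cone r : gB q (@cone n r) = 1 - q.
Proof. by rewrite -[cone r]cadd0 caddC gBS gB0 mul1r ffunE expr1. Qed.

Lemma gBhc_cone E r : gB q (cadd E (cone r)) * hc q E (cone r)
      = (1 - q ^+ (E r).+1) * qhi q E r.+1 / (1 - q).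
Proof.
rewrite /hc ccross_conel gBS gB_cone /qhi; field.
by rewrite (gB_neq0 q1) q11.
Qed.

Section L.
Variables (s x : K).
Hypotheses (s0 : s != 0) (x0 : x != 0) (sxq : forall d : nat, qp q (s * x) d != 0).
Let y := s * x.

Lemma y1 : 1 - y != 0.
Proof. by have := sxq 1%N; rewrite qpS qp0 mul1r expr0 mulr1. Qed.

(** The two arguments differ by the factor q, so (qy)_k / (y)_k reduces to its end factors (1 - y
    q^k) / (1 - y). *)
Lemma PhiK_full E k :
  PhiK E (cadd E (ck k)) (q * y) y =
  if unlift ord0 k is Some r
  then - q^-1 / (1 - y) * q^-1 ^+ ctot E * (qhi q E r.+1 * (1 - q ^+ (E r).+1))
  else (1 - y * q ^+ ctot E) / (1 - y) * q^-1 ^+ ctot E.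
Proof.
rewrite /PhiK [cadd E _]caddC caddK.
have y0 : y != 0 by rewrite mulf_neq0.
have -> : y / (q * y) = q^-1 by field; rewrite q0 y0.
have qe := qpSl q y (ctot E); have := sxq (ctot E).+1; have := sxq (ctot E).
rewrite [cadd _ E]caddC.
case: (unliftP ord0 k) => [r|] ->.
  rewrite color_confS ctotD ctot_cone addn1 gBhc_cone -/y => _.
  rewrite qe qpS qp0 expr0 mulrC mulf_eq0 negb_or => /andP[h _].
  rewrite [q * y]mulrC exprVn; field.
  by rewrite q0 q11 y1 h expf_neq0.
rewrite color_conf0 cadd0 gBhc0 ctot0 qp0 -/y.
rewrite qe mulf_eq0 negb_or => h /andP[_ h2].
rewrite [q * y]mulrC exprVn.
have -> : qp q (y * q) (ctot E) = qp q y (ctot E) * (1 - y * q ^+ ctot E) / (1 - y).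
  by rewrite -qpS qe [RHS]mulrC mulKf // y1.
by field; rewrite h y1 expf_neq0.
Qed.

Lemma PhiK_0 k : PhiK (czero n) (ck k) (q^-1 / (x / s)) q^-1
  = if k == ord0 then 1 else (1 - x / s) / (1 - q^-1).
Proof.
rewrite /PhiK ctot0 csub0 gBhc0l mulr1 qp0 expr0 mulr1 mul1r.
case: (unliftP ord0 k) => [r|] ->; last by rewrite color_conf0 ctot0 !qp0 divr1.
rewrite color_confS ctot_cone /= !qpS !qp0 !mul1r !expr0 !mulr1; congr (_ / _).
by congr (_ - _); field; rewrite s0 x0 q0.
Qed.

Lemma PhiK_1 r : PhiK (cone r) (cone r) (q^-1 / (x / s)) q^-1
  = (x / s - q^-1) / (1 - q^-1).
Proof.
have qv : 1 - q^-1 != 0.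
  by rewrite subr_eq0 eq_sym invr_eq1 eq_sym -subr_eq0 q11.
rewrite /PhiK ctot_cone.
have -> : csub (cone r) (cone r) = czero n :> conf n.
  by apply: confP => i; rewrite !ffunE subnn.
rewrite ctot0 gBhc0 !qpS !qp0 expr0 expr1; field.
have qm : q - 1 != 0 by rewrite -opprB oppr_eq0 q11.
by rewrite s0 x0 q0 qm.
Qed.

(** The fused weight for L = 1 with its sum over P written out: B is a color, so P is 0 or that
    color. *)
Definition fusedK A C k l :=
  (x / s) ^ ((ctot (ck l))%:Z - (ctot (ck k))%:Z) * q ^+ ctot A * (s ^- 2) ^- ctot (ck l) *
    (PhiK C (cadd C (ck l)) (q * y) y * PhiK (czero n) (ck k) (q^-1 / (x / s)) q^-1
     + if (k != ord0) && cle (ck k) C then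
       PhiK (csub C (ck k)) (csub (cadd C (ck l)) (ck k)) (q * y) y
         * PhiK (ck k) (ck k) (q^-1 / (x / s)) q^-1 else 0).

Lemma fusedKE A C k l : cadd A (ck k) = cadd C (ck l) ->
  fusedK A C k l = ell q (s ^+ 2) y A k l / (1 - y).
Proof.
have qv : 1 - q^-1 != 0.
  by rewrite subr_eq0 eq_sym invr_eq1 eq_sym -subr_eq0 q11.
have qm : q - 1 != 0 by rewrite -opprB oppr_eq0 q11.
have y1' := y1.
rewrite /fusedK PhiK_full PhiK_0.
case: (unliftP ord0 k) => [j|] ->; case: (unliftP ord0 l) => [r|] ->.
- rewrite !color_confS !ctot_cone subrr expr0z mul1r expr1 PhiK_1 cle_cone /= => E.
  have sE : (s ^- 2)^-1 = s ^+ 2 by rewrite invrK.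
  rewrite sE /ell liftK wtE /= /bump add1n !ltnS.
  (* Without an arrow of index j in C the second term is absent, and conservation forces r = j and A
     = C. *)
  have [Cj|/csub_split[C1 CE]] := posnP (C j).
    have jr : j = r.
      apply/eqP; move/ffunP: E => /(_ j); rewrite cadd_cone !ffunE Cj.
      by case: eqP.
    subst r; have -> : A = C by exact: caddI E.
    rewrite ltnn leqnn addr0 (qhiS q _ j) Cj expr0 exprVn /y; field.
    by rewrite qm s0 q0 y1' expf_neq0.
  have -> : A = cadd C1 (cone r) by apply: (@caddI _ _ _ (cone j)); rewrite E CE caddAC.
  have -> : csub (cadd C (cone r)) (cone j) = cadd C1 (cone r) by rewrite CE caddAC caddK.
  have -> : csub C (cone j) = C1 by rewrite CE caddK.
  rewrite -(color_confS r) PhiK_full liftK color_confS.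
  rewrite CE !ctotD !ctot_cone !addn1 (qhiS q (cadd C1 (cone r)) r) cadd_cone !qhiD !qhi_cone ltnn.
  have -> : (cadd C1 (cone j)) r = (C1 r + (r == j))%N by rewrite !ffunE.
  rewrite !exprVn !exprS -(val_eqE r j) /=.
  by case: (ltngtP r j) => _; rewrite ?addn0 ?addn1 ?exprS /y; field;
    rewrite qm s0 q0 y1' expf_neq0.
- rewrite color_confS color_conf0 ctot0 ctot_cone !cadd0 cle_cone PhiK_1 => <-.
  rewrite cadd_cone /= caddK (_ : (0%:Z - 1%:Z)%R = -1) // exprN1.
  have := PhiK_full A ord0; rewrite unlift_none color_conf0 cadd0 => ->.
  rewrite ctotD ctot_cone addn1 expr0 invr1 mulr1 /ell unlift_none /= !exprVn !exprS /y; field.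
  by rewrite qm s0 x0 q0 y1' expf_neq0.
- rewrite eqxx /= color_conf0 cadd0 color_confS ctot_cone ctot0 => ->.
  rewrite (_ : (1%:Z - 0%:Z)%R = 1) // expr1z addr0 mulr1 expr1 ctotD ctot_cone addn1.
  rewrite /ell liftK wtE /= (qhiS q _ r) cadd_cone qhiD qhi_cone ltnn !exprVn.
  rewrite !exprS /y; field.
  by rewrite s0 q0 y1' oner_neq0 expf_neq0.
- rewrite eqxx /= color_conf0 !cadd0 ctot0 => ->.
  rewrite subrr expr0z addr0 !expr0 invr1 /ell unlift_none ltnn exprVn; field.
  by rewrite y1' expf_neq0.
Qed.
End L.

Lemma subs_color k : subs (ck k) =i
  (if k == ord0 then [:: czero n] else [:: czero n; ck k]).
Proof.
move=> P; rewrite mem_subs; case: (unliftP ord0 k) => [j|] -> /=.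
  rewrite !inE color_confS; apply/idP/orP => [/forallP h|[] /eqP->]; rewrite ?cle0 //.
    have [Pj|Pj] := posnP (P j); [left|right]; apply/eqP/confP => i.
      have := h i; rewrite !ffunE; case: eqP => [->|_]; first by rewrite Pj.
      by rewrite leqn0 => /eqP.
    have := h i; rewrite !ffunE; case: eqP => [->|_]; last by rewrite leqn0 => /eqP.
    by case: (P j) Pj => [|[]].
  by apply/forallP => i.
rewrite ?eqxx inE color_conf0; apply/idP/eqP => [/forallP h|->]; last exact: cle0.
by apply: confP => i; have := h i; rewrite ffunE leqn0 => /eqP.
Qed.

Lemma sum_subs_color k (F : conf n -> K) :
  \sum_(P <- subs (ck k)) F P = F (czero n) + (if k == ord0 then 0 else F (ck k)).
Proof.
have u : uniq (if k == ord0 then [:: czero n] else [:: czero n; ck k]).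
  case: (unliftP ord0 k) => [j|] -> //=; rewrite inE andbT color_confS; apply/eqP.
  by move=> /ffunP /(_ j); rewrite !ffunE eqxx.
rewrite (perm_big _ (uniq_perm (subs_uniq _) u (subs_color k))).
by case: ifP => _; rewrite !big_cons big_nil /= !addr0.
Qed.

Section Row0.
Variables (m : nat) (a b z : K) (A : conf n) (k l : 'I_n.+1).
Hypothesis ab : a * b = q^-1.
Hypothesis a0 : a != 0.
Hypothesis Ac : offm m A = A.
Hypothesis km : k != ord0 -> (m < k)%N.
Hypothesis lm : l != ord0 -> (m < l)%N.

Lemma phi2_cone (X : conf n) (r : 'I_n) : (m <= r)%N -> offm m X = X ->
  phi2 q m z q^-1 (cone r) X = - (z / q) * qhi q X r.+1 * (1 - xs q m X r).
Proof.
move=> mr Xc; have qm : q - 1 != 0 by rewrite -opprB oppr_eq0 q11.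
rewrite /phi2 ctot_cone qpS qp0 expr0 expr1.
move: mr; rewrite leq_eqVlt => /orP[/eqP mr|mr].
  have -> : offm m (cone r) = czero n.
    apply: confP => i; rewrite !ffunE mr; case: (i =P r) => [->|_]; first by rewrite ltnn.
    by case: (_ < _)%N.
  rewrite cle0 csub0 /xs mr ltnn /hc ccross_conel gB_cone -/(qhi _ _ _); field.
  by rewrite (gB_neq0 q1) q0 q11.
have -> : offm m (cone r) = cone r.
  apply: confP => i; rewrite !ffunE; case: (i =P r) => [->|_]; first by rewrite mr.
  by case: (_ < _)%N.
rewrite cle_cone /xs mr; case: posnP => [->|/csub_split[X1 ->]].
  by rewrite expr0 subrr mulr0.
rewrite caddK -[_ * gB q _ * hc _ _ _]mulrA gBhc_cone cadd_cone qhiD qhi_cone ltnn; field.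
by rewrite q0 q11.
Qed.

(** The queue weight at s_1^2 = 1/q, where ab = s_1^2. With the parameters of row 0, a z is s_2^2 =
    m1/m2 and z/q is x s_2/v = m1. *)
Lemma Rr_half : Rr q m a b z q^-1 A (ck k) (ck l) / qp q q^-1 (ctot (ck k))
  = qw q (a * z) (z / q) m A k l.
Proof.
have qm : q - 1 != 0 by rewrite -opprB oppr_eq0 q11.
have bE : b = q^-1 / a by rewrite -ab mulrC mulKf.
rewrite /Rr sum_subs_color !csub0.
have -> : csub (ck k) (ck k) = czero n by apply: confP => i; rewrite !ffunE subnn.
rewrite cadd0 Ac /phi1 ctot0 !qp0 expr0.
have h0 E : gB q E * (1 * qp q b (ctot E) * a ^+ ctot E * hc q (czero n) E) = qp q b (ctot E) * a ^+ ctot E.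
  transitivity (qp q b (ctot E) * a ^+ ctot E * (gB q E * hc q (czero n) E)); first by ring.
  by rewrite gBhc0l mulr1.
have h1 E : gB q E * (qp q a (ctot E) * 1 * 1 * hc q E (czero n)) = qp q a (ctot E).
  transitivity (qp q a (ctot E) * (gB q E * hc q E (czero n))); first by ring.
  by rewrite gBhc0 mulr1.
rewrite h0 h1.
have phi0 X : phi2 q m z q^-1 (ck ord0) X = 1.
  by rewrite color_conf0 /phi2 offm0 cle0 csub0 ctot0 qp0 expr0 !mul1r gBhc0.
case: (unliftP ord0 l) lm => [r|] -> lm'; last first.
  rewrite !phi0 !mulr1 /qw unlift_none; case: (unliftP ord0 k) => [j|] ->.
    rewrite color_confS ctot_cone !qpS !qp0 !expr0 expr1 bE /=; field.
    by rewrite q0 qm a0.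
  by rewrite color_conf0 ctot0 !qp0 expr0 eqxx addr0 mulr1 divr1.
have mr : (m <= r)%N by exact: lm'.
rewrite color_confS !phi2_cone //; last by rewrite offm_id.
rewrite /qw liftK wtE (gA_xs q A mr) (gA_S q A (mr : m < r.+1)%N).
case: (unliftP ord0 k) km => [j|] -> km'; last first.
  rewrite color_conf0 ctot0 !qp0 expr0 eqxx cadd0 Ac /= ; field; rewrite q0 ?oner_neq0 //.
have mj : (m <= j)%N by exact: km'.
rewrite color_confS ctot_cone !qpS !qp0 !expr0 expr1 offmD Ac xs_o qhiD qhi_offm // qhi_cone.
rewrite /= /bump add1n !ltnS bE.
by case: (ltngtP r j) => _; field; rewrite q0 qm a0.
Qed.
End Row0.
End SpinHalf.

(** * Yang-Baxter equation in a truncated row *)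

Section LocalYBE.
Variables (K : fieldType) (q : K) (n : nat).
Hypothesis q1 : forall i, 1 - q ^+ i.+1 != 0.
Hypothesis q0 : q != 0.
Local Notation ck := (@color_conf n).
Variables (l1 l2 m1 m2 : K).
Hypotheses (l1n : l1 != 0) (l2n : l2 != 0) (m1n : m1 != 0) (m2n : m2 != 0).
Let sg := l1 / l2.
Variable m : 'I_n.

(* The numbers of arrows allowed on a horizontal edge of the row. *)
Variable al : nat -> Prop.
Hypothesis al_le : forall d e, (d <= e)%N -> al e -> al d.
Hypothesis al_not : forall d, ~ al d ->
  exists L, [/\ (L < d)%N, sg * q ^+ L = 1 & forall e, al e -> (e <= L)%N].
Hypothesis al_qp : forall d, al d -> qp q sg d != 0.

Definition below (B : conf n) := forall i : 'I_n, (i < m)%N -> B i = 0%N.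
Definition above (k : 'I_n.+1) := k != ord0 -> (m < k)%N.

Variables (W : conf n -> conf n -> conf n -> conf n -> K).
Variables (w : conf n -> 'I_n.+1 -> conf n -> 'I_n.+1 -> K).
Variables (Lw : conf n -> 'I_n.+1 -> conf n -> 'I_n.+1 -> K).
Variables (p0 p1 p2 : K).
Hypothesis WE : forall A B C D, below B ->
  W A B C D = if `[< [/\ offm m (cadd A B) = offm m (cadd C D),
             below D, al (ctot B) & al (ctot D)] >]
  then p1 * (Rr q m (l1 / m2) (m2 / l2) (m1 / l1) (l1 / l2) A B D / qp q (l1 / l2) (ctot B)) else 0.
Hypothesis wE : forall A C k l, offm m A = A -> above k -> above l ->
  w A k C l = if offm m (cadd A (ck k)) == offm m (cadd C (ck l))
  then p0 * qw q (m1 / m2) m1 m A k l else 0.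
Hypothesis LE : forall B D k l, Lw B k D l = if cadd B (ck k) == cadd D (ck l)
  then ell q (l1 / l2) l1 B k l / p2 else 0.

(** At the largest allowed d, the truncation level L is d itself. *)
Lemma al_step d : al d -> ~ al d.+1 -> sg * q ^+ d = 1.
Proof.
move=> ad nd; have [L [Ld sL h]] := al_not nd.
by have -> : d = L by apply/eqP; rewrite eqn_leq h.
Qed.

Lemma ctot_ck k : ctot (ck k) = (k != ord0).
Proof.
case: (unliftP ord0 k) => [j|] ->; first by rewrite color_confS ctot_cone.
by rewrite color_conf0 ctot0 eqxx.
Qed.

Lemma below_move (E : conf n) j kk : below E -> above j -> cle (ck kk) (cadd E (ck j)) ->
  above kk /\ below (csub (cadd E (ck j)) (ck kk)).
Proof.
move=> Em jm /forallP h.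
have jE (i : 'I_n) : (i < m)%N -> (i.+1 == j :> nat) = false.
  move=> im; apply/eqP => ij; have /jm : j != ord0 by rewrite -val_eqE /= -ij.
  by rewrite -ij ltnS leqNgt im.
split; last by move=> i im; rewrite !ffunE Em // add0n jE.
case: (unliftP ord0 kk) h => [i|] -> //= h _.
have hi : (0 < E i + (i.+1 == j :> nat))%N by have := h i; rewrite !ffunE lift0 eqxx.
rewrite lift0 ltnS leqNgt; apply/negP => im; move: hi.
by rewrite Em // add0n jE.
Qed.

Section Fixed.
Variables (A A'' B D : conf n) (k l : 'I_n.+1).
Hypothesis Ac : offm m A = A.
Hypothesis Bm : below B.
Hypothesis Dm : below D.
Hypothesis km : above k.
Hypothesis lm : above l.
Hypothesis Bal : al (ctot B).

(** The inner tuples, vertical and horizontal, are already expressed by conservation; only the color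
    [kk] of the inner row-0 edge is left to sum over. *)
Definition tL kk :=
  if cle (ck kk) (cadd D (ck l)) then
    let D' := csub (cadd D (ck l)) (ck kk) in
    let C := csub (offm m (cadd A B)) (offm m D') in
    W A B C D' * w C k A'' kk * Lw D' kk D l
  else 0.
Definition tR kk :=
  if cle (ck kk) (cadd B (ck k)) then
    let B' := csub (cadd B (ck k)) (ck kk) in
    let A' := csub (offm m (cadd A (ck kk))) (offm m (ck l)) in
    Lw B k B' kk * (w A kk A' l * W A' B' A'' D)
  else 0.

Let cons := offm m (cadd A (cadd B (ck k))) == offm m (cadd A'' (cadd D (ck l))).
Let Kc := p0 * p1 / p2 / qp q (l1 / l2) (ctot B).

Lemma Rr0 D' : ~~ cle (offm m D') (offm m (cadd A B)) ->
  Rr q m (l1 / m2) (m2 / l2) (m1 / l1) (l1 / l2) A B D' = 0.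
Proof.
move=> h; rewrite /Rr big1_seq // => P; rewrite mem_subs => /andP[_ /forallP PB].
rewrite /phi2 ifF ?mulr0 //; apply: contraNF h => /forallP h.
apply/forallP => i; apply: leq_trans (h i) _; rewrite !ffunE; case: ifP => // _.
by rewrite leq_add2l leq_subr.
Qed.

Lemma pw (C E : conf n) : C = E -> forall i : 'I_n, C i = E i :> nat.
Proof. by move=> ->. Qed.

Lemma csub_offm (C E : conf n) : offm m (csub (offm m C) (offm m E)) = csub (offm m C) (offm m E).
Proof. by rewrite offmB !offm_id. Qed.

Lemma tLE kk : tL kk = if cons && cle (ck kk) (cadd D (ck l)) then
  let D' := csub (cadd D (ck l)) (ck kk) in
  if `[< al (ctot D') >] then
  Kc * (Rr q m (l1 / m2) (m2 / l2) (m1 / l1) (l1 / l2) A B D'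
    * qw q (m1 / m2) m1 m (csub (offm m (cadd A B)) (offm m D')) k kk
      * ell q (l1 / l2) l1 D' kk l) else 0 else 0.
Proof.
rewrite /tL; case: ifP => h; last by rewrite andbF.
have [kkm D'm] := below_move Dm lm h; rewrite andbT.
set D' := csub (cadd D (ck l)) (ck kk); set C := csub (offm m (cadd A B)) (offm m D') => /=.
have DE : cadd D' (ck kk) = cadd D (ck l) by rewrite /D' csubK.
rewrite LE DE eqxx (wE _ (csub_offm _ _) km kkm) (WE _ _ _ Bm).
have [CE|nC] := boolP (cle (offm m D') (offm m (cadd A B))); last first.
  rewrite (Rr0 nC); do ?case: ifP => _; by do ?[rewrite mul0r | rewrite mulr0].

have e1 : offm m (cadd A B) = offm m (cadd C D').
  by rewrite [RHS]offmD /C csub_offm csubK.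
have -> : (offm m (cadd C (ck k)) == offm m (cadd A'' (ck kk))) = cons.
  rewrite /cons -DE; move: {CE} e1; move: (C) (D') => C1 D1 e1.
  apply/eqP/eqP => e; apply: confP => i;
    have := pw e i; have := pw e1 i; rewrite !ffunE; case: (m < i)%N => //;
    move: (A i) (B i) (C1 i) (D1 i) (ck k i) (ck kk i) (A'' i) => *; lia.
case: (boolP cons) => _; last by rewrite mulr0 mul0r.
have [aD|aD] := pselect (al (ctot D')).
  rewrite (asboolT aD) asboolT; first by rewrite /Kc; ring.
  by split.
by rewrite (asboolF aD) asboolF ?mul0r // => -[].
Qed.

Lemma tRE kk : tR kk = if cons && cle (ck kk) (cadd B (ck k)) then
  let B' := csub (cadd B (ck k)) (ck kk) in
  if `[< al (ctot B') /\ al (ctot D) >] then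
  Kc * (ellr q (l1 / l2) l1 B k kk * qw q (m1 / m2) m1 m A kk l
   * Rr q m (l1 / m2) (m2 / l2) (m1 / l1) (l1 / l2) (csub (offm m (cadd A (ck kk))) (offm m (ck l))) B' D)
   else 0 else 0.
Proof.
rewrite /tR; case: ifP => h; last by rewrite andbF.
have [kkm B'm] := below_move Bm km h; rewrite andbT.
set B' := csub (cadd B (ck k)) (ck kk).
set A' := csub (offm m (cadd A (ck kk))) (offm m (ck l)) => /=.
have BE : cadd B' (ck kk) = cadd B (ck k) by rewrite /B' csubK.
rewrite LE BE eqxx (wE _ Ac kkm lm) (WE _ _ _ B'm).
have [lA|nl] := boolP (cle (offm m (ck l)) (cadd A (offm m (ck kk)))); last first.
  rewrite (qw_exit0 _ _ _ lm nl); do ?case: ifP => _; by do ?[rewrite mul0r | rewrite mulr0].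
have A'E : cadd A' (offm m (ck l)) = offm m (cadd A (ck kk)).
  by rewrite /A' csubK // offmD Ac.
have A'c : offm m A' = A' by rewrite /A' csub_offm.
rewrite ifT; last by rewrite [X in _ == X]offmD A'c A'E.
have -> : `[< [/\ offm m (cadd A' B') = offm m (cadd A'' D), below D, al (ctot B') & al (ctot D)] >]
   = cons && `[< al (ctot B') /\ al (ctot D) >].
  have consE : offm m (cadd A' B') = offm m (cadd A'' D) <-> cons.
    rewrite /cons -BE; move: (A') (B') A'E => A1 B1 A1E.
    split=> [e|/eqP e]; [apply/eqP|]; apply: confP => i;
      have := pw e i; have := pw A1E i; rewrite !ffunE; case: (m < i)%N => //;
      move: (A i) (B1 i) (A1 i) (D i) (ck l i) (ck kk i) (A'' i) => *; lia.
  apply/asboolP/andP => [[/consE c _ h1 h2]|[/consE c /asboolP[h1 h2]]]; first by split=> //; apply/asboolP.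
  by split.
case: (boolP cons) => _; last by rewrite /= !mulr0.
case: asboolP => [[aB' aD]|_] /=; last by rewrite !mulr0.
have qB := al_qp Bal; have qB' := al_qp aB'.
have tE : (ctot B' + (kk != ord0) = ctot B + (k != ord0))%N.
  by have := congr1 (@ctot n) BE; rewrite !ctotD !ctot_ck.
(* The queue weights of the two sides carry (sg)_|B| and (sg)_|B'| in the denominator. The weight
   [ellr] absorbs the ratio and keeps a meaning when (sg)_|B'| is zero. *)
suff E : ell q (l1 / l2) l1 B k kk / qp q (l1 / l2) (ctot B')
    = ellr q (l1 / l2) l1 B k kk / qp q (l1 / l2) (ctot B).
  transitivity (p0 * p1 / p2 * (ell q (l1 / l2) l1 B k kk / qp q (l1 / l2) (ctot B'))
     * qw q (m1 / m2) m1 m A kk l * Rr q m (l1 / m2) (m2 / l2) (m1 / l1) (l1 / l2) A' B' D).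
    ring.
  by rewrite E /Kc; ring.
rewrite /ellr; case: (unliftP ord0 kk) tE => [j|] -> /=; rewrite ?addn0 ?addn1 => tE.
  move: tE; case: (eqVneq k ord0) => /= [_|_]; rewrite ?addn0 ?addn1; last by case=> ->; rewrite mul1r.
  move=> tE; move: qB; rewrite -tE /= qpS mulf_eq0 negb_or => /andP[_ nz].
  rewrite -/sg; field; rewrite nz qB' //.
move: tE; case: (eqVneq k ord0) => /= [->|k0]; rewrite ?addn0 ?addn1 => tE; first by rewrite tE.
move: qB'; rewrite tE qpS mulf_eq0 negb_or => /andP[h1 h2].
rewrite /ell unlift_none lt0n k0 mul1r -/sg; field.
by rewrite h1 h2.
Qed.

(** [ybe_R] sums over all inner colors, so each term excluded by the truncation must be shown to be
    zero on its own; D, D' and B' are excluded for three different reasons. *)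
Lemma local_ybe : \sum_kk tL kk = \sum_kk tR kk.
Proof.
under eq_bigr do rewrite tLE.
under [in RHS]eq_bigr do rewrite tRE.
case: (boolP cons) => _ /=; last by rewrite !big1.
(* If D is forbidden but D' is allowed, the inner arrow is absorbed at the top level |D'| = L and
   nothing exits; the L-weight is then 1 - sg q^L = 0. *)
have [Dal|Dal] := pselect (al (ctot D)); last first.
  rewrite [RHS]big1; last by move=> kk _; case: ifP => // _; rewrite asboolF // => -[].
  rewrite big1 // => kk _; case: ifP => // h; set D' := csub (cadd D (ck l)) (ck kk).
  case: asboolP => // aD'.
  have DE : cadd D' (ck kk) = cadd D (ck l) by rewrite /D' csubK.
  have := congr1 (@ctot n) DE; rewrite !ctotD !ctot_ck => tE.
  have DD : (ctot D <= (ctot D').+1)%N.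
    by move: tE; case: (kk != ord0); case: (l != ord0) => /=; lia.
  have tD : ctot D = (ctot D').+1.
    apply/eqP; rewrite eqn_leq DD ltnNge; apply/negP => h'; apply: Dal.
    exact: al_le h' aD'.
  have [k0 l0] : (0 < kk)%N /\ l = ord0.
    move: tE; rewrite tD lt0n; case: (eqVneq kk ord0) => [->|k0]; case: (eqVneq l ord0) => [->|] //=; lia.
  rewrite [ell _ _ _ _ _ _](_ : _ = 0) ?mulr0 // /ell l0 unlift_none k0.
  by rewrite al_step ?subrr // -tD.
have ybe := ybe_R q1 q0 l1n l2n m1n m2n A Bm Dm km lm.
transitivity (Kc * \sum_(kk < n.+1) (if cle (ck kk) (cadd D (ck l)) then
      let D' := csub (cadd D (ck l)) (ck kk) in
      Rr q m (l1 / m2) (m2 / l2) (m1 / l1) (l1 / l2) A B D'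
      * qw q (m1 / m2) m1 m (csub (offm m (cadd A B)) (offm m D')) k kk
      * ell q (l1 / l2) l1 D' kk l else 0)).
  rewrite mulr_sumr; apply: eq_bigr => kk _; case: ifP => h; last by rewrite mulr0.
  set D' := csub (cadd D (ck l)) (ck kk) => /=; case: asboolP => // nD'.
  have DE : cadd D' (ck kk) = cadd D (ck l) by rewrite /D' csubK.
  have := congr1 (@ctot n) DE; rewrite !ctotD !ctot_ck => tE.
  have tD : ctot D' = (ctot D).+1.
    have : (ctot D' <= (ctot D).+1)%N.
      by move: tE; case: (kk != ord0); case: (l != ord0) => /=; lia.
    rewrite leq_eqVlt => /orP[/eqP//|]; rewrite ltnS => h'; case: nD'; exact: al_le h' Dal.
  (* A forbidden D' is one arrow above the truncation, so [phi2] contains a vanishing (sg)_|D'| and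
     the omitted term may be restored. *)
  have z0 : qp q (l1 / l2) (ctot D') = 0.
    by rewrite tD qpS al_step ?subrr ?mulr0 // -tD.
  rewrite /Rr big1 ?mul0r ?mulr0 // => P _; rewrite /phi2 z0.
  by case: ifP; rewrite ?(mulr0, mul0r).
rewrite [X in _ * X]ybe mulr_sumr; apply: eq_bigr => kk _; case: ifP => h; last by rewrite mulr0.
set B' := csub (cadd B (ck k)) (ck kk) => /=; case: asboolP => // nB'.
have {}nB' : ~ al (ctot B') by move=> h'; apply: nB'.
have [L [LB sL hL]] := al_not nB'.
(* A forbidden B' has more than L arrows while D has at most L, and the product (l1/m2)(m2/l2) is
   sg. *)
rewrite (@Rr_vanish _ q n q1 q0 m _ _ _ _ _ _ _ Dm L) ?mulr0 //; last exact: hL.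
by rewrite -sL /sg; field; rewrite l2n m2n.
Qed.
End Fixed.
End LocalYBE.

(** * Queue weights and L-weights *)

Section Link.
Variables (R : realType) (q : R).
Hypothesis q01 : 0 < q < 1.
Variable n : nat.
Implicit Types (A B C D P X Y : conf n) (i j r : 'I_n) (k l : 'I_n.+1).
Local Notation ck := (@color_conf n).
Local Notation Q := (q%:C%C : R[i]).

Lemma Q0 : Q != 0.
Proof. by case/andP: q01 => q0 _; rewrite fmorph_eq0 (gt_eqF q0). Qed.

Lemma Q1 (i : nat) : 1 - Q ^+ i.+1 != 0.
Proof.
case/andP: q01 => q0 q1; rewrite -rmorphXn -(rmorph1 (real_complex R)) -rmorphB fmorph_eq0.
by rewrite subr_eq0 gt_eqF // exprn_ilt1 // ltW.
Qed.

Lemma qpochE (a : R[i]) (k : nat) : qpoch q a k = qp Q a k.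
Proof. by []. Qed.

Lemma fsbig_subs (B : conf n) (c : pred (conf n)) (F : conf n -> R[i]) (S : set (conf n)) :
  (forall P, S P <-> cle P B /\ c P) ->
  \sum_(P \in S) F P = \sum_(P <- subs B | c P) F P.
Proof.
move=> h; rewrite -[RHS]big_filter.
have u := filter_uniq c (subs_uniq B).
have SE P : (P \in S) = (P \in [seq P <- subs B | c P]).
  by rewrite mem_filter mem_subs; apply/idP/andP; rewrite inE h => -[-> ->].
rewrite (@fsbigE _ _ _ _ S [seq P <- subs B | c P]) //.
- by rewrite big_seq_cond [RHS]big_seq; apply: eq_bigl => P; rewrite SE andbb.
- by move=> P /= Pi; rewrite -in_setE SE.
- by move=> P /= Pi; rewrite -SE; move: Pi; rewrite -in_setE => ->.
Qed.

Lemma prod_qpoch A B :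
  \prod_(i < n) (qpoch q Q (B i) / (qpoch q Q (A i) * qpoch q Q (B i - A i)))
    = gB Q B / (gB Q A * gB Q (csub B A)).
Proof.
rewrite prodf_div big_split /=; congr (_ / (_ * _)).
by apply: eq_bigr => i _; rewrite ffunE.
Qed.

Lemma PhiE A B (x y : R[i]) : Phi q A B x y = PhiK Q A B x y.
Proof. by rewrite /Phi prod_qpoch /PhiK /hc !qpochE; ring. Qed.

Lemma LweightE (s x : R[i]) A C k l :
  s != 0 -> x != 0 -> (forall d : nat, qpoch q (s * x) d != 0) ->
  Lweight q s x A k C l =
  if cadd A (ck k) == cadd C (ck l)
  then ell Q (s ^+ 2) (s * x) A k l / (1 - s * x) else 0.
Proof.
move=> s0 x0 sx; rewrite /Lweight /fusedW; case: eqP => // E.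
rewrite -(fusedKE Q1 Q0 s0 x0 sx E) /fusedK; congr (_ * _).
have -> : Q / s ^- 2 * (x / s) = Q * (s * x) by rewrite invrK; field.
have -> : x / s / s ^- 2 = s * x by rewrite invrK; field.
rewrite (fsbig_subs (B := ck k) (c := fun P : conf n => cle P C)); last first.
  move=> P /=; split=> [h|[/forallP h1 /forallP h2] i]; last by rewrite leq_min h1 h2.
  by split; apply/forallP => i; have := h i; rewrite leq_min => /andP[].
rewrite big_mkcond sum_subs_color cle0 !csub0 !PhiE; congr (_ + _).
by case: eqP => //= _; case: ifP.
Qed.

Definition vl (m : 'I_n) A : vconf n :=
  [ffun i : 'I_n => if i == m then None else Some (offm m A i)].

Lemma fin_vl m A i : fin_part (vl m A i) = offm m A i.
Proof. by rewrite /vl ffunE; case: (eqVneq i m) => // ->; rewrite ffunE ltnn. Qed.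

Section QueueW.
Variables (m : 'I_n) (s1 s2 u : R[i]).
Hypothesis wd : queueW_well_defined q s1 s2 u.
Let a := s1 * s2 / u.
Let b := s1 * u / s2.
Let z := u * s2 / s1.
Let sg := s1 ^+ 2.
Definition qpre : R[i] := qpoch_inf q (s1^-1 * s2 * u) / qpoch_inf q (s1 * s2 * u).

(** With X = A + B - P, conservation turns C - P into X - D above m, so the range P <= C becomes D
    <= X. The isolated factor (q)_(D_m) completes the product over i > m to the full [gB D]. *)
Lemma queueWE A B C D :
  (forall i : 'I_n, (i < m)%N -> B i = 0%N) ->
  queueW q m s1 s2 u (vl m A) B (vl m C) D =
  if `[< [/\ offm m (cadd A B) = offm m (cadd C D),
             forall i : 'I_n, (i < m)%N -> D i = 0%N,
             queue_allowed q s1 (ctot B) & queue_allowed q s1 (ctot D)] >]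
  then qpre * (Rr Q m a b z sg A B D / qp Q sg (ctot B)) else 0.
Proof.
move=> Bm; rewrite /queueW.
have -> : `[< [/\ forall i, i != m -> (fin_part (vl m A i) + B i)%N = (fin_part (vl m C i) + D i)%N,
     forall i : 'I_n, (i < m)%N -> D i = 0%N,
     queue_allowed q s1 (ctot B) & queue_allowed q s1 (ctot D)] >] =
   `[< [/\ offm m (cadd A B) = offm m (cadd C D),
             forall i : 'I_n, (i < m)%N -> D i = 0%N,
             queue_allowed q s1 (ctot B) & queue_allowed q s1 (ctot D)] >].
  apply: asbool_equiv_eq; split=> -[h1 h2 h3 h4]; split=> //.
    apply: confP => i; rewrite !ffunE; case: ltnP => // mi.
    have := h1 i; rewrite !fin_vl !ffunE mi; apply.
    by apply/eqP => im; move: mi; rewrite im ltnn.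
  move=> i im; rewrite !fin_vl !ffunE.
  have := congr1 (fun x : conf n => x i) h1; rewrite !ffunE; case: ltnP => // mi _.
  have {}mi : (i < m)%N by rewrite ltn_neqAle mi andbT.
  by rewrite Bm // h2.
case: ifP => // /asboolP[h1 h2 h3 h4]; congr (_ * _).
rewrite (fsbig_subs (B := B) (c := fun P : conf n => cle (offm m P) C)); last first.
  move=> P; split=> [h|[/forallP PB /forallP PC] i].
    split; apply/forallP => i; have := h i; rewrite [vl _ _ _]ffunE; case: eqP => [->|im] //=.
    - by rewrite leq_min => /andP[].
    - by rewrite ffunE ltnn.
    rewrite leq_min => /andP[_]; rewrite !ffunE; by case: (m < i)%N.
  have := PC i; have := PB i; rewrite [vl _ _ _]ffunE [offm m P i]ffunE; case: eqP => [->|im] //=.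
  rewrite leq_min ffunE => -> /=; case: ltnP => // mi.
  have {}mi : (i < m)%N by rewrite ltn_neqAle mi andbT; apply/eqP => /val_inj.
  by have := PB i; rewrite Bm.
rewrite /Rr mulr_suml big_mkcond; apply: eq_big_seq => P; rewrite mem_subs => PB.
have hP i : (P i <= B i)%N by move/forallP: PB => /(_ i).
have hAB i : (m < i)%N -> (A i + B i = C i + D i)%N.
  by move=> mi; have := congr1 (fun x : conf n => x i) h1; rewrite !ffunE mi.
rewrite /phi2; set X := offm m (cadd A _).
have -> : cle (offm m P) C = cle (offm m D) X.
  apply/forallP/forallP => h i; have := h i; have := hP i; have := hAB i; rewrite !ffunE;
    case: (m < i)%N => // /(_ isT); move: (A i) (B i) (C i) (D i) (P i) => *; lia.
case: ifP => [/forallP hD|_]; last by rewrite mulr0 mul0r.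
set Y := csub X _.
have hX i : (m < i)%N -> X i = (C i - P i + D i)%N /\ Y i = (C i - P i)%N.
  move=> mi; have := hD i; have := hP i; have := hAB i mi; rewrite !ffunE mi; move: (A i) (B i) (C i) (D i) (P i) => *; lia.
have h0 i : (i <= m)%N -> X i = 0%N /\ Y i = 0%N.
  by move=> mi; rewrite !ffunE ltnNge mi.
have -> : (ctot B - ctot P)%N = ctot (csub B P) by rewrite -[in ctot B](csubK PB) ctotD addnK.
rewrite prod_qpoch.
have -> : (\sum_(i < n | (m <= i)%N) \sum_(j < n | (i < j)%N) D i * (fin_part (vl m C j) - P j) = ccross D Y)%N.
  rewrite /ccross [RHS](bigID (fun i : 'I_n => (m <= i)%N)) /= [X in (_ + X)%N]big1 ?addn0.
    apply: eq_bigr => i mi; apply: eq_bigr => j ij; congr (_ * _)%N.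
    have mj := leq_ltn_trans mi ij.
    by rewrite fin_vl ffunE mj (hX j mj).2.
  by move=> i; rewrite -ltnNge => im; rewrite big1 // => j _; rewrite h2.
have -> : \prod_(i < n | (m < i)%N)
        (qpoch q Q (fin_part (vl m C i) - P i + D i) /
         (qpoch q Q (fin_part (vl m C i) - P i) * qpoch q Q (D i)))
   = gB Q X / (gB Q Y * gB Q D) * qp Q Q (D m).
  rewrite /gB -big_split -prodf_div /= [X in _ = X * _](bigD1 m) //= (h0 m (leqnn _)).1 (h0 m (leqnn _)).2 qp0.
  rewrite !mul1r [X in _ = X]mulrAC mulVf ?mul1r ?(qpq_neq0 Q1) //.
  rewrite big_mkcond [RHS]big_mkcond; apply: eq_bigr => i _.
  case: (ltngtP m i) => mi.
  - rewrite ifT; last by apply/eqP => e; rewrite e ltnn in mi.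
    by rewrite fin_vl ffunE mi (hX i mi).1 (hX i mi).2.
  - case: ifP => // _; rewrite (h0 i (ltnW mi)).1 (h0 i (ltnW mi)).2 h2 // qp0.
    by rewrite !mulr1 divr1.
  - by rewrite ifF //; apply/negbTE/negPn/eqP/val_inj.
rewrite /phi1 /hc !qpochE; field.
case: wd => _ _ _ _ /(_ _ h3); rewrite qpochE => ->.
by rewrite !(gB_neq0 Q1) (qpq_neq0 Q1).
Qed.
End QueueW.

Lemma allowed_le (s : R[i]) (d e : nat) : (d <= e)%N ->
  queue_allowed q s e -> queue_allowed q s d.
Proof. by move=> de h L L0 /(h L L0); exact: leq_trans. Qed.

Lemma allowed_color (s : R[i]) k : queue_allowed q s (ctot (ck k)).
Proof.
move=> L L0 _; apply: leq_trans L0; case: (unliftP ord0 k) => [j|] ->.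
  by rewrite color_confS ctot_cone.
by rewrite color_conf0 ctot0.
Qed.

Lemma sqr_sqrtq : ((Num.sqrt q)%:C%C : R[i]) ^+ 2 = Q.
Proof. by rewrite -rmorphXn /= sqr_sqrtr //; case/andP: q01 => /ltW. Qed.

Lemma not_allowed (s : R[i]) (d : nat) : ~ queue_allowed q s d ->
  exists L, [/\ (0 < L < d)%N, s ^+ 2 * Q ^+ L = 1
              & forall e, queue_allowed q s e -> (e <= L)%N].
Proof.
move/existsNP => [L /not_implyP[L0 /not_implyP[sE /negP]]]; rewrite -ltnNge => Ld.
exists L; split; rewrite ?L0 //; last by move=> e; exact.
have rq0 : ((Num.sqrt q)%:C%C : R[i]) != 0.
  by rewrite -(sqrf_eq0) sqr_sqrtq Q0.
rewrite sE fmorphV rmorphXn /= -sqr_sqrtq -exprM mulnC exprM -exprMn mulVf ?expr1n //.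
by rewrite expf_neq0.
Qed.

Section LocalYBE.
Variables (m : 'I_n) (s1 s2 u v x : R[i]).
Local Notation rq := ((Num.sqrt q)%:C%C : R[i]).
Hypothesis u0 : u != 0.
Hypothesis v0 : v != 0.
Hypothesis wd0 : queueW_well_defined q rq^-1 s2 (x * rq / v).
Hypothesis wd : queueW_well_defined q s1 s2 (u / v).
Hypothesis wdL : Lweight_well_defined q s1 (x * u^-1).
(** Chosen so that l1/m2 = s1 s2 v/u, m2/l2 = s1 u/(s2 v), m1/l1 = u s2/(v s1) and l1/l2 = s1^2 are
    the four arguments of the queue weight of row j; x cancels in all of them. *)
Let l1 := s1 * (x / u).
Let l2 := x / u / s1.
Let m1 := x / v * s2.
Let m2 := x / v / s2.

Let s10 : s1 != 0. Proof. by case: wd. Qed.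
Let s20 : s2 != 0. Proof. by case: wd. Qed.
Let rq0 : rq != 0. Proof. by rewrite -sqrf_eq0 sqr_sqrtq Q0. Qed.
Let x0 : x != 0.
Proof. by case: wd0 => _ _; rewrite !mulf_eq0 !negb_or => /andP[/andP[]]. Qed.

Let pre0 := qpre rq^-1 s2 (x * rq / v).
Lemma row0E A C k l : offm m A = A -> (k != ord0 -> (m < k)%N) -> (l != ord0 -> (m < l)%N) ->
  queueW q m rq^-1 s2 (x * rq / v) (vl m A) (ck k) (vl m C) (ck l) =
  if offm m (cadd A (ck k)) == offm m (cadd C (ck l))
  then pre0 * qw Q (m1 / m2) m1 m A k l else 0.
Proof.
move=> Ac km lm.
have below kk : (kk != ord0 -> (m < kk)%N) -> forall i : 'I_n, (i < m)%N -> ck kk i = 0%N.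
  case: (unliftP ord0 kk) => [j|] -> h i im; last by rewrite color_conf0 ffunE.
  rewrite color_confS ffunE; case: eqP => // ij; move: (h isT) im.
  by rewrite ij lift0 ltnS leqNgt => /negbTE ->.
rewrite queueWE //; last exact: below.
rewrite (_ : `[< _ >] = (offm m (cadd A (ck k)) == offm m (cadd C (ck l)))); last first.
  apply/asboolP/eqP => [[]//|h]; split=> //; try exact: allowed_color.
  exact: below.
case: ifP => // _; congr (_ * _).
have e1 : rq^-1 ^+ 2 = Q^-1 by rewrite exprVn sqr_sqrtq.
rewrite e1 (@Rr_half _ Q n Q1 Q0 m _ _ _ A k l _ _ Ac km lm); first 1 last.
- by rewrite -sqr_sqrtq; field; rewrite rq0 v0 x0 s20.
- by rewrite !(mulf_neq0, invr_neq0).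
congr (qw _ _ _ _ _ _ _); rewrite /m1 /m2 -?sqr_sqrtq; field; by rewrite ?rq0 ?v0 ?x0 ?s20 ?oner_neq0.
Qed.

Let W A B C D := queueW q m s1 s2 (u / v) (vl m A) B (vl m C) D.
Let w A k C l := queueW q m rq^-1 s2 (x * rq / v) (vl m A) (ck k) (vl m C) (ck l).
Let Lw B k D l := Lweight q s1 (x * u^-1) B k D l.

Let sgE : l1 / l2 = s1 ^+ 2.
Proof. by rewrite /l1 /l2; field; rewrite s10 u0 x0. Qed.

Let WE A B C D : (forall i : 'I_n, (i < m)%N -> B i = 0%N) ->
  W A B C D = if `[< [/\ offm m (cadd A B) = offm m (cadd C D),
             forall i : 'I_n, (i < m)%N -> D i = 0%N,
             queue_allowed q s1 (ctot B) & queue_allowed q s1 (ctot D)] >]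
  then qpre s1 s2 (u / v) * (Rr Q m (l1 / m2) (m2 / l2) (m1 / l1) (l1 / l2) A B D / qp Q (l1 / l2) (ctot B)) else 0.
Proof.
move=> Bm; rewrite /W (queueWE wd _ _ _ Bm); case: ifP => // _.
have key (p a b z sg a' b' z' sg' : R[i]) : a = a' -> b = b' -> z = z' -> sg = sg' ->
    p * (Rr Q m a b z sg A B D / qp Q sg (ctot B))
    = p * (Rr Q m a' b' z' sg' A B D / qp Q sg' (ctot B)).
  by move=> -> -> -> ->.
apply: key; rewrite /l1 /l2 /m1 /m2; field.
all: by rewrite ?u0 ?v0 ?x0 ?s20 ?s10 ?oner_neq0.
Qed.

Let LE B D k l : Lw B k D l = if cadd B (ck k) == cadd D (ck l)
  then ell Q (l1 / l2) l1 B k l / (1 - l1) else 0.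
Proof. by rewrite sgE; case: wdL => h1 h2 h3; exact: LweightE. Qed.

Lemma queue_ybe A A'' B D k l : offm m A = A -> below m B -> below m D ->
  above m k -> above m l -> queue_allowed q s1 (ctot B) ->
  \sum_kk tL m W w Lw A A'' B D k l kk = \sum_kk tR m W w Lw A A'' B D k l kk.
Proof.
move=> Ac Bm Dm km lm Bal.
have n1 : l1 != 0 by rewrite /l1 !mulf_neq0 ?invr_neq0.
have n2 : l2 != 0 by rewrite /l2 !mulf_neq0 ?invr_neq0.
have n3 : m1 != 0 by rewrite /m1 !mulf_neq0 ?invr_neq0.
have n4 : m2 != 0 by rewrite /m2 !mulf_neq0 ?invr_neq0.
apply: (@local_ybe _ Q n Q1 Q0 l1 l2 m1 m2 n1 n2 n3 n4 m (queue_allowed q s1)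
  _ _ _ W w Lw pre0 (qpre s1 s2 (u / v)) (1 - l1)) => //.
- by move=> d e; exact: allowed_le.
- by rewrite sgE => d /not_allowed[L [/andP[_ h1] h2 h3]]; exists L.
- by move=> d ad; rewrite sgE; case: wd => _ _ _ _; exact.
- by move=> *; exact: row0E.
Qed.

End LocalYBE. End Link.

(** * Unordered sums *)

#[local] Existing Instance summability.totally_filter.

Section HasSum.
Local Open Scope classical_set_scope.
Variable R : realType.
Local Notation K := (R[i]).

(** The bound [e] is complex, but 0 < e forces it to be real. *)
Definition has_sum (I : choiceType) (f : I -> K) (l : K) :=
  forall e : K, 0 < e -> exists F0 : {fset I}, forall F : {fset I},
    (F0 `<=` F)%fset -> `|\sum_(i <- F) f i - l| < e.

Definition csum (I : choiceType) (f : I -> K) : K :=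
  @summability.sum I K K^o f.

Lemma has_sumE (I : choiceType) (f : I -> K) l : has_sum f l -> csum f = l.
Proof.
move=> fl; rewrite /csum /summability.sum.
apply: (@cvg_lim K^o); first exact: norm_hausdorff.
apply/(@cvgrPdist_lt K K^o) => e e0; have [F0 hF0] := fl e e0.
exists F0 => // F /= F0F; rewrite distrC.
have -> : summability.partial_sum f F = \sum_(i <- F) f i by rewrite [RHS]big_seq_fsetE.
exact: hF0.
Qed.

Lemma has_sum0 (I : choiceType) : has_sum (fun _ : I => 0) 0.
Proof. by move=> e e0; exists fset0 => F _; rewrite big1 // subrr normr0. Qed.

Lemma has_sumD (I : choiceType) (f g : I -> K) k l :
  has_sum f k -> has_sum g l -> has_sum (fun i => f i + g i) (k + l).
Proof.
move=> fk gl e e0; have e20 : 0 < e / 2%:R by rewrite divr_gt0.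
have [F hF] := fk _ e20; have [G hG] := gl _ e20.
exists (F `|` G)%fset => H; rewrite fsubUset => /andP[FH GH].
rewrite big_split /= opprD addrACA; apply: le_lt_trans (ler_normD _ _) _.
by rewrite [e]splitr ltrD ?hF ?hG.
Qed.

Lemma has_sumZ (I : choiceType) (f : I -> K) l (c : K) :
  has_sum f l -> has_sum (fun i => f i * c) (l * c).
Proof.
move=> fl e e0; have c1 : 0 < `|c| + 1 by rewrite ltr_wpDl.
have [F hF] := fl (e / (`|c| + 1)) (divr_gt0 e0 c1); exists F => H /hF h.
rewrite -mulr_suml -mulrBl normrM.
apply: (@le_lt_trans _ _ (`|\sum_(i <- H) f i - l| * (`|c| + 1))).
  by rewrite ler_wpM2l // lerDl.
by rewrite -ltr_pdivlMr.
Qed.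

Lemma has_sum_sum (I : choiceType) (J : Type) (s : seq J) (f : J -> I -> K) (l : J -> K) :
  (forall j, has_sum (f j) (l j)) ->
  has_sum (fun i => \sum_(j <- s) f j i) (\sum_(j <- s) l j).
Proof.
move=> h; elim: s => [|j s IHs].
  by rewrite big_nil (_ : (fun _ => _) = fun=> 0); [exact: has_sum0|apply/funext => i; rewrite big_nil].
rewrite big_cons (_ : (fun _ => _) = fun i => f j i + \sum_(k <- s) f k i); first exact: has_sumD.
by apply/funext => i; rewrite big_cons.
Qed.

Lemma sum_fset_sub (I : choiceType) (F G : {fset I}) (f : I -> K) : (F `<=` G)%fset ->
  (forall i, i \in G -> i \notin F -> f i = 0) ->
  \sum_(i <- G) f i = \sum_(i <- F) f i.
Proof. by move=> FG h; rewrite (big_fset_incl _ FG) // => i iG iF; exact: h. Qed.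

Lemma has_sum_point (I : choiceType) (f : I -> K) i0 :
  (forall i, i != i0 -> f i = 0) -> has_sum f (f i0).
Proof.
move=> h e e0; exists [fset i0]%fset => F hF.
rewrite (sum_fset_sub hF); first by rewrite big_seq_fset1 subrr normr0.
by move=> i _; rewrite inE => /h.
Qed.

Lemma sum_push (I J : choiceType) (f : I -> K) (e : I -> J) (d : J -> I) (G : {fset J}) :
  \sum_(i <- [fset d j | j in G & e (d j) == j]%fset) f i
  = \sum_(j <- G) if e (d j) == j then f (d j) else 0.
Proof.
rewrite -big_mkcond /= -[RHS]big_filter.
have dinj : {in [seq j <- G | e (d j) == j] &, injective d}.
  by move=> i j; rewrite !mem_filter => /andP[/eqP h _] /andP[/eqP h' _] E; rewrite -h -h' E.
rewrite -(big_map d xpredT f); apply: perm_big; apply: uniq_perm.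
- exact: fset_uniq.
- by rewrite map_inj_in_uniq // filter_uniq // fset_uniq.
move=> i; apply/imfsetP/mapP => [[j /=]|[j]].
  by rewrite !inE => /andP[jG h] ->; exists j => //; rewrite mem_filter h.
by rewrite mem_filter => /andP[h jG] ->; exists j => //=; rewrite !inE jG.
Qed.

(* Transport of a sum along a partial bijection [e : I -> J], [d : J -> I]. *)
Lemma has_sum_push (I J : choiceType) (f : I -> K) l (e : I -> J) (d : J -> I) :
  has_sum f l -> (forall i, f i != 0 -> d (e i) = i) ->
  has_sum (fun j => if e (d j) == j then f (d j) else 0) l.
Proof.
move=> fl de eps eps0; have [F0 hF0] := fl _ eps0.
exists [fset e i | i in F0]%fset => G hG.
pose D := [fset d j | j in G & e (d j) == j]%fset.
have := hF0 (F0 `|` D)%fset (fsubsetUl _ _); congr (`| _ - _ | < _).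
rewrite (@sum_fset_sub _ D); first 1 last.
- exact: fsubsetUr.
- move=> i; rewrite inE => /orP[iF|->//] iD; apply: contraNeq iD => /de dei.
  apply/imfsetP; exists (e i) => //=; rewrite !inE /= dei eqxx andbT.
  by apply: (fsubsetP hG); apply/imfsetP; exists i.
by rewrite sum_push.
Qed.

Lemma fset_sum_le (I : choiceType) (F G : {fset I}) (f : I -> K) : (forall i, 0 <= f i) ->
  (F `<=` G)%fset -> \sum_(i <- F) f i <= \sum_(i <- G) f i.
Proof.
move=> f0 FG.
have -> : \sum_(i <- F) f i = \sum_(i <- G) (if i \in F then f i else 0).
  rewrite (sum_fset_sub FG); first by apply: eq_big_seq => i ->.
  by move=> i _ /negbTE ->.
by apply: ler_sum => i _; case: ifP.
Qed.

Lemma has_sum_nneg (I : choiceType) (f : I -> R) (B : R) : (forall i, 0 <= f i) ->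
  (forall F : {fset I}, \sum_(i <- F) f i <= B) ->
  exists l, has_sum (fun i => (f i)%:C%C) l.
Proof.
move=> f0 fB; pose S := [set \sum_(i <- F) f i | F in [set: {fset I}]].
have hS : has_sup S.
  split; first by exists (\sum_(i <- fset0) f i); exists fset0.
  by exists B => _ [F _ <-].
exists (sup S)%:C%C => e e0.
have [r r0 er] : exists2 r : R, 0 < r & e = r%:C%C.
  by case: e e0 => a b; rewrite ltcE /= => /andP[/eqP -> ?]; exists a.
have [_ [F0 _ <-] hF0] := sup_adherent r0 hS.
exists F0 => F F0F; rewrite er -rmorph_sum -rmorphB normc_def /= expr0n addr0 sqrtr_sqr ltcR.
have h1 : \sum_(i <- F0) f i <= \sum_(i <- F) f i.
  rewrite -lecR !rmorph_sum; apply: fset_sum_le F0F => i. by rewrite (lecR 0).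
have h2 : \sum_(i <- F) f i <= sup S by apply: ub_le_sup; [exact: hS.2|exists F].
rewrite ltr_norml; lra.
Qed.

Definition abs_bounded (I : choiceType) (f : I -> K) (B : K) :=
  forall F : {fset I}, \sum_(i <- F) `|f i| <= B.

(** Real and imaginary parts g satisfy |g| <= n for the family n of norms, and g = (g + n) - n is a
    difference of nonnegative families with bounded partial sums. *)
Lemma abs_has_sum (I : choiceType) (f : I -> K) B : abs_bounded f B -> has_sum f (csum f).
Proof.
move=> fB; suff [l hl] : exists l, has_sum f l by rewrite (has_sumE hl).
pose n i := complex.Re `|f i|.
have nE i : (n i)%:C%C = `|f i|.
  by rewrite /n normc_def.
have Bn (F : {fset I}) : \sum_(i <- F) n i <= complex.Re B.
  have := fB F; under eq_bigr do rewrite -nE.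
  by rewrite -rmorph_sum; case: B {fB} => a b; rewrite lecE /= => /andP[_].
have n0 i : 0 <= n i by rewrite -lecR nE normr_ge0.
have part (g : I -> R) : (forall i, `|g i| <= n i) -> exists l, has_sum (fun i => (g i)%:C%C) l.
  move=> gn.
  have [l1 h1] := has_sum_nneg n0 Bn.
  have h0 i : 0 <= g i + n i by have := gn i; rewrite ler_norml; lra.
  have [l2 h2] : exists l, has_sum (fun i => (g i + n i)%:C%C) l.
    apply: (@has_sum_nneg _ _ (complex.Re B *+ 2)) => // F.
    apply: le_trans (_ : \sum_(i <- F) (n i *+ 2) <= _).
      by apply: ler_sum => i _; have := gn i; rewrite ler_norml mulr2n; lra.
    by rewrite sumrMnl lerMn2r Bn.
  exists (l2 + l1 * -1).
  rewrite (_ : (fun _ => _) = fun i => (g i + n i)%:C%C + (n i)%:C%C * -1).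
    exact: has_sumD h2 (has_sumZ _ h1).
  by apply/funext => i; rewrite rmorphD; ring.
have ReN (z : K) : (`|complex.Re z| <= complex.Re `|z|) /\ (`|complex.Im z| <= complex.Re `|z|).
  case: z => a b; rewrite normc_def /= -!sqrtr_sqr; split; apply: ler_wsqrtr;
    by rewrite ?lerDl ?lerDr sqr_ge0.
have [l1 h1] := part (fun i => complex.Re (f i)) (fun i => (ReN (f i)).1).
have [l2 h2] := part (fun i => complex.Im (f i)) (fun i => (ReN (f i)).2).
exists (l1 + l2 * 'i%C).
rewrite (_ : f = fun i => (complex.Re (f i))%:C%C + (complex.Im (f i))%:C%C * 'i%C).
  exact: has_sumD h1 (has_sumZ _ h2).
by apply/funext => i; rewrite [LHS]complexE mulrC; congr (_ + _); rewrite mulrC.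
Qed.

Lemma abs_bounded_push (I J : choiceType) (f : I -> K) B (e : I -> J) (d : J -> I) :
  abs_bounded f B -> abs_bounded (fun j => if e (d j) == j then f (d j) else 0) B.
Proof.
move=> fB G; apply: le_trans (fB [fset d j | j in G & e (d j) == j]%fset).
rewrite sum_push le_eqVlt; apply/orP; left; apply/eqP/eq_bigr => j _.
by case: ifP; rewrite ?normr0.
Qed.

Lemma abs_bounded_sum (I : choiceType) (J : Type) (s : seq J) (f : J -> I -> K) (B : J -> K) :
  (forall j, abs_bounded (f j) (B j)) ->
  abs_bounded (fun i => \sum_(j <- s) f j i) (\sum_(j <- s) B j).
Proof.
move=> h F; apply: le_trans (_ : \sum_(i <- F) \sum_(j <- s) `|f j i| <= _).
  by apply: ler_sum => i _; exact: ler_norm_sum.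
by rewrite exchange_big; apply: ler_sum => j _; exact: h.
Qed.

(** A finite set of tuples lies in a box, over which the sum is the n-th power of a finite geometric
    sum. *)
Lemma geometric_bound n (Q : K) (F : {fset conf n}) : 0 < Q -> Q < 1 ->
  \sum_(h <- F) Q ^+ ctot h <= (1 - Q)^-1 ^+ n.
Proof.
move=> Q0 Q1; pose T := (\sum_(h <- F) ctot h)%N.
pose em (s : {ffun 'I_n -> 'I_T.+1}) : conf n := [ffun i => s i : nat].
have em_inj : injective em.
  by move=> s t /ffunP E; apply/ffunP => i; apply/val_inj; have := E i; rewrite !ffunE.
pose G := [fset em s | s in [set: {ffun 'I_n -> 'I_T.+1}]%SET]%fset.
have FG : (F `<=` G)%fset.
  apply/fsubsetP => h hF; apply/imfsetP; exists [ffun i => inord (h i)]; first by rewrite /= finset.in_setT.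
  apply/ffunP => i; rewrite !ffunE inordK // ltnS /T (big_fsetD1 h) //=.
  by rewrite (leq_trans _ (leq_addr _ _)) // /ctot (bigD1 i) //= leq_addr.
apply: le_trans (fset_sum_le (f := fun h => Q ^+ ctot h) _ FG) _.
  by move=> h; rewrite exprn_ge0 // ltW.
have -> : \sum_(h <- G) Q ^+ ctot h = \sum_(s : {ffun 'I_n -> 'I_T.+1}) \prod_i Q ^+ s i.
  rewrite /G big_imfset /=; last by move=> s t _ _; exact: em_inj.
  rewrite big_enum; apply: eq_big => [s|s _]; first by rewrite finset.in_setT.
  by rewrite prodrXr /ctot; under eq_bigr do rewrite ffunE.
rewrite -(bigA_distr_bigA (fun (_ : 'I_n) (t : 'I_T.+1) => Q ^+ t)) prodr_const card_ord.
have Q1' : 0 < 1 - Q by rewrite subr_gt0.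
apply: lerXn2r; rewrite ?nnegrE ?invr_ge0 ?(ltW Q1') //.
  by apply: sumr_ge0 => t _; rewrite exprn_ge0 // ltW.
rewrite -[leRHS]mul1r ler_pdivlMr // mulrC.
have -> : (1 - Q) * (\sum_(t < T.+1) Q ^+ t) = 1 - Q ^+ T.+1.
  by rewrite -[X in X - Q](expr1n _ 1) -opprB -[RHS]opprB subrX1 mulNr expr1n.
by rewrite lerBlDr lerDl exprn_ge0 // ltW.
Qed.

Lemma abs_bounded_geometric (I : choiceType) n (Q C : K) (f : I -> K) (key : I -> conf n) :
  0 < Q -> Q < 1 -> 0 <= C ->
  (forall i, `|f i| <= C * Q ^+ ctot (key i)) ->
  (forall i j, f i != 0 -> f j != 0 -> key i = key j -> i = j) ->
  abs_bounded f (C * (1 - Q)^-1 ^+ n).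
Proof.
move=> Q0 Q1 C0 fC inj F; pose F' := [fset i in F | f i != 0]%fset.
rewrite (@sum_fset_sub _ F'); first 1 last.
- by apply/fsubsetP => i; rewrite !inE => /andP[].
- by move=> i iF; rewrite !inE iF /= negbK => /eqP ->; rewrite normr0.
apply: le_trans (_ : \sum_(i <- F') C * Q ^+ ctot (key i) <= _); first exact: ler_sum.
rewrite -mulr_sumr ler_wpM2l //.
have F'n i : i \in F' -> f i != 0 by rewrite !inE => /andP[].
move: (F') F'n => G Gn.
have -> : \sum_(i <- G) Q ^+ ctot (key i) = \sum_(h <- [fset key i | i in G]%fset) Q ^+ ctot h.
  by rewrite big_imfset //= => i j iG jG; apply: inj; exact: Gn.
exact: geometric_bound.
Qed.

Lemma sum_fsetM (I J : choiceType) (A : {fset I}) (B : {fset J}) (f : I -> K) (g : J -> K) :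
  \sum_(p <- (A `*` B)%fset) f p.1 * g p.2 = (\sum_(i <- A) f i) * (\sum_(j <- B) g j).
Proof.
rewrite big_distrl /=; under [RHS]eq_bigr do rewrite mulr_sumr.
rewrite -(@big_allpairs _ _ _ _ _ A B (fun p => f p.1 * g p.2)); apply: perm_big; apply: uniq_perm.
- exact: fset_uniq.
- by apply: allpairs_uniq => // -[a b] [c d].
move=> [i j]; rewrite in_fsetM; apply/andP/allpairsP => [[iA jB]|[[a b] [aA bB [-> ->]]]] //.
by exists (i, j).
Qed.

Section Pair.
Variables (I J : choiceType) (f : I -> K) (g : J -> K) (B C : K).
Hypotheses (fB : abs_bounded f B) (gC : abs_bounded g C).
Let h (p : I * J) := f p.1 * g p.2.

Lemma fset_box (F : {fset I * J}) : exists A D : _, (F `<=` (A `*` D))%fset.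
Proof.
exists [fset p.1 | p in F]%fset, [fset p.2 | p in F]%fset; apply/fsubsetP => -[i j] ijF.
by rewrite in_fsetM /=; apply/andP; split; apply/imfsetP; exists (i, j).
Qed.

Lemma abs_bounded_pair : abs_bounded h (B * C).
Proof.
move=> F; have [A [D FAD]] := fset_box F.
apply: le_trans (fset_sum_le _ FAD) _ => //.
under eq_bigr do rewrite normrM.
rewrite (sum_fsetM A D (fun i => `|f i|) (fun j => `|g j|)).
by apply: ler_pM; rewrite ?sumr_ge0.
Qed.

(** All three sums exist by absolute boundedness; a box containing the three finite sets given by
    [e] shows that the limits differ by at most a constant times [e]. *)
Lemma has_sum_pair : has_sum h (csum f * csum g).
Proof.
have hh := abs_has_sum abs_bounded_pair; rewrite -[X in has_sum h X](_ : csum h = _) //.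
have fs := abs_has_sum fB; have gs := abs_has_sum gC.
have B0 : 0 <= B by apply: le_trans (fB fset0); rewrite big_seq_fset0.
apply/eqP; rewrite -subr_eq0 -normr_eq0 eq_le normr_ge0 andbT.
have c0 : 0 < B + `|csum g| + 1 by rewrite ltr_wpDl // addr_ge0.
have step e : 0 < e -> `|csum h - csum f * csum g| <= e * (B + `|csum g| + 1).
  move=> e0; have [H hH] := hh _ e0; have [F hF] := fs _ e0; have [G hG] := gs _ e0.
  have [A [D HAD]] := fset_box H.
  pose S := (A `|` F)%fset; pose T := (D `|` G)%fset.
  have HST : (H `<=` (S `*` T))%fset.
    apply/fsubsetP => p /(fsubsetP HAD); rewrite !in_fsetM !in_fsetU => /andP[-> ->] //.
  have := hH _ HST; rewrite /h sum_fsetM => h1.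
  have h2 := hF _ (fsubsetUr A F); have h3 := hG _ (fsubsetUr D G).
  set a := \sum_(i <- S) f i in h1 h2; set b := \sum_(j <- T) g j in h1 h3.
  have aB : `|a| <= B by apply: le_trans (fB S); exact: ler_norm_sum.
  rewrite (_ : _ - _ = (csum h - a * b) + (a * (b - csum g) + (a - csum f) * csum g)); last by ring.
  apply: le_trans (ler_normD _ _) _; apply: le_trans (lerD (lexx _) (ler_normD _ _)) _.
  rewrite [X in _ <= X](_ : _ = e + (B * e + e * `|csum g|)); last by ring.
  rewrite !normrM distrC; apply: lerD; first exact: ltW.
  by apply: lerD; [apply: ler_pM => //; exact: ltW|apply: ler_wpM2r => //; exact: ltW].
have [->|n0] := eqVneq (csum h - csum f * csum g) 0; first by rewrite normr0.
have d0 : 0 < `|csum h - csum f * csum g| by rewrite normr_gt0.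
have := step (`|csum h - csum f * csum g| / 2%:R / (B + `|csum g| + 1)).
rewrite !divr_gt0 // => /(_ isT); rewrite mulfVK ?gt_eqF // => hd.
suff : `|csum h - csum f * csum g| < `|csum h - csum f * csum g| by rewrite ltxx.
by apply: le_lt_trans hd _; rewrite ltr_pdivrMr // ltr_pMr // ltr1n.
Qed.


End Pair.

End HasSum.

(** * Columns of queue vertices *)

Section Bound.
Variables (R : realType) (q : R).
Hypothesis q01 : 0 < q < 1.
Variable n : nat.
Implicit Types (A B C D P X Y : conf n).
Local Notation Q := (q%:C%C : R[i]).

Lemma Qgt0 : 0 < Q. Proof. by case/andP: q01; rewrite -(ltcR 0). Qed.
Lemma Qlt1 : Q < 1. Proof. by case/andP: q01 => _; rewrite -(ltcR _ 1). Qed.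

Lemma qpQ_ge0 k : 0 <= qp Q Q k.
Proof.
rewrite /qp prodr_ge0 // => i _; rewrite subr_ge0 -exprS.
by rewrite exprn_ile1 ?(ltW Qgt0) ?(ltW Qlt1).
Qed.

Lemma qpQ_le k d : qp Q Q (k + d) <= qp Q Q k.
Proof.
elim: d => [|d IH]; first by rewrite addn0.
rewrite addnS qpS; apply: le_trans IH; rewrite ler_piMr ?qpQ_ge0 // lerBlDr lerDl.
by rewrite -exprS exprn_ge0 ?(ltW Qgt0).
Qed.

Lemma gB_ge0 B : 0 <= gB Q B.
Proof. by rewrite prodr_ge0 // => i _; exact: qpQ_ge0. Qed.

(** All coordinates of Y = X - D lie above m, so if D_m > 0 the crossing power contains q^|Y|. The
    constant Q^-|D| pays for |Y| >= |X| - |D|. *)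
Lemma phi2_bound (m : 'I_n) (z sg : R[i]) D A X : offm m X = X -> (ctot A <= ctot X)%N ->
  `|phi2 Q m z sg D X| <= `|z ^+ ctot D * qp Q sg (ctot D) / gB Q D| * Q ^- ctot D
     * Q ^+ (if (0 < D m)%N then ctot A else 0).
Proof.
move=> Xc AX; have Qge0 := ltW Qgt0.
rewrite /phi2; case: ifP => [DX|_]; last first.
  by rewrite normr0 !mulr_ge0 ?invr_ge0 ?exprn_ge0.
set Y := csub X _; have YX : cadd Y (offm m D) = X by rewrite /Y csubK.
have Yc : offm m Y = Y by rewrite /Y -Xc offmB !offm_id.
have tY : (ctot X <= ctot Y + ctot D)%N.
  rewrite -YX ctotD leq_add2l; apply: leq_sum => i _; rewrite ffunE; by case: ifP.
have gXY : gB Q X / gB Q Y <= 1.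
  have gY : 0 < gB Q Y by rewrite lt_neqAle gB_ge0 eq_sym (gB_neq0 (Q1 q01)).
  rewrite ler_pdivrMr // mul1r; apply: ler_prod => i _; rewrite qpQ_ge0 -YX ffunE.
  exact: qpQ_le.
have e : ((if (0 < D m)%N then ctot A else 0) <= ccross D Y + ctot D)%N.
  case: ifP => // Dm; apply: leq_trans AX (leq_trans tY _); rewrite leq_add2r.
  rewrite /ccross (bigD1 m) //= (leq_trans _ (leq_addr _ _)) //.
  rewrite -[in leqLHS]Yc [leqRHS]big_mkcond; apply: leq_sum => i _; rewrite ffunE.
  by case: ifP => // _; rewrite leq_pmull.
rewrite /hc; set c := z ^+ _ * _.
have -> : c * gB Q X * (Q ^+ ccross D Y / (gB Q Y * gB Q D)) =
   (c / gB Q D) * ((gB Q X / gB Q Y) * Q ^+ ccross D Y).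
  by rewrite invfM; ring.
rewrite normrM -[leRHS]mulrA; apply: ler_wpM2l => //.
rewrite ger0_norm ?mulr_ge0 ?invr_ge0 ?gB_ge0 ?exprn_ge0 //.
apply: le_trans (_ : 1 * Q ^+ ccross D Y <= _); first by rewrite ler_wpM2r ?exprn_ge0.
rewrite mul1r mulrC ler_pdivlMr ?exprn_gt0 ?Qgt0 // -exprD.
by apply: ler_wiXn2l => //; exact: ltW Qlt1.
Qed.

Lemma queueW_bound (m : 'I_n) (s1 s2 u : R[i]) B D : queueW_well_defined q s1 s2 u ->
  below m B -> exists2 c : R[i], 0 <= c & forall A C, offm m A = A ->
  `|queueW q m s1 s2 u (vl m A) B (vl m C) D| <= c * Q ^+ (if (0 < D m)%N then ctot A else 0).
Proof.
move=> wd Bm; have Qge0 := ltW Qgt0.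
pose a := s1 * s2 / u; pose b := s1 * u / s2; pose z := u * s2 / s1; pose sg := s1 ^+ 2.
pose k2 := `|z ^+ ctot D * qp Q sg (ctot D) / gB Q D| * Q ^- ctot D.
pose c := `|qpre q s1 s2 u / qp Q sg (ctot B)|
  * \sum_(P <- subs B) `|gB Q B * phi1 Q a b P (csub B P)| * k2.
have k20 : 0 <= k2 by rewrite mulr_ge0 ?invr_ge0 ?exprn_ge0.
have c0 : 0 <= c by rewrite mulr_ge0 // sumr_ge0 // => P _; rewrite mulr_ge0.
exists c => // A C Ac; rewrite (queueWE q01 wd) //; case: ifP => _; last first.
  by rewrite normr0 mulr_ge0 ?exprn_ge0.
rewrite [X in `|_ * X|]mulrC mulrA normrM /c -[leRHS]mulrA ler_wpM2l //.
rewrite /Rr mulr_suml; apply: le_trans (ler_norm_sum _ _ _) _; apply: ler_sum => P _.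
rewrite normrM -[leRHS]mulrA ler_wpM2l //; apply: phi2_bound; first by rewrite offm_id.
by rewrite -[in leqLHS]Ac; apply: leq_sum => i _; rewrite !ffunE; case: ifP => // _; rewrite leq_addr.
Qed.

End Bound.

Lemma ordS_ind N (P : 'I_N.+1 -> Prop) t0 : P t0 -> (forall t, P t -> P (ordS t)) ->
  forall t, P t.
Proof.
move=> P0 PS t; have it k : P (iter k (@ordS N.+1) t0) by elim: k => //= k; exact: PS.
have vit k : iter k (@ordS N.+1) t0 = ((t0 + k) %% N.+1)%N :> nat.
  elim: k => [|k IH]; first by rewrite addn0 modn_small.
  by rewrite iterS /= IH -addn1 modnDml addn1 addnS.
have -> : t = iter (t + N.+1 - t0)%N (@ordS N.+1) t0; last exact: it.
apply/val_inj; rewrite /= vit subnKC; last by have := ltn_ord t0; lia.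
by rewrite modnDr modn_small.
Qed.

Section Rows.
Variables (N : nat) (T : Type) (t0 : T) (t : 'I_N -> T).
Lemma with_row0_0 : with_row0 t0 t ord0 = t0.
Proof. by rewrite /with_row0 unlift_none. Qed.
Lemma with_row0_S j : with_row0 t0 t (lift ord0 j) = t j.
Proof. by rewrite /with_row0 liftK. Qed.
End Rows.

Section Column.
Variables (R : realType) (q : R).
Hypothesis q01 : 0 < q < 1.
Variables (n N : nat) (m : 'I_n) (sm vm : R[i]) (rs ru : 'I_N.+1 -> R[i]).
Hypothesis wd : forall r, queueW_well_defined q (rs r) sm (ru r / vm).
Local Notation row := ('I_N.+1).
Local Notation edges := (row -> conf n).
Local Notation Q := (q%:C%C : R[i]).
Implicit Types (a c : edges) (y : {ffun row -> conf n}) (s : row -> row) (r t : row).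

Definition row_weight r A B C D := queueW q m (rs r) sm (ru r / vm) (vl m A) B (vl m C) D.

(* [s r] is the position of row [r] on the cylinder. *)
Definition column_weight s a c y : R[i] :=
  if [forall t, offm m (y t) == y t] then
    \prod_r row_weight r (y (s r)) (a r) (y (ordS (s r))) (c r) else 0.

(** Colors up to m cannot occur to the left of column m, nor colors below m to its right; that color
    m leaves somewhere makes the column sum converge. Each condition depends only on the total
    content of the edges. *)
Definition crosses a c : bool :=
  [&& [forall r, forall i : 'I_n, (i <= m)%N ==> (a r i == 0)%N],
      [forall r, forall i : 'I_n, (i < m)%N ==> (c r i == 0)%N]
    & [exists r, 0 < c r m]%N].

Definition column_sum s a c : R[i] :=
  if crosses a c then csum (column_weight s a c) else 0.

Lemma crosses_below a c : crosses a c ->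
  [/\ forall r, below m (a r), forall r, below m (c r) & exists r, (0 < c r m)%N].
Proof.
move=> /and3P[/forallP h1 /forallP h2 /existsP h3]; split=> // r i im.
  by have /forallP/(_ i)/implyP/(_ (ltnW im))/eqP := h1 r.
by have /forallP/(_ i)/implyP/(_ im)/eqP := h2 r.
Qed.

Lemma crosses_content a c a' c' :
  (forall i, \sum_r a r i = \sum_r a' r i)%N -> (forall i, \sum_r c r i = \sum_r c' r i)%N ->
  crosses a c = crosses a' c'.
Proof.
move=> ha hc.
have E (P : pred 'I_n) (e e' : edges) : (forall i, \sum_r e r i = \sum_r e' r i)%N ->
   [forall r, forall i : 'I_n, P i ==> (e r i == 0)%N] =
   [forall r, forall i : 'I_n, P i ==> (e' r i == 0)%N].
  have key (d d' : edges) : (forall i, \sum_r d r i = \sum_r d' r i)%N ->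
     [forall r, forall i : 'I_n, P i ==> (d r i == 0)%N] ->
     [forall r, forall i : 'I_n, P i ==> (d' r i == 0)%N].
    move=> h /forallP h0; apply/forallP => r; apply/forallP => i; apply/implyP => Pi.
    have := h i; rewrite big1; first by move/esym/eqP; rewrite sum_nat_eq0 => /forallP/(_ r).
    by move=> r' _; have /forallP/(_ i)/implyP/(_ Pi)/eqP := h0 r'.
  by move=> h; apply/idP/idP; apply: key => // i; rewrite h.
rewrite /crosses (E (fun i => i <= m)%N _ _ ha) (E (fun i => i < m)%N _ _ hc); congr [&& _, _ & _].
have E' (e : edges) : [exists r, 0 < e r m]%N = (0 < \sum_r e r m)%N.
  rewrite lt0n sum_nat_eq0 negb_forall; apply: eq_existsb => r; by rewrite /= lt0n.
by rewrite !E' hc.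
Qed.

Lemma row_weight_neq0 r A B C D : below m B -> row_weight r A B C D != 0 ->
  [/\ offm m (cadd A B) = offm m (cadd C D), below m D,
      queue_allowed q (rs r) (ctot B) & queue_allowed q (rs r) (ctot D)].
Proof.
move=> Bm; rewrite /row_weight (queueWE q01 (wd r)) //.
by case: asboolP => //; rewrite eqxx.
Qed.

Lemma column_weight_neq0 s a c y : (forall r, below m (a r)) -> column_weight s a c y != 0 ->
  (forall t, offm m (y t) = y t) /\ forall r,
  [/\ offm m (cadd (y (s r)) (a r)) = offm m (cadd (y (ordS (s r))) (c r)), below m (c r),
      queue_allowed q (rs r) (ctot (a r)) & queue_allowed q (rs r) (ctot (c r))].
Proof.
move=> am; rewrite /column_weight; case: ifP => [/forallP yc|]; last by rewrite eqxx.
move/prodf_neq0 => h; split=> [t|r]; first exact/eqP/yc.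
by apply: row_weight_neq0 => //; exact: h.
Qed.

Lemma column_abs_bounded s a c : injective s -> crosses a c ->
  exists B, abs_bounded (column_weight s a c) B.
Proof.
move=> sinj /crosses_below[am cm [r0 r0m]].
have [s' s'K sK'] := injF_bij sinj.
have hK r : exists K : R[i], 0 <= K /\ forall A C, offm m A = A ->
    `|row_weight r A (a r) C (c r)| <= K * Q ^+ (if (0 < c r m)%N then ctot A else 0).
  by have [K K0 hK] := queueW_bound q01 (c r) (wd r) (am r); exists K.
have [K hK'] := choice hK.
have Qle1 := ltW (Qlt1 q01); have Qge0 := ltW (Qgt0 q01).
exists ((\prod_r K r) * (1 - Q)^-1 ^+ n).
apply: (@abs_bounded_geometric _ _ n Q (\prod_r K r) _ (fun y => y (s r0))).
- exact: Qgt0. - exact: Qlt1.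
- by rewrite prodr_ge0 // => r _; case: (hK' r).
- move=> y; rewrite /column_weight; case: ifP => [/forallP yc|_]; last first.
    by rewrite normr0 mulr_ge0 ?exprn_ge0 // prodr_ge0 // => r _; case: (hK' r).
  rewrite normr_prod; apply: le_trans (_ : \prod_r (K r * Q ^+ (if (0 < c r m)%N then ctot (y (s r)) else 0)) <= _).
    by apply: ler_prod => r _; rewrite normr_ge0; apply: (hK' r).2; exact/eqP/yc.
  rewrite big_split /= ler_wpM2l ?prodr_ge0 //; first by move=> r _; case: (hK' r).
  rewrite (bigD1 r0) //= r0m ler_piMr ?exprn_ge0 // prodr_ile1 // => r _.
  by rewrite exprn_ge0 // exprn_ile1.
move=> y y' /(column_weight_neq0 am)[yc hy] /(column_weight_neq0 am)[yc' hy'] y0.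
apply/ffunP; apply: (ordS_ind y0) => t yt.
have [h _ _ _] := hy (s' t); have [h' _ _ _] := hy' (s' t).
move: h h'; rewrite sK' yt => -> ; rewrite !offmD yc yc'; exact: caddI.
Qed.

Lemma has_column_sum s a c : injective s -> crosses a c ->
  has_sum (column_weight s a c) (column_sum s a c).
Proof.
move=> si ac; rewrite /column_sum ac; have [B hB] := column_abs_bounded si ac.
exact: abs_has_sum hB.
Qed.

(** Conservation is summed around the column: each vertical tuple is incoming once and outgoing
    once, so these contributions cancel. *)
Lemma column_sum_neq0 s a c : injective s -> column_sum s a c != 0 ->
  [/\ crosses a c, forall r, queue_allowed q (rs r) (ctot (c r))
    & forall i, i != m -> (\sum_r a r i = \sum_r c r i)%N].
Proof.
move=> si; rewrite /column_sum; case: ifP => [ac|]; last by rewrite eqxx.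
have [am cm _] := crosses_below ac.
have [[y y0] _|h0] := pselect (exists y, column_weight s a c y != 0); last first.
  rewrite (_ : column_weight s a c = fun=> 0); last first.
    apply/funext => y; apply/eqP; apply: contra_notT h0 => ?; by exists y.
  by rewrite (has_sumE (@has_sum0 _ _)) eqxx.
have [yc hy] := column_weight_neq0 am y0; split=> // [r|i im].
  by case: (hy r).
case: (ltnP m i) => mi; last first.
  by rewrite !big1 // => r _; [rewrite cm|rewrite am] => //; rewrite ltn_neqAle mi andbT -val_eqE in im *.
apply: (@addnI (\sum_t y t i)).
have Ey : (\sum_t y t i = \sum_r y (s r) i)%N by rewrite (reindex_inj si).
have Ey' : (\sum_t y t i = \sum_r y (ordS (s r)) i)%N.
  by rewrite (reindex_inj (inj_comp (@ordS_inj _) si)).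
rewrite {1}Ey Ey' -!big_split /=; apply: eq_bigr => r _.
by have [h _ _ _] := hy r; have := pw h i; rewrite !ffunE mi.
Qed.

End Column.

(** * States, their arrow content, and exchanges between row 0 and row j *)

Section States.
Variables (R : realType) (q : R).
Variables (n N : nat).
Local Notation row := ('I_N.+1).
Local Notation state := (state n N).
Local Notation ck := (@color_conf n).
Implicit Types (a b d z : state) (j : 'I_N) (i : 'I_n) (T : nat).

Definition rows_of b : row -> conf n := with_row0 (ck b.1) b.2.
Definition content b i : nat := \sum_r rows_of b r i.
Definition arrows b : nat := \sum_i content b i.

Lemma contentE b i : content b i = (ck b.1 i + \sum_j b.2 j i)%N.
Proof.
rewrite /content big_ord_recl /rows_of with_row0_0; congr (_ + _)%N.
by apply: eq_bigr => j _; rewrite with_row0_S.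
Qed.

Definition state_emb T (s : 'I_n.+1 * {ffun 'I_N -> {ffun 'I_n -> 'I_T.+1}}) : state :=
  (s.1, [ffun j => emb (s.2 j)]).
(** A finite list that is stable under every transition preserving the number of arrows. *)
Definition states T : seq state :=
  [seq b <- [seq state_emb s | s <- enum {: 'I_n.+1 * {ffun 'I_N -> {ffun 'I_n -> 'I_T.+1}}}]
   | (arrows b <= T)%N].

Lemma states_uniq T : uniq (states T).
Proof.
rewrite filter_uniq // map_inj_uniq ?enum_uniq // => -[k f] [k' f'] [-> /ffunP E].
by congr (_, _); apply/ffunP => j; have := E j; rewrite !ffunE; exact: emb_inj.
Qed.

Lemma mem_states T b : (b \in states T) = (arrows b <= T)%N.
Proof.
rewrite mem_filter; case: leqP => //= bT; case: b bT => k f bT.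
have h j i : (f j i <= T)%N.
  apply: leq_trans bT; rewrite /arrows (bigD1 i) //= contentE /=.
  by rewrite (bigD1 j) //=; lia.
apply/mapP; exists (k, [ffun j => sval (emb_ex (h j))]); first by rewrite mem_enum.
congr (_, _); apply/ffunP => j; rewrite !ffunE; exact: (svalP (emb_ex (h j))).
Qed.

Lemma fsbig_states T (F : state -> R[i]) : (forall b, F b != 0 -> (arrows b <= T)%N) ->
  \sum_(b \in [set: state]%classic) F b = \sum_(b <- states T) F b.
Proof.
move=> h; rewrite (@fsbigE _ _ _ _ _ (states T)) ?states_uniq //.
  by apply: eq_bigl => b; rewrite in_setT.
by move=> b _; rewrite mem_states; apply: contraNeq => /h.
Qed.

(** The only transitions with nonzero weight in the operator L^{(0,j)}. *)
Definition exchange z j b :=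
  (forall j', j' != j -> z.2 j' = b.2 j') /\ cadd (z.2 j) (ck z.1) = cadd (b.2 j) (ck b.1).

Lemma exchange_content z j b : exchange z j b -> forall i, content b i = content z i.
Proof.
move=> [h1 h2] i; rewrite !contentE (bigD1 j) //= [in RHS](bigD1 j) //= !addnA.
congr (_ + _)%N; first by have := pw h2 i; rewrite !ffunE addnC [in RHS]addnC => ->.
by apply: eq_bigr => j' /h1 ->.
Qed.

Lemma exchange_arrows z j b : exchange z j b -> arrows b = arrows z.
Proof. by move=> /exchange_content h; apply: eq_bigr => i _. Qed.

Definition move z j k : state :=
  (k, [ffun j' => if j' == j then csub (cadd (z.2 j) (ck z.1)) (ck k) else z.2 j']).

Lemma exchange_move z j k : cle (ck k) (cadd (z.2 j) (ck z.1)) -> exchange z j (move z j k).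
Proof.
by move=> h; split=> [j' /negbTE j'j|]; rewrite /= ffunE ?eqxx ?j'j // csubK.
Qed.

Lemma exchangeP z j b : exchange z j b ->
  b = move z j b.1 /\ cle (ck b.1) (cadd (z.2 j) (ck z.1)).
Proof.
move=> [h1 h2]; split; last by rewrite h2 cle_addl.
case: b h1 h2 => k f /= h1 h2; congr (_, _); apply/ffunP => j'; rewrite ffunE.
by case: eqP => [->|/eqP /h1 -> //]; rewrite h2 caddK.
Qed.

(** An exchange is determined by the new color of row 0, so a sum over states becomes a sum over one
    color, as in the local equation. *)
Lemma sum_states_exchange T z j (G : state -> R[i]) : (arrows z <= T)%N ->
  (forall b, G b != 0 -> exchange z j b) ->
  \sum_(b <- states T) G b =
  \sum_k if cle (ck k) (cadd (z.2 j) (ck z.1)) then G (move z j k) else 0.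
Proof.
move=> zT hG.
transitivity (\sum_(b <- states T) \sum_k
    if cle (ck k) (cadd (z.2 j) (ck z.1)) && (b == move z j k) then G b else 0).
  apply: eq_bigr => b _; have [Gb|/hG /exchangeP[bE bk]] := eqVneq (G b) 0.
    by rewrite big1 // => k _; rewrite Gb; case: ifP.
  rewrite (bigD1 b.1) //= bk -bE eqxx big1 ?addr0 // => k kb.
  by rewrite ifF //; apply: contraNF kb => /andP[_ /eqP ->].
rewrite exchange_big; apply: eq_bigr => k _ /=; case: ifP => [h|_]; last by rewrite big1.
rewrite (bigD1_seq (move z j k)) ?states_uniq //=; last first.
  by rewrite mem_states (exchange_arrows (exchange_move h)).
by rewrite eqxx big1 ?addr0 // => b /negbTE ->.
Qed.

Lemma Lop_exchange j (s x : R[i]) a b : Lop q j s x a b != 0 -> exchange a j b.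
Proof.
rewrite /Lop /Lweight /fusedW; case: forallP => [h|]; last by rewrite eqxx.
case: ifP => [/eqP E _|]; last by rewrite eqxx.
by split=> // j' j'j; have := h j'; rewrite j'j => /eqP.
Qed.

Lemma exchange_sym z j b : exchange z j b -> exchange b j z.
Proof. by move=> [h1 h2]; split=> // j' /h1. Qed.

Lemma Lop_move_l j (s x : R[i]) z k : Lop q j s x (move z j k) z
  = Lweight q s x (csub (cadd (z.2 j) (ck z.1)) (ck k)) k (z.2 j) z.1.
Proof.
rewrite /Lop ifT /=; first by rewrite ffunE eqxx.
by apply/forallP => j'; apply/implyP => /negbTE h; rewrite ffunE h.
Qed.

Lemma Lop_move_r j (s x : R[i]) z k : Lop q j s x z (move z j k)
  = Lweight q s x (z.2 j) z.1 (csub (cadd (z.2 j) (ck z.1)) (ck k)) k.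
Proof.
rewrite /Lop ifT /=; first by rewrite ffunE eqxx.
by apply/forallP => j'; apply/implyP => /negbTE h; rewrite ffunE h.
Qed.
End States.

Section Update.
Variables (N : nat) (T : eqType).
Implicit Types (y : {ffun 'I_N.+1 -> T}).
Definition fupd y t0 h : {ffun 'I_N.+1 -> T} := [ffun t => if t == t0 then h else y t].
Lemma fupd_eq y t0 h : fupd y t0 h t0 = h. Proof. by rewrite ffunE eqxx. Qed.
Lemma fupd_neq y t0 h t : t != t0 -> fupd y t0 h t = y t.
Proof. by move=> tt0; rewrite ffunE (negbTE tt0). Qed.
Lemma fupdK y t0 h h' : fupd (fupd y t0 h) t0 h' = fupd y t0 h'.
Proof. by apply/ffunP => t; rewrite !ffunE; case: eqP. Qed.
Lemma fupd_id y t0 : fupd y t0 (y t0) = y.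
Proof. by apply/ffunP => t; rewrite ffunE; case: eqP => [->|]. Qed.
End Update.

Section InnerEdge.
Variables (R : realType) (q : R).
Hypothesis q01 : 0 < q < 1.
Variables (n N : nat) (m : 'I_n) (sm vm : R[i]) (rs ru : 'I_N.+1 -> R[i]).
Hypothesis wd : forall r, queueW_well_defined q (rs r) sm (ru r / vm).
Local Notation row := ('I_N.+1).
Local Notation edges := (row -> conf n).
Implicit Types (a c : edges) (y : {ffun row -> conf n}) (s : row -> row) (r t : row).
Local Notation cw := (column_weight q m sm vm rs ru).
Local Notation rw := (row_weight q m sm vm rs ru).
Local Notation cs := (column_sum q m sm vm rs ru).

(* Conservation determines the edge [t0] above row [r] from the other data. *)
Definition inner s a c r t0 y :=
  fupd y t0 (csub (offm m (cadd (y (s r)) (a r))) (offm m (c r))).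

(** The tuple at [t0] is determined by the others, so the sum may be indexed by families with the
    placeholder 0 at [t0]. This index set is common to both sides of the Yang-Baxter equation. *)
Lemma has_sum_inner s a c r t0 : injective s -> crosses m a c ->
  ordS (s r) = t0 -> s r != t0 ->
  has_sum (fun y => if fupd y t0 (czero n) == y then cw s a c (inner s a c r t0 y) else 0)
    (cs s a c).
Proof.
move=> si ac st0 snt0; have [am _ _] := crosses_below ac.
have H := @has_sum_push _ _ _ _ _ (fun y => fupd y t0 (czero n)) (inner s a c r t0)
  (has_column_sum q01 wd si ac).
have /H : forall y, cw s a c y != 0 -> inner s a c r t0 (fupd y t0 (czero n)) = y.
  move=> y /(column_weight_neq0 q01 wd am)[yc /(_ r)[h _ _ _]].
  by rewrite /inner fupdK fupd_neq // h st0 offmD yc caddK fupd_id.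
by under eq_fun do rewrite /inner fupdK.
Qed.

Lemma column_weight_split p s a c y : p != ord0 -> (forall t, offm m (y t) = y t) ->
  cw s a c y = rw p (y (s p)) (a p) (y (ordS (s p))) (c p)
    * rw ord0 (y (s ord0)) (a ord0) (y (ordS (s ord0))) (c ord0)
    * \prod_(r | (r != ord0) && (r != p)) rw r (y (s r)) (a r) (y (ordS (s r))) (c r).
Proof.
move=> p0 yc; rewrite /column_weight ifT; last by apply/forallP => t; apply/eqP.
by rewrite (bigD1 ord0) //= (bigD1 p) //= mulrA [X in X * _]mulrC.
Qed.
End InnerEdge.

Lemma below_above n (m : 'I_n) k : below m (color_conf k) -> above m k.
Proof.
case: (unliftP ord0 k) => [i|] -> // h _; rewrite lift0 ltnS leqNgt; apply/negP => im.
by have := h i im; rewrite color_confS ffunE eqxx.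
Qed.

(** * Yang-Baxter equation for a whole column of the cylinder *)

Section ColumnYBE.
Variables (R : realType) (q : R).
Hypothesis q01 : 0 < q < 1.
Variables (n N : nat) (x : R[i]) (u sh : 'I_N -> R[i]) (m : 'I_n) (sm vm : R[i]).
Local Notation row := ('I_N.+1).
Local Notation rq := ((Num.sqrt q)%:C%C : R[i]).
Local Notation ck := (@color_conf n).
Let rs := with_row0 rq^-1 sh.
Let ru := with_row0 (x * rq) u.
Hypothesis wd0 : queueW_well_defined q rq^-1 sm (x * rq / vm).
Hypothesis wdS : forall j, queueW_well_defined q (sh j) sm (u j / vm).
Hypothesis wdL : forall j, Lweight_well_defined q (sh j) (x * (u j)^-1).
Hypothesis u0 : forall j, u j != 0.
Hypothesis v0 : vm != 0.
Implicit Types (a b d : state n N).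
Local Notation cs s a b := (column_sum q m sm vm rs ru s (rows_of a) (rows_of b)).
Local Notation cw := (column_weight q m sm vm rs ru).
Local Notation rw := (row_weight q m sm vm rs ru).

Lemma wd_rows r : queueW_well_defined q (rs r) sm (ru r / vm).
Proof. by case: (unliftP ord0 r) => [j|] ->; rewrite /rs /ru ?with_row0_S ?with_row0_0. Qed.

Variable j : 'I_N.
Let p : row := lift ord0 j.
Variable s : row -> row.
Hypothesis si : injective s.
Hypothesis sp : ordS (s p) = s ord0.
(** In [s] row 0 lies directly above row j, in [s'] directly below it; in both cases the vertical
    tuple at [t0] is the one between the two rows. *)
Let s' r := s (tperm ord0 p r).
Let t0 := s ord0.
Let p0 : p != ord0. Proof. by rewrite eq_sym neq_lift. Qed.
Let spt0 : s p != t0. Proof. by rewrite (inj_eq si). Qed.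
Let St0 : ordS t0 != t0. Proof. by rewrite /t0 -[in X in _ != X]sp (inj_eq (@ordS_inj _)) eq_sym. Qed.
Let s'0 : s' ord0 = s p. Proof. by rewrite /s' tpermL. Qed.
Let s'p : s' p = t0. Proof. by rewrite /s' tpermR. Qed.
Let s'r r : r != ord0 -> r != p -> s' r = s r.
Proof. by move=> h1 h2; rewrite /s' tpermD // eq_sym. Qed.
Let s'i : injective s'. Proof. by move=> r r' /si /perm_inj. Qed.

Section Pointwise.
Variables (a d : state n N) (y : {ffun row -> conf n}).
Hypothesis ad : crosses m (rows_of a) (rows_of d).
Hypothesis al : queue_allowed q (sh j) (ctot (a.2 j)).
Hypothesis yc : forall t, offm m (y t) = y t.
Let rest := \prod_(r | (r != ord0) && (r != p)) rw r (y (s r)) (rows_of a r) (y (ordS (s r))) (rows_of d r).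

Let rows_0 b : rows_of b ord0 = ck b.1. Proof. exact: with_row0_0. Qed.
Let rows_p b : rows_of b p = b.2 j. Proof. exact: with_row0_S. Qed.
Let rows_r b k r : r != ord0 -> r != p -> rows_of (move b j k) r = rows_of b r.
Proof.
case: (unliftP ord0 r) => [i|] ->; last by rewrite eqxx.
by move=> _; rewrite (inj_eq lift_inj) /rows_of !with_row0_S ffunE => /negbTE ->.
Qed.
Let move_j b k : (move b j k).2 j = csub (cadd (b.2 j) (ck b.1)) (ck k).
Proof. by rewrite ffunE eqxx. Qed.

Let rest_neq r : r != ord0 -> r != p -> (s r != t0) /\ (ordS (s r) != t0).
Proof. by move=> r0 rp; rewrite /t0 -[in X in _ /\ X]sp (inj_eq (@ordS_inj _)) !(inj_eq si). Qed.

(** With all tuples except the one at [t0] fixed, the other rows contribute a common factor [rest]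
    that does not see [t0], and the local equation applies. *)
Lemma pointwise_ybe :
  \sum_k (if cle (ck k) (cadd (d.2 j) (ck d.1)) then
     cw s (rows_of a) (rows_of (move d j k)) (inner m s (rows_of a) (rows_of (move d j k)) p t0 y)
     * Lop q j (sh j) (x * (u j)^-1) (move d j k) d else 0)
  = \sum_k (if cle (ck k) (cadd (a.2 j) (ck a.1)) then
     Lop q j (sh j) (x * (u j)^-1) a (move a j k)
     * cw s' (rows_of (move a j k)) (rows_of d) (inner m s' (rows_of (move a j k)) (rows_of d) ord0 t0 y) else 0).
Proof.
have [am dm _] := crosses_below ad.
have Bm : below m (a.2 j) by rewrite -rows_p.
have Dm : below m (d.2 j) by rewrite -rows_p.
have km : above m a.1 by apply: below_above; rewrite -rows_0.
have lm : above m d.1 by apply: below_above; rewrite -rows_0.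
have := queue_ybe q01 (u0 j) v0 wd0 (wdS j) (wdL j) (y (ordS t0)) (yc (s p)) Bm Dm km lm al.
move/(congr1 ( *%R rest)); rewrite !mulr_sumr.
have upc h t : offm m h = h -> offm m (fupd y t0 h t) = fupd y t0 h t.
  by move=> hc; rewrite ffunE; case: ifP.
have hc (C E : conf n) : offm m (csub (offm m C) (offm m E)) = csub (offm m C) (offm m E).
  by rewrite offmB !offm_id.
move=> E; transitivity (\sum_k rest * tL m
   (fun A B C D => queueW q m (sh j) sm (u j / vm) (vl m A) B (vl m C) D)
   (fun A k C l => queueW q m rq^-1 sm (x * rq / vm) (vl m A) (ck k) (vl m C) (ck l))
   (Lweight q (sh j) (x * (u j)^-1)) (y (s p)) (y (ordS t0)) (a.2 j) (d.2 j) a.1 d.1 k).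
  apply: eq_bigr => k _; rewrite /tL; case: ifP => _; last by rewrite mulr0.
  rewrite (column_weight_split q sm vm rs ru _ _ _ p0); last by move=> t; apply: upc.
  rewrite /inner sp !fupd_eq !(fupd_neq _ _ spt0) !(fupd_neq _ _ St0) !rows_p !rows_0 move_j /=.
  rewrite Lop_move_l /row_weight /rs /ru !with_row0_S !with_row0_0 -/rs -/ru.
  rewrite [LHS]mulrAC [LHS]mulrC; congr (_ * _).
  apply: eq_bigr => r /andP[r0 rp]; have [h1 h2] := rest_neq r0 rp.
  by rewrite !fupd_neq // rows_r.
rewrite {}E; apply: eq_bigr => k _; rewrite /tR; case: ifP => _; last by rewrite mulr0.
rewrite (column_weight_split q sm vm rs ru _ _ _ p0); last by move=> t; apply: upc.
rewrite /inner s'0 s'p sp -/t0 !fupd_eq !(fupd_neq _ _ spt0) !(fupd_neq _ _ St0) !rows_p !rows_0 move_j /=.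
rewrite Lop_move_r /row_weight /rs /ru !with_row0_S !with_row0_0 -/rs -/ru.
rewrite [RHS]mulrA [RHS]mulrC; congr (_ * _); last by rewrite [X in _ = _ * X]mulrC.
apply: eq_bigr => r /andP[r0 rp]; have [h1 h2] := rest_neq r0 rp.
by rewrite s'r // !fupd_neq // rows_r.
Qed.
End Pointwise.

Lemma column_ybe T a d : queue_allowed q (sh j) (ctot (a.2 j)) ->
  (arrows a <= T)%N -> (arrows d <= T)%N ->
  \sum_(b <- states n N T) cs s a b * Lop q j (sh j) (x * (u j)^-1) b d
  = \sum_(b <- states n N T) Lop q j (sh j) (x * (u j)^-1) a b * cs s' b d.
Proof.
move=> al aT dT.
rewrite (sum_states_exchange (j := j) dT); last first.
  by move=> b; rewrite mulf_eq0 negb_or => /andP[_ /Lop_exchange/exchange_sym].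
rewrite (sum_states_exchange (j := j) aT); last first.
  by move=> b; rewrite mulf_eq0 negb_or => /andP[/Lop_exchange].
(* An exchange preserves contents and hence [crosses], so without it every term on both sides is
   zero. *)
case: (boolP (crosses m (rows_of a) (rows_of d))) => ad; last first.
  rewrite [RHS]big1; last first.
    move=> k _; case: ifP => // h; rewrite /column_sum (crosses_content _ (exchange_content (exchange_move h)) (fun=> erefl)).
    by rewrite (negbTE ad) mulr0.
  rewrite big1 // => k _; case: ifP => // h; rewrite /column_sum.
  by rewrite (crosses_content _ (fun=> erefl) (exchange_content (exchange_move h))) (negbTE ad) mul0r.
have gl k : cle (ck k) (cadd (d.2 j) (ck d.1)) -> crosses m (rows_of a) (rows_of (move d j k)).
  by move=> h; rewrite (crosses_content _ (fun=> erefl) (exchange_content (exchange_move h))).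
have gr k : cle (ck k) (cadd (a.2 j) (ck a.1)) -> crosses m (rows_of (move a j k)) (rows_of d).
  by move=> h; rewrite (crosses_content _ (exchange_content (exchange_move h)) (fun=> erefl)).
have H1 k : has_sum (fun y => if cle (ck k) (cadd (d.2 j) (ck d.1)) then
     (if fupd y t0 (czero n) == y then cw s (rows_of a) (rows_of (move d j k)) (inner m s (rows_of a) (rows_of (move d j k)) p t0 y) else 0)
     * Lop q j (sh j) (x * (u j)^-1) (move d j k) d else 0)
   (if cle (ck k) (cadd (d.2 j) (ck d.1)) then cs s a (move d j k) * Lop q j (sh j) (x * (u j)^-1) (move d j k) d else 0).
  case: (boolP (cle _ _)) => h; last exact: has_sum0.
  by apply: has_sumZ; apply: (has_sum_inner q01 wd_rows si (gl _ h)).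
have H2 k : has_sum (fun y => if cle (ck k) (cadd (a.2 j) (ck a.1)) then
     (if fupd y t0 (czero n) == y then cw s' (rows_of (move a j k)) (rows_of d) (inner m s' (rows_of (move a j k)) (rows_of d) ord0 t0 y) else 0)
     * Lop q j (sh j) (x * (u j)^-1) a (move a j k) else 0)
   (if cle (ck k) (cadd (a.2 j) (ck a.1)) then Lop q j (sh j) (x * (u j)^-1) a (move a j k) * cs s' (move a j k) d else 0).
  case: (boolP (cle _ _)) => h; last exact: has_sum0.
  rewrite [X in has_sum _ X]mulrC; apply: has_sumZ; apply: (has_sum_inner q01 wd_rows s'i (gr _ h)).
    by rewrite s'0.
  by rewrite s'0.
rewrite -(has_sumE (has_sum_sum (index_enum _) H1)) -(has_sumE (has_sum_sum (index_enum _) H2)).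
congr csum; apply/funext => y.
case: (eqVneq (fupd y t0 (czero n)) y) => [e|_]; last first.
  by rewrite !big1 // => k _; case: ifP => //; rewrite mul0r.
have yt0 : y t0 = czero n by rewrite -e fupd_eq.
case: (pselect (forall t, offm m (y t) = y t)) => [yc|nc].
  rewrite (pointwise_ybe ad al yc); apply: eq_bigr => k _; case: ifP => // _; exact: mulrC.
have nc' s1 (a1 c1 : row -> conf n) r : cw s1 a1 c1 (inner m s1 a1 c1 r t0 y) = 0.
  rewrite /column_weight ifF //; apply: contra_notF nc => /forallP h t.
  have [->|tt0] := eqVneq t t0; first by rewrite yt0 offm0.
  by have /eqP := h t; rewrite /inner fupd_neq.
by rewrite !big1 // => k _; case: ifP => // _; rewrite nc' mul0r.
Qed.
End ColumnYBE.

(** * The cylinder *)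

Section Chain.
Variables (R : realType) (q : R).
Hypothesis q01 : 0 < q < 1.
Variables (n N : nat) (x : R[i]) (u sh : 'I_N -> R[i]) (v sv : 'I_n -> R[i]).
Hypothesis pwd : params_well_defined q x u sh v sv.
Local Notation row := ('I_N.+1).
Local Notation state := (state n N).
Local Notation rq := ((Num.sqrt q)%:C%C : R[i]).
Local Notation ck := (@color_conf n).
Local Notation rs := (with_row0 rq^-1 sh).
Local Notation ru := (with_row0 (x * rq) u).
Implicit Types (a b c d : state) (m : 'I_n) (s : row -> row) (T k : nat).

Let u0 j : u j != 0. Proof. by case: pwd => -[]. Qed.
Let v0 m : v m != 0. Proof. by case: pwd => -[]. Qed.
Let wd0 m : queueW_well_defined q rq^-1 (sv m) (x * rq / v m). Proof. by case: pwd. Qed.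
Let wdS m j : queueW_well_defined q (sh j) (sv m) (u j / v m). Proof. by case: pwd. Qed.
Let wdL j : Lweight_well_defined q (sh j) (x * (u j)^-1). Proof. by case: pwd. Qed.
Let wdr m r : queueW_well_defined q (rs r) (sv m) (ru r / v m).
Proof. exact: wd_rows (wd0 m) (wdS m) r. Qed.

(** The guard makes the weight absolutely summable for arbitrary edges. *)
Definition cweight m s a c (y : {ffun row -> conf n}) : R[i] :=
  if crosses m (rows_of a) (rows_of c) then
    column_weight q m (sv m) (v m) rs ru s (rows_of a) (rows_of c) y else 0.
Definition cmx m s a c : R[i] := column_sum q m (sv m) (v m) rs ru s (rows_of a) (rows_of c).

Lemma cweight_bounded m s a c : injective s -> exists B, abs_bounded (cweight m s a c) B.
Proof.
move=> si; rewrite /cweight; case: (boolP (crosses m (rows_of a) (rows_of c))) => h; last first.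
  by exists 0 => F; rewrite big1 // => y _; rewrite normr0.
exact: (column_abs_bounded q01 (wdr m) si h).
Qed.

Lemma csum_cweight m s a c : csum (cweight m s a c) = cmx m s a c.
Proof.
rewrite /cmx /column_sum /cweight; case: (crosses m (rows_of a) (rows_of c)) => //.
by apply: has_sumE; exact: has_sum0.
Qed.

(** Shifting all rows by one position only relabels the vertical tuples. *)
Lemma cmx_ordS m a c : cmx m (@ordS N.+1) a c = cmx m id a c.
Proof.
rewrite /cmx /column_sum; case: (boolP (crosses m (rows_of a) (rows_of c))) => h; last by [].
have [B hB] := column_abs_bounded q01 (wdr m) (@inj_id _) h.
pose e (y : {ffun row -> conf n}) := [ffun t => y (ord_pred t)].
pose d (y : {ffun row -> conf n}) := [ffun t => y (ordS t)].
pose f := column_weight q m (sv m) (v m) rs ru id (rows_of a) (rows_of c).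
have H : has_sum (fun y => if e (d y) == y then f (d y) else 0) (csum f).
  by apply: has_sum_push (abs_has_sum hB) _ => y _; apply/ffunP => t; rewrite !ffunE ordSK.
rewrite -/f; apply: has_sumE; congr has_sum: H; apply/funext => y.
rewrite ifT; last by apply/eqP/ffunP => t; rewrite !ffunE ord_predK.
rewrite /d /f.
rewrite /column_weight; have -> : [forall t, offm m ([ffun t => y (ordS t)] t) == [ffun t => y (ordS t)] t]
   = [forall t, offm m (y t) == y t].
  apply/forallP/forallP => h' t; last by rewrite ffunE.
  by have := h' (ord_pred t); rewrite ffunE ord_predK.
by case: ifP => // _; apply: eq_bigr => r _; rewrite !ffunE.
Qed.

Lemma cmx_neq0 m s a c : injective s -> cmx m s a c != 0 ->
  [/\ forall j, queue_allowed q (sh j) (ctot (c.2 j)), (0 < content c m)%N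
    & forall i, i != m -> content a i = content c i].
Proof.
move=> si /(column_sum_neq0 q01 (wdr m) si)[/crosses_below[_ _ [r cm]] h1 h2]; split=> //.
- by move=> j; have := h1 (lift ord0 j); rewrite /rows_of !with_row0_S.
- by rewrite /content (bigD1 r) //= ltn_addr.
Qed.

(** Product of the matrices of the columns k - 1, ..., 0 from left to right. Cutting intermediate
    states off at T arrows keeps the sums finite and loses nothing once T bounds the right edge (see
    [col_termE]). *)
Fixpoint chain s T k a b : R[i] :=
  if k is k'.+1 then
    \sum_(c <- states n N T) (if insub k' is Some m then cmx m s a c else 0) * chain s T k' c b
  else (a == b)%:R.

(** Column m conserves every color except m and forces m to be present on its right; columns further
    to the right conserve m. *)
Lemma chain_content s T k a b : injective s -> chain s T k a b != 0 ->
  (forall i : 'I_n, (k <= i)%N -> content a i = content b i) /\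
  (forall i : 'I_n, (i < k)%N -> (0 < content b i)%N).
Proof.
move=> si; elim: k a => [|k IH] a /=; first by case: (a =P b) => [-> //|_]; rewrite eqxx.
move=> h; have [c _] : exists2 c, c \in states n N T &
    (if insub k is Some m then cmx m s a c else 0) * chain s T k c b != 0.
  apply/hasP; apply: contraNT h => /hasPn h; rewrite big1_seq // => c /h /negPn/eqP //.
rewrite mulf_eq0 negb_or => /andP[]; case: insubP => [m _ mk|]; last by rewrite eqxx.
move=> /(cmx_neq0 si)[_ h1 h2] /IH[h3 h4]; split=> i ki.
  rewrite h2; first by apply: h3; exact: ltnW.
  by rewrite -val_eqE /= mk gtn_eqF.
move: ki; rewrite ltnS leq_eqVlt => /orP[/eqP ki|]; last exact: h4.
by rewrite -h3 ?ki // (_ : i = m) //; apply/val_inj; rewrite /= mk.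
Qed.

(** Induction on the columns. The truncation hypothesis on row j of the left edge is inherited by
    the next edge, because a nonzero column sum has an allowed right edge. *)
Lemma chain_ybe j s T k a d : injective s -> ordS (s (lift ord0 j)) = s ord0 ->
  queue_allowed q (sh j) (ctot (a.2 j)) -> (arrows a <= T)%N -> (arrows d <= T)%N ->
  \sum_(b <- states n N T) chain s T k a b * Lop q j (sh j) (x * (u j)^-1) b d
  = \sum_(b <- states n N T) Lop q j (sh j) (x * (u j)^-1) a b
      * chain (fun r => s (tperm ord0 (lift ord0 j) r)) T k b d.
Proof.
move=> si sp + + dT; pose s' r := s (tperm ord0 (lift ord0 j) r); rewrite -/s'; set L := Lop _ _ _ _.
elim: k a => [|k IH] a al aT /=.
  transitivity (L a d).
    rewrite (bigD1_seq a) ?states_uniq ?mem_states //= eqxx mul1r big1 ?addr0 // => b.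
    by rewrite eq_sym => /negbTE ->; rewrite mul0r.
  rewrite (bigD1_seq d) ?states_uniq ?mem_states //= eqxx mulr1 big1 ?addr0 // => b.
  by move=> /negbTE ->; rewrite mulr0.
under eq_bigr do rewrite mulr_suml; rewrite exchange_big /=.
under [RHS]eq_bigr do rewrite mulr_sumr; rewrite [RHS]exchange_big /=.
case: insubP => [m _ mk|_]; last first.
  by rewrite !big1 // => c _; rewrite big1 // => b _; rewrite ?mul0r // mulr0 ?mul0r // mul0r mulr0.
transitivity (\sum_(c <- states n N T) \sum_(b <- states n N T) cmx m s a c * L c b * chain s' T k b d).
  apply: eq_big_seq => c; rewrite mem_states => cT.
  have [->|nz] := eqVneq (cmx m s a c) 0.
    by rewrite !big1 // => b _; rewrite !mul0r.
  have [cal _ _] := cmx_neq0 si nz.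
  under eq_bigr do rewrite -mulrA; rewrite -mulr_sumr IH // mulr_sumr.
  by apply: eq_bigr => b _; rewrite mulrA.
rewrite exchange_big; apply: eq_big_seq => b; rewrite mem_states => bT.
rewrite -mulr_suml /cmx (@column_ybe _ q q01 n N x u sh m (sv m) (v m) (wd0 m) (wdS m) wdL u0 (v0 m) j s si sp T a b al aT bT).
rewrite mulr_suml; apply: eq_bigr => c _; exact/esym/mulrA.
Qed.
End Chain.

Section StateRows.
Variables (n N : nat).
Local Notation row := ('I_N.+1).
Local Notation state := (state n N).
Local Notation ck := (@color_conf n).
Implicit Types (c : state) (H : row -> conf n).

Definition state_of (H : row -> conf n) : state :=
  (odflt ord0 [pick k | ck k == H ord0], [ffun j => H (lift ord0 j)]).

Lemma ck_inj : injective ck.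
Proof.
move=> k k'; case: (unliftP ord0 k) => [i|] ->; case: (unliftP ord0 k') => [i'|] ->;
  rewrite ?color_conf0 ?color_confS // => /ffunP.
- by move=> /(_ i); rewrite !ffunE eqxx; case: eqP => // ->.
- by move=> /(_ i); rewrite !ffunE eqxx.
- by move=> /(_ i'); rewrite !ffunE eqxx.
Qed.

Lemma rows_ofK c : state_of (rows_of c) = c.
Proof.
case: c => k f; rewrite /state_of /rows_of with_row0_0 /=; congr (_, _).
  by case: pickP => [k' /eqP /ck_inj //|/(_ k)]; rewrite eqxx.
by apply/ffunP => j; rewrite ffunE with_row0_S.
Qed.

Lemma rows_of_state H : (ctot (H ord0) <= 1)%N -> rows_of (state_of H) =1 H.
Proof.
move=> H1 r; case: (unliftP ord0 r) => [j|] ->; first by rewrite /rows_of with_row0_S ffunE.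
rewrite /rows_of with_row0_0 /=; case: pickP => [k /eqP //|h].
have [H0|Hp] := posnP (ctot (H ord0)).
  by have := h ord0; rewrite color_conf0 (csum0 H0) eqxx.
have [[i Hi]|nH] := pselect (exists i, (0 < H ord0 i)%N); last first.
  move: Hp; rewrite /ctot big1 // => i _; apply/eqP; rewrite -leqn0 leqNgt.
  by apply/negP => Hi; apply: nH; exists i.
have := csubK (A := H ord0) (B := cone i); rewrite cle_cone => /(_ Hi) E.
have := congr1 (@ctot n) E; rewrite ctotD ctot_cone => E'.
have := h (lift ord0 i); rewrite color_confS -E (csum0 (D := csub _ _)); last by lia.
by rewrite caddC cadd0 eqxx.
Qed.

Definition empty_state : state := (ord0, [ffun=> czero n]).
Lemma rows_empty r : rows_of empty_state r = czero n.
Proof.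
by case: (unliftP ord0 r) => [j|] ->; rewrite /rows_of ?with_row0_0 ?with_row0_S ?color_conf0 ?ffunE.
Qed.
End StateRows.

(** * The cylinder sum as an iterated sum over columns *)

Section Paths.
Variables (R : realType) (q : R).
Hypothesis q01 : 0 < q < 1.
Variables (n N : nat) (x : R[i]) (u sh : 'I_N -> R[i]) (v sv : 'I_n -> R[i]).
Hypothesis pwd : params_well_defined q x u sh v sv.
Local Notation row := ('I_N.+1).
Local Notation state := (state n N).
Local Notation rq := ((Num.sqrt q)%:C%C : R[i]).
Local Notation ck := (@color_conf n).
Local Notation rs := (with_row0 rq^-1 sh).
Local Notation ru := (with_row0 (x * rq) u).
Local Notation ycol := {ffun row -> conf n}.
Local Notation cwt := (@cweight R q n N x u sh v sv).
Local Notation chn := (@chain R q n N x u sh v sv id).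
Variables (T : nat) (b : state).
Implicit Types (a c d : state) (m : 'I_n) (k : nat) (Z : seq (ycol * state)).

(* Data of the columns [k-1, ..., 0] (from left to right), each with its right edge. *)
Fixpoint path_weight k a Z : R[i] :=
  match k, Z with
  | 0%N, [::] => (a == b)%:R
  | k'.+1, (y, c) :: Z' => (if (c \in states n N T) then
      if insub k' is Some m then cwt m id a c y else 0 else 0) * path_weight k' c Z'
  | _, _ => 0
  end.

(** Fubini: a list is its first column together with its tail, and the right edge of that column
    ranges over a finite list. *)
Lemma path_weight_sum k a : (k <= n)%N -> has_sum (path_weight k a) (chn T k a b) /\
  exists B, abs_bounded (path_weight k a) B.
Proof.
elim: k a => [|k IH] a kn.
  pose f Z : R[i] := if Z is [::] then (a == b)%:R else 0.
  have fE : path_weight 0 a = f by apply/funext => -[|[]].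
  have f0 Z : Z != [::] -> f Z = 0 by case: Z.
  rewrite fE; split; first exact: (has_sum_point f0).
  exists 1 => F; rewrite (@sum_fset_sub _ _ (F `&` [fset [::]])%fset) ?fsubsetIl //; last first.
    by move=> Z ZF; rewrite in_fsetI ZF /= in_fset1 => /f0 ->; rewrite normr0.
  apply: le_trans (fset_sum_le (f := fun Z => `|f Z|) _ (fsubsetIr _ _)) _ => //.
  by rewrite big_seq_fset1 /f; case: (a == b); rewrite ?normr1 ?normr0 ?ler01.
pose m := Ordinal kn; have iE : insub k = Some m by rewrite insubT.
have -> : chn T k.+1 a b = \sum_(c <- states n N T) cmx q x u sh v sv m id a c * chn T k c b.
  by rewrite /= iE.
pose e c (p : ycol * seq (ycol * state)) := (p.1, c) :: p.2.
(* The value on the empty list is arbitrary: [e c] never returns it, so the test in [g] fails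
   there. *)
pose d Z : ycol * seq (ycol * state) := if Z is z :: Z' then (z.1, Z') else (finfun (fun=> czero n), [::]).
pose f c (p : ycol * seq (ycol * state)) := cwt m id a c p.1 * path_weight k c p.2.
pose g c Z := if e c (d Z) == Z then f c (d Z) else 0.
have fs c : has_sum (f c) (cmx q x u sh v sv m id a c * chn T k c b) /\ exists B, abs_bounded (f c) B.
  have [B hB] := cweight_bounded q01 pwd m a c (@inj_id _).
  have [h1 [B' hB']] := IH c (ltnW kn).
  split; last by exists (B * B'); exact: abs_bounded_pair.
  have := has_sum_pair hB hB'; rewrite csum_cweight (has_sumE h1); exact.
have gs c : has_sum (g c) (cmx q x u sh v sv m id a c * chn T k c b) /\ exists B, abs_bounded (g c) B.
  have [h1 [B hB]] := fs c; split; last by exists B; exact: abs_bounded_push.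
  by apply: has_sum_push h1 _ => -[y Z].
have pE : path_weight k.+1 a = fun Z => \sum_(c <- states n N T) g c Z.
  apply/funext => -[|[y c] Z] /=.
    by rewrite big1.
  rewrite iE /g /d /e /=.
  have gE c' : ((y, c') :: Z == (y, c) :: Z) = (c' == c).
    by apply/eqP/eqP => [[]|->].
  under eq_bigr do rewrite gE.
  case: ifP => [cS|cS].
    rewrite (bigD1_seq c) ?states_uniq //= eqxx big1 ?addr0 // => c' /negbTE ->//.
  rewrite mul0r big1_seq // => c' /andP[_ c'S]; rewrite ifF //.
  by apply: contraFF cS => /eqP <-.
have [B hB] := choice (fun c => (gs c).2).
rewrite pE; split.
  by apply: has_sum_sum => c; exact: (gs c).1.
by exists (\sum_(c <- states n N T) B c); exact: abs_bounded_sum.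
Qed.
End Paths.

Section CylinderSum.
Variables (R : realType) (q : R).
Hypothesis q01 : 0 < q < 1.
Variables (n N : nat) (x : R[i]) (u sh : 'I_N -> R[i]) (v sv : 'I_n -> R[i]).
Hypothesis pwd : params_well_defined q x u sh v sv.
Local Notation row := ('I_N.+1).
Local Notation state := (state n N).
Local Notation rq := ((Num.sqrt q)%:C%C : R[i]).
Local Notation ck := (@color_conf n).
Local Notation rs := (with_row0 rq^-1 sh).
Local Notation ru := (with_row0 (x * rq) u).
Local Notation ycol := {ffun row -> conf n}.
Local Notation cwt := (@cweight R q n N x u sh v sv).
Local Notation chn := (@chain R q n N x u sh v sv id).
Local Notation cylconf :=
  ({ffun 'I_n.+1 * 'I_N.+1 -> conf n} * {ffun 'I_n * 'I_N.+1 -> vconf n})%type.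
Variables (T : nat) (b : state).
Implicit Types (a c d : state) (m : 'I_n) (k : nat) (Z : seq (ycol * state)) (F : cylconf).
Local Notation pw := (@path_weight R q n N x u sh v sv T b).
Local Notation emp := (empty_state n N).
Let y0 : ycol := [ffun=> czero n].

Lemma path_weight_canonical k a Z : pw k a Z != 0 ->
  size Z = k /\ forall m i r, (i + m).+1 = k -> offm m ((nth (y0, emp) Z i).1 r) = (nth (y0, emp) Z i).1 r.
Proof.
elim: k a Z => [|k IH] a [|[y c] Z] /=; rewrite ?eqxx //.
rewrite mulf_eq0 negb_or => /andP[]; case: ifP => _; last by rewrite eqxx.
case: insubP => [m' _ m'k|]; last by rewrite eqxx.
rewrite /cweight; case: ifP => _; last by rewrite eqxx.
rewrite /column_weight; case: ifP => [/forallP yc|]; last by rewrite eqxx.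
move=> _ /IH[sZ hZ]; split=> [|m [|i] r]; first by rewrite sZ.
  by rewrite add0n => -[mk]; rewrite (_ : m = m') /=; [apply/eqP|apply/val_inj; rewrite m'k -mk].
by rewrite addSn => -[h]; exact: hZ.
Qed.

(** The list runs through columns n - 1 down to 0. Edge k is the right edge of column k and edge n
    is the empty boundary, which is why the empty state is put in front and edges are read at n - k,
    columns at n - 1 - m. *)
Definition to_cyl Z : cylconf :=
  ([ffun p : 'I_n.+1 * row => rows_of (nth emp (emp :: map snd Z) (n - p.1)) p.2],
   [ffun p : 'I_n * row => vl p.1 (nth y0 (map fst Z) (n.-1 - p.1) p.2)]).
Definition col_of F m : ycol * state :=
  ([ffun r => [ffun i => fin_part (F.2 (m, r) i)]],
   state_of (fun r => F.1 (right_edge m, r))).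
Definition ncol F (i : nat) := if insub i is Some m then col_of F m else (y0, emp).
Definition cols F k := [seq ncol F i | i <- rev (iota 0 k)].
Definition edge F (i : nat) : state := if i == n then emp else (ncol F i).2.

Lemma size_cols F k : size (cols F k) = k.
Proof. by rewrite size_map size_rev size_iota. Qed.

Lemma nth_cols F k i : (i < k)%N -> nth (y0, emp) (cols F k) i = ncol F (k.-1 - i).
Proof.
move=> ik; rewrite (nth_map 0%N) ?size_rev ?size_iota // nth_rev ?size_iota // nth_iota; last by lia.
by congr (ncol F _); lia.
Qed.

Lemma ncolE F m : ncol F m = col_of F m.
Proof. by rewrite /ncol valK. Qed.

Lemma nth_edge F (i : 'I_n.+1) : nth emp (emp :: map snd (cols F n)) (n - i) = edge F i.
Proof.
rewrite /edge; have := ltn_ord i; rewrite ltnS leq_eqVlt; case: eqP => [->|_] /= h.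
  by rewrite subnn.
rewrite -[(n - i)%N]prednK ?subn_gt0 //= (nth_map (y0, emp)) ?size_cols; last by lia.
by rewrite nth_cols; [congr (ncol F _).2; lia|lia].
Qed.

Lemma nth_vert F m : nth y0 (map fst (cols F n)) (n.-1 - m) = (col_of F m).1.
Proof.
have mn := ltn_ord m; rewrite (nth_map (y0, emp)) ?size_cols; last by lia.
by rewrite nth_cols; [rewrite -ncolE; congr (ncol F _).1; lia|lia].
Qed.

Lemma to_cylK Z : pw n emp Z != 0 -> cols (to_cyl Z) n = Z.
Proof.
move=> /path_weight_canonical[sZ hZ]; apply: (@eq_from_nth _ (y0, emp)) => [|i].
  by rewrite size_cols.
rewrite size_cols => ik; have lt_n : (n.-1 - i < n)%N by lia.
rewrite nth_cols // /ncol insubT; set m := Sub _ _; have mE : m = (n.-1 - i)%N :> nat by [].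
rewrite [RHS]surjective_pairing; congr (_, _).
  apply/ffunP => r; apply/ffunP => j; rewrite 2!ffunE.
  have -> : (to_cyl Z).2 (m, r) = vl m (nth y0 (map fst Z) (n.-1 - m) r) by rewrite ffunE.
  rewrite fin_vl.
  rewrite (nth_map (y0, emp)); last by rewrite sZ mE; lia.
  have -> : (n.-1 - m)%N = i by rewrite mE; lia.
  by rewrite hZ // mE; lia.
rewrite -[RHS]rows_ofK; congr state_of; apply/funext => r; rewrite ffunE /=.
have -> : (n - m)%N = i.+1 by rewrite mE; lia.
by rewrite /= (nth_map (y0, emp)) // sZ.
Qed.

Definition col_term F (i : nat) : R[i] :=
  if (edge F i \in states n N T) then
    if insub i is Some m then cwt m id (edge F i.+1) (edge F i) (col_of F m).1 else 0 else 0.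

Lemma path_weight_cols F k : (k <= n)%N ->
  pw k (edge F k) (cols F k) = (edge F 0 == b)%:R * \prod_(i < k) col_term F i.
Proof.
elim: k => [|k IH] kn; first by rewrite big_ord0 mulr1.
have iE : iota 0 k.+1 = rcons (iota 0 k) k by rewrite -addn1 iotaD cats1.
have -> : cols F k.+1 = ncol F k :: cols F k by rewrite /cols iE rev_rcons.
have kE : (ncol F k).2 = edge F k by rewrite /edge ltn_eqF.
rewrite big_ord_recr mulrA -IH; last exact: ltnW.
pose m : 'I_n := Ordinal kn; have mE : insub k = Some m by rewrite insubT.
have nE : ncol F k = col_of F m by rewrite /ncol mE.
by rewrite nE (surjective_pairing (col_of F m)) -nE kE [RHS]mulrC /col_term /= mE nE.
Qed.

Lemma queueW_neq0 m (s1 s2 z : R[i]) A B C D : queueW q m s1 s2 z A B C D != 0 ->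
  [/\ forall i, i != m -> (fin_part (A i) + B i = fin_part (C i) + D i)%N,
             forall i : 'I_n, (i < m)%N -> D i = 0%N,
             queue_allowed q s1 (ctot B) & queue_allowed q s1 (ctot D)].
Proof. by rewrite /queueW; case: asboolP => //; rewrite eqxx. Qed.

Section Fixed.
Variable F : cylconf.
Local Notation W := (cyl_weight q ru rs v sv F).
Local Notation Rb := (rows_of b).

Lemma cyl_weight_neq0 : W != 0 -> forall m r,
  [/\ forall i, i != m -> (fin_part (F.2 (m, r) i) + F.1 (left_edge m, r) i
         = fin_part (F.2 (m, ordS r) i) + F.1 (right_edge m, r) i)%N,
      forall i : 'I_n, (i < m)%N -> F.1 (right_edge m, r) i = 0%N,
      queue_allowed q (rs r) (ctot (F.1 (left_edge m, r)))
    & queue_allowed q (rs r) (ctot (F.1 (right_edge m, r)))].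
Proof.
move=> /prodf_neq0 h m r; have /prodf_neq0/(_ r isT) := h m isT.
exact: queueW_neq0.
Qed.

(** Nonzero weight and s = q^{-1/2} leave at most one arrow on each edge of row 0, so its tuples are
    colors and no information is lost. *)
Lemma cyl_fixed : cyl_admissible Rb F -> W != 0 -> to_cyl (cols F n) = F.
Proof.
move=> [h1 h2 h3] /cyl_weight_neq0 h; case: (F) h1 h2 h3 h => H V h1 h2 h3 h; congr (_, _).
  apply/ffunP => -[i r]; rewrite ffunE nth_edge /edge /=.
  have := ltn_ord i; rewrite ltnS leq_eqVlt; case: eqP => [iE _|_ /= lt_i].
    by rewrite rows_empty (_ : i = ord_max) ?h1 //; apply/val_inj.
  have iE : right_edge (Ordinal lt_i) = i by apply/val_inj.
  rewrite /ncol insubT /= rows_of_state ?iE //.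
  have [_ _ _] := h (Ordinal lt_i) ord0; rewrite with_row0_0 iE; apply=> //.
  by rewrite expr1 fmorphV.
apply/ffunP => -[m r]; rewrite ffunE nth_vert /=; apply/ffunP => i; rewrite !ffunE /=.
have [h4 h5 h6] := h3 m r; case: (eqVneq i m) => [->|im]; first by rewrite h4.
case: (ltngtP m i) => mi.
- by have := h6 i mi; case: (V (m, r) i).
- by rewrite h5.
by rewrite (val_inj mi) eqxx in im.
Qed.

Section Present.
Hypothesis bT : (arrows b <= T)%N.
Hypothesis bp : forall i, (0 < content b i)%N.
Hypothesis fx : to_cyl (cols F n) = F.

Lemma edge_rows (i : 'I_n.+1) r : rows_of (edge F i) r = F.1 (i, r).
Proof. by rewrite -[in RHS]fx ffunE nth_edge. Qed.

Lemma vert_rows m r : F.2 (m, r) = vl m ((col_of F m).1 r).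
Proof. by rewrite -[in LHS]fx ffunE nth_vert. Qed.

Lemma admissibleE : cyl_admissible Rb F <-> edge F 0 = b.
Proof.
split=> [[_ h _]|eb].
  rewrite -[LHS]rows_ofK -[RHS]rows_ofK; congr state_of; apply/funext => r.
  by rewrite (edge_rows ord0).
split=> [r|r|m r].
- by rewrite -edge_rows /edge eqxx rows_empty.
- by rewrite -edge_rows eb.
rewrite vert_rows; split=> [|i im|i mi]; rewrite ffunE.
- by rewrite eqxx.
- rewrite ifF; last by apply/eqP => e; rewrite e ltnn in im.
  by rewrite ffunE ltnNge (ltnW im).
- by rewrite ifF //; apply/eqP => e; rewrite e ltnn in mi.
Qed.

Lemma edge_content : edge F 0 = b -> W != 0 -> forall k, (k <= n)%N -> forall i : 'I_n, (k <= i)%N ->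
  (\sum_r F.1 (inord k, r) i)%N = content b i.
Proof.
move=> eb /cyl_weight_neq0 h; elim=> [|k IH] kn i ki.
  rewrite -eb; apply: eq_bigr => r _; rewrite -edge_rows; congr (rows_of (edge F _) _ _).
  by rewrite inordK.
rewrite -IH; [|exact: ltnW|exact: ltnW].
pose m := Ordinal kn; have im : i != m by rewrite -val_eqE /= gtn_eqF.
have -> : inord k.+1 = left_edge m by apply/val_inj; rewrite /= inordK // lift0.
have -> : inord k = right_edge m by apply/val_inj; rewrite /= inordK // ltnW.
apply: (@addnI (\sum_r fin_part (F.2 (m, r) i))).
rewrite -big_split [X in _ = (X + _)%N](reindex_inj (@ordS_inj _)) -big_split /=.
by apply: eq_bigr => r _; have [-> ] := h m r.
Qed.

(** For nonzero weight all guards of [col_term] hold: to the right of column m the colors below m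
    are absent and the others have the content of b, so T arrows suffice and color m is present. *)
Lemma col_termE : edge F 0 = b -> W != 0 -> forall m, col_term F m =
  \prod_r queueW q m (rs r) (sv m) (ru r / v m) (F.2 (m, r)) (F.1 (left_edge m, r))
            (F.2 (m, ordS r)) (F.1 (right_edge m, r)).
Proof.
move=> eb W0 m; have h := cyl_weight_neq0 W0.
have Er r : rows_of (edge F m) r = F.1 (right_edge m, r) by rewrite -edge_rows.
have El r : rows_of (edge F m.+1) r = F.1 (left_edge m, r) by rewrite -edge_rows /left_edge lift0.
have Ec (i : 'I_n) : (m <= i)%N -> content (edge F m) i = content b i.
  move=> mi; rewrite -(edge_content eb W0 (ltnW (ltn_ord m)) mi); apply: eq_bigr => r _.
  rewrite Er; congr (F.1 (_, r) i); apply/val_inj; rewrite /= inordK //.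
  exact: ltnW (ltn_ord m).
have E0 (i : 'I_n) r : (i < m)%N -> F.1 (right_edge m, r) i = 0%N by have [_ + _ _] := h m r; apply.
rewrite /col_term ifT; last first.
  rewrite mem_states; apply: leq_trans bT; apply: leq_sum => i _.
  case: (leqP m i) => mi; first by rewrite Ec.
  by rewrite /content big1 // => r _; rewrite Er E0.
rewrite valK /cweight ifT; last first.
  apply/and3P; split.
  - apply/forallP => r; apply/forallP => i; apply/implyP => im; rewrite El.
    have := ltn_ord m; rewrite leq_eqVlt => /orP[/eqP mn|mn].
      rewrite -edge_rows (_ : nat_of_ord (left_edge m) = n); last by rewrite /left_edge lift0.
      by rewrite /edge eqxx rows_empty ffunE.
    have -> : left_edge m = right_edge (Ordinal mn) by apply/val_inj; exact: lift0.
    by have [_ -> //] := h (Ordinal mn) r.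
  - by apply/forallP => r; apply/forallP => i; apply/implyP => im; rewrite Er E0.
  have := bp m; rewrite -Ec // /content lt0n sum_nat_eq0 negb_forall => /existsP[r hr].
  by apply/existsP; exists r; rewrite lt0n.
rewrite /column_weight ifT; last first.
  apply/forallP => r; apply/eqP/ffunP => i.
  by rewrite -fin_vl -vert_rows !ffunE.
by apply: eq_bigr => r _; rewrite /row_weight Er El -!vert_rows.
Qed.

Lemma col_term0 : edge F 0 = b -> W = 0 -> \prod_(i < n) col_term F i = 0.
Proof.
move=> eb /eqP/prodf_eq0[m _ /eqP m0]; apply/eqP/prodf_eq0; exists m => //.
rewrite /col_term; case: ifP => // _; rewrite valK /cweight; case: ifP => // _.
rewrite /column_weight; case: ifP => // _; rewrite -m0; apply/eqP/eq_bigr => r _.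
by rewrite /row_weight -!vert_rows -!edge_rows /left_edge lift0.
Qed.

End Present.
End Fixed.

(** If a color is missing, the chain vanishes by [chain_content], in agreement with the convention.
    Otherwise [to_cyl] matches the lists and the cylinder configurations of nonzero weight. *)
Lemma cyl_partition_chain : (arrows b <= T)%N ->
  cyl_partition q ru rs v sv (rows_of b) = chn T n emp b.
Proof.
move=> bT; rewrite /cyl_partition.
have prE : [forall i : 'I_n, exists r, (0 < rows_of b r i)%N] = [forall i : 'I_n, (0 < content b i)%N].
  apply: eq_forallb => i; apply/existsP/idP => [[r hr]|].
    by rewrite /content (bigD1 r) //= ltn_addr.
  rewrite /content lt0n sum_nat_eq0 negb_forall => /existsP[r hr].
  by exists r; rewrite lt0n.
rewrite prE; case: forallP => [bp|nbp]; last first.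
  apply/esym/eqP; apply: contra_notT nbp => /(chain_content q01 pwd (@inj_id _))[_ h] i.
  exact/h/ltn_ord.
apply: has_sumE.
have := has_sum_push (e := to_cyl) (d := fun F => cols F n)
  (path_weight_sum q01 pwd T b emp (leqnn n)).1 to_cylK.
congr has_sum; apply/funext => F; case: eqP => [fx|nfx]; last first.
  case: asboolP => // ad; apply/esym/eqP; apply: contra_notT nfx => W0.
  exact: cyl_fixed.
have -> : emp = edge F n by rewrite /edge eqxx.
rewrite path_weight_cols //; case: asboolP => [/(admissibleE fx) eb|nad]; last first.
  by case: eqP => [eb|_]; [case: nad; apply/admissibleE|rewrite mul0r].
rewrite eb eqxx mul1r.
have [W0|W0] := eqVneq (cyl_weight q ru rs v sv F) 0.
  by rewrite W0 col_term0.
by rewrite /cyl_weight; apply: eq_bigr => m _; exact: col_termE.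
Qed.
End CylinderSum.

(** * Composition of operators on row vectors *)

Section Operators.
Variables (R : realType) (n N : nat).
Local Notation state := (state n N).
Local Notation opmx := (opmx R n N).
Implicit Types (a b c d : state) (S L : opmx) (phi psi : state -> R[i]).

Definition preserves_arrows S := forall a b, S a b != 0 -> arrows a = arrows b.

Lemma op_act_states phi S T b : preserves_arrows S -> (arrows b <= T)%N ->
  op_act phi S b = \sum_(a <- states n N T) phi a * S a b.
Proof.
move=> hS bT; rewrite /op_act (@fsbig_states _ _ _ T) // => a.
by rewrite mulf_eq0 negb_or => /andP[_ /hS ->].
Qed.

Lemma op_mul_states S L T a b : preserves_arrows L -> (arrows b <= T)%N ->
  op_mul S L a b = \sum_(c <- states n N T) S a c * L c b.
Proof. exact: op_act_states. Qed.

Lemma op_id_arrows : preserves_arrows (@op_id R n N).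
Proof. by move=> a b; rewrite /op_id; case: (a =P b) => [->|]; rewrite ?eqxx. Qed.

Lemma op_mul_arrows S L : preserves_arrows S -> preserves_arrows L ->
  preserves_arrows (op_mul S L).
Proof.
move=> hS hL a b; rewrite (op_mul_states _ _ hL (leqnn _)) => h.
have [c _] : exists2 c, c \in states n N (arrows b) & S a c * L c b != 0.
  by apply/hasP; apply: contraNT h => /hasPn h; rewrite big1_seq // => c /h /negPn/eqP.
by rewrite mulf_eq0 negb_or => /andP[/hS -> /hL].
Qed.

(** Preservation of arrows confines both sums to one finite list, where they may be interchanged. *)
Lemma op_act_mul phi S L b : preserves_arrows S -> preserves_arrows L ->
  op_act phi (op_mul S L) b = op_act (op_act phi S) L b.
Proof.
move=> hS hL; rewrite (op_act_states _ (op_mul_arrows hS hL) (leqnn _)).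
rewrite (op_act_states _ hL (leqnn _)).
under eq_bigr do rewrite (op_mul_states _ _ hL (leqnn _)) mulr_sumr.
rewrite exchange_big; apply: eq_big_seq => c; rewrite mem_states => cb.
by rewrite (op_act_states _ hS cb) mulr_suml; apply: eq_bigr => a _; rewrite mulrA.
Qed.

Lemma Lop_arrows q j (s z : R[i]) : preserves_arrows (Lop q j s z).
Proof. by move=> a b /Lop_exchange/exchange_arrows. Qed.
End Operators.

(* The positions of the rows on the cylinder once row [0] has been moved below
   the rows [N, ..., k + 1]. *)
Definition pos N k (r : 'I_N.+1) : 'I_N.+1 :=
  if r == ord0 then ordS (inord k) else if (r <= k)%N then r else ordS r.

Lemma pos_last N : @pos N N = id.
Proof.
apply/funext => r; rewrite /pos -ltnS ltn_ord; case: eqP => // ->.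
by apply/val_inj; rewrite /= inordK // modnn.
Qed.

(** Row 0 has passed all the others: the cyclic order is the original one, shifted by one position,
    which [cmx_ordS] does not notice. *)
Lemma pos_first N : @pos N 0 = @ordS N.+1.
Proof.
apply/funext => r; rewrite /pos leqn0 -(inj_eq val_inj) /=.
by case: eqP => // r0; congr ordS; apply/val_inj; rewrite /= inordK.
Qed.

Lemma pos_tperm N (j : 'I_N) r : pos j.+1 (tperm ord0 (lift ord0 j) r) = pos j r.
Proof.
have jN := ltn_ord j; have jE : lift ord0 j = inord j.+1 by apply/val_inj; rewrite /= inordK.
case: tpermP => [->|->|/eqP r0 /eqP rj].
- have l0 : (lift ord0 j == ord0) = false by apply/negbTE; rewrite eq_sym neq_lift.
  rewrite /pos eqxx l0 lift0 leqnn; apply/val_inj; rewrite /= /bump leq0n add1n inordK; last exact: ltnW.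
  by rewrite modn_small.
- have l0 : (lift ord0 j == ord0) = false by apply/negbTE; rewrite eq_sym neq_lift.
  by rewrite /pos eqxx l0 lift0 ltnn jE.
rewrite /pos (negbTE r0); congr (if _ then _ else _).
have : nat_of_ord r != j.+1 by apply: contraNneq rj => rE; apply/eqP/val_inj; rewrite /= rE.
lia.
Qed.

Lemma ordS_pos N (j : 'I_N) : ordS (pos j.+1 (lift ord0 j)) = pos j.+1 ord0.
Proof.
have l0 : (lift ord0 j == ord0) = false by apply/negbTE; rewrite eq_sym neq_lift.
rewrite /pos eqxx l0 lift0 leqnn; congr ordS; apply/val_inj; rewrite /= inordK //.
exact: ltn_ord.
Qed.

Lemma pos_inj N k : (k <= N)%N -> injective (@pos N k).
Proof.
move=> kN; rewrite -(subKn kN); elim: (N - k)%N (leq_subr k N) => [|d IH] dN.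
  by rewrite subn0 pos_last; exact: inj_id.
have jN : (N - d.+1 < N)%N by lia.
pose j := Ordinal jN; have jE : (j.+1 = N - d)%N by rewrite /=; lia.
move=> r r'; rewrite -!(pos_tperm j) jE => /(IH (ltnW dN)); exact: perm_inj.
Qed.

(** * Row 0 carried once around the cylinder *)

Section Stationarity.
Variables (R : realType) (q : R).
Hypothesis q01 : 0 < q < 1.
Variables (n N : nat) (x : R[i]) (u sh : 'I_N -> R[i]) (v sv : 'I_n -> R[i]).
Hypothesis pwd : params_well_defined q x u sh v sv.
Local Notation emp := (empty_state n N).
Local Notation ck := (@color_conf n).
Local Notation chn := (@chain R q n N x u sh v sv).
Local Notation Lj j := (@Lop R q n N j (sh j) (x * (u j)^-1)).
Variable T : nat.

Lemma chain_pos0 k a b : chn (@pos N 0) T k a b = chn id T k a b.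
Proof.
rewrite pos_first; elim: k a => //= k IH a; apply: eq_bigr => c _; rewrite IH.
by case: (insub k : option 'I_n) => [m|]; [rewrite (cmx_ordS q01 pwd)|].
Qed.

(** With no arrow to exchange, only the empty state is reachable; its weight is 1 - s z over itself,
    for z = x/u_j. *)
Lemma Lop_empty j c : Lj j emp c = (c == emp)%:R.
Proof.
have [->|ce] := eqVneq c emp; last first.
  apply/eqP; apply: contraNT ce => /Lop_exchange/exchangeP[-> /=].
  rewrite ffunE color_conf0 cadd0; case: (unliftP ord0 c.1) => [i|] ->.
    by rewrite color_confS cle_cone ffunE.
  move=> _; apply/eqP; congr (_, _); apply/ffunP => j'; rewrite !ffunE.
  by rewrite color_conf0 cadd0 csub0; case: ifP.
case: pwd => _ _ _ /(_ j)[s0 z0 sz].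
rewrite /Lop ifT /=; last by apply/forallP => j'; apply/implyP.
rewrite (LweightE q01 _ _ _ _ s0 z0 sz) eqxx /ell unlift_none /= ffunE ctot0 expr0 mulr1 divff //.
by have := sz 1%N; rewrite /qpoch big_ord_recr big_ord0 /= expr0 mulr1 mul1r.
Qed.

Lemma empty_arrows : arrows emp = 0%N.
Proof.
by rewrite /arrows big1 // => i _; rewrite /content big1 // => r _; rewrite rows_empty ffunE.
Qed.

Lemma act_Lop (psi : state n N -> R[i]) (j : 'I_N) :
  (forall d, (arrows d <= T)%N -> psi d = chn (@pos N j.+1) T n emp d) ->
  forall d, (arrows d <= T)%N -> op_act psi (Lj j) d = chn (@pos N j) T n emp d.
Proof.
move=> h d dT; rewrite (op_act_states _ (@Lop_arrows _ _ _ _ _ _ _) dT).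
transitivity (\sum_(b <- states n N T) chn (@pos N j.+1) T n emp b * Lj j b d).
  by apply: eq_big_seq => b; rewrite mem_states => /h ->.
rewrite (chain_ybe q01 pwd) ?empty_arrows ?ordS_pos //; first 1 last.
- by apply: pos_inj; exact: ltn_ord.
- by rewrite ffunE ctot0 => L.
rewrite (bigD1_seq emp) ?states_uniq ?mem_states ?empty_arrows //= Lop_empty eqxx mul1r big1 ?addr0.
  by congr (chain _ _ _ _ _ _ _ _ _ _ _); apply/funext => r; exact: pos_tperm.
by move=> c /negbTE ce; rewrite Lop_empty ce mul0r.
Qed.

(** The values of [psi] on states with more than T arrows stay free, since operators preserving
    arrows never bring them in; this allows the induction to replace [psi] by its image. *)
Lemma act_straight k psi : (k <= N)%N ->
  (forall d, (arrows d <= T)%N -> psi d = chn (@pos N k) T n emp d) ->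
  forall d, (arrows d <= T)%N ->
  op_act psi (foldr (@op_mul R n N) (@op_id R n N) [seq Lj j | j <- rev (take k (enum 'I_N))]) d
  = chn (@pos N 0) T n emp d.
Proof.
have pr (l : seq 'I_N) : preserves_arrows (foldr (@op_mul R n N) (@op_id R n N) [seq Lj j | j <- l]).
  elim: l => [|j l IH] /=; first exact: op_id_arrows.
  by apply: op_mul_arrows; [exact: Lop_arrows|].
elim: k psi => [|k IH] psi kN h d dT.
  rewrite take0 /= (op_act_states _ (@op_id_arrows _ _ _) dT).
  rewrite (bigD1_seq d) ?states_uniq ?mem_states //= /op_id eqxx mulr1 h // big1 ?addr0 // => a /negbTE ->.
  by rewrite mulr0.
pose j := Ordinal kN; rewrite (take_nth j) ?size_enum_ord // rev_rcons /=.
rewrite (_ : nth j (enum 'I_N) k = j); last exact: (nth_ord_enum j j).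
rewrite (op_act_mul _ _ (@Lop_arrows _ _ _ _ _ _ _) (pr _)).
by apply: IH => //; [exact: ltnW|exact: (act_Lop (j := j))].
Qed.
End Stationarity.

Theorem theorem3p6 (R : realType) (n N : nat) (q : R) (x : R[i])
    (u sh : 'I_N -> R[i]) (v sv : 'I_n -> R[i]) :
  (1 <= n)%N -> (1 <= N)%N -> 0 < q < 1 ->
  params_well_defined q x u sh v sv ->
  forall b : state n N,
    op_act (queue_vector q x u sh v sv) (straight_op q x u sh) b
    = queue_vector q x u sh v sv b.
Proof.
move=> _ _ q01 pwd b.
(* T is the number of arrows of b, which covers every state that the straight operator can lead to
   b. *)
have qE d : (arrows d <= arrows b)%N -> queue_vector q x u sh v sv d =
    chain q x u sh v sv id (arrows b) n (empty_state n N) d.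
  exact: cyl_partition_chain.
rewrite [RHS]qE // -(chain_pos0 q01 pwd) /straight_op.
rewrite -[enum 'I_N](take_size) size_enum_ord.
by apply: (act_straight q01 pwd (leqnn N)) => // d /qE ->; rewrite pos_last.
Qed.
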